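(* Let $\alpha\in(0,2)$, let $\Omega=(a_x,b_x)\times(a_y,b_y)\times(a_z,b_z)\subset\mathbb{R}^3$ be a bounded box, and let $u:\mathbb{R}^3\to\mathbb{R}$ satisfy $u=0$ on $\mathbb{R}^3\setminus\Omega$. Let $0<\varepsilon\le 1+\lfloor\alpha\rfloor-\alpha$ and assume $u\in C^{2+\lfloor\alpha\rfloor,\,\alpha-\lfloor\alpha\rfloor+\varepsilon}(\mathbb{R}^3)$. Then with splitting parameter $\gamma=2$ there is a constant $C>0$ independent of $h$ such that, for all sufficiently small $h=L/N$, $$\sup_{\mathbf{x}\in\Omega}\big|(-\Delta)^{\alpha/2}u(\mathbf{x})-(-\Delta)^{\alpha/2}_{h,2}u(\mathbf{x})\big|\le C h^{2}.$$
   Context: $\lfloor\cdot\rfloor$ is the floor function. For $k\in\mathbb{N}_0$, $s\in(0,1]$, $C^{k,s}(\mathbb{R}^d)$ is the space of functions $\mathbb{R}^d\to\mathbb{R}$ with continuous partial derivatives of all orders $\le k$ whose $k$-th order partial derivatives are uniformly Hölder continuous with exponent $s$. The fractional Laplacian is $(-\Delta)^{\alpha/2}u(\mathbf{x})=c_{d,\alpha}\,\mathrm{P.V.}\int_{\mathbb{R}^d}\frac{u(\mathbf{x})-u(\mathbf{x}')}{|\mathbf{x}-\mathbf{x}'|^{d+\alpha}}\,d\mathbf{x}'$ with $c_{d,\alpha}=\frac{2^{\alpha-1}\alpha\,\Gamma((d+\alpha)/2)}{\pi^{d/2}\Gamma(1-\alpha/2)}$. Three-dimensional discrete operator: let $L=\max\{b_x-a_x,b_y-a_y,b_z-a_z\}$,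 $N$ a positive integer, $h=L/N$, $\boldsymbol{\xi}_{ijk}=(ih,jh,kh)$, $I_{ijk}=[ih,(i+1)h]\times[jh,(j+1)h]\times[kh,(k+1)h]$, $D_1=(0,L)^3$, $D_2=[0,\infty)^3\setminus D_1$. For $\mathbf{x}=(x,y,z)$, $\boldsymbol{\xi}=(\xi,\eta,\zeta)\in[0,\infty)^3\setminus\{0\}$ set $\psi_\gamma(\mathbf{x},\boldsymbol{\xi})=|\boldsymbol{\xi}|^{-\gamma}\Big(\sum_{m,n,s\in\{0,1\}}u(x+(-1)^m\xi,\,y+(-1)^n\eta,\,z+(-1)^s\zeta)-8u(\mathbf{x})\Big)$ and $\omega_\gamma(\boldsymbol{\xi})=|\boldsymbol{\xi}|^{\gamma-(3+\alpha)}$. For $(m,n,s)\in\{0,1\}^3\setminus\{(0,0,0)\}$ let $c^\gamma_{mns}=1$ if $\gamma\in(\alpha,2)$; if $\gamma=2$, $c^2_{mns}=8/3$ when $m+n+s=1$ and $c^2_{mns}=0$ when $m+n+s>1$. Define, for $\mathbf{x}\in\Omega$, $$(-\Delta)^{\alpha/2}_{h,\gamma}u(\mathbf{x})=-c_{3,\alpha}\Big[\tfrac18\Big(\sum_{(m,n,s)\ne(0,0,0)}c^\gamma_{mns}\psi_\gamma(\mathbf{x},\boldsymbol{\xi}_{mns})\Big)\int_{I_{000}}\omega_\gamma\,d\boldsymbol{\xi}+\tfrac18\sum_{\substack{0\le i,j,k\le N-1\\(i,j,k)\ne(0,0,0)}}\Big(\sum_{m,n,s\in\{0,1\}}\psi_\gamma(\mathbf{x},\boldsymbol{\xi}_{(i+m)(j+n)(k+s)})\Big)\int_{I_{ijk}}\omega_\gamma\,d\boldsymbol{\xi}-8u(\mathbf{x})\int_{D_2}|\boldsymbol{\xi}|^{-(3+\alpha)}d\boldsymbol{\xi}\Big].$$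 *)

(* Defs.v *)
From HB Require Import structures.
From mathcomp Require Import all_boot all_order all_algebra.
From mathcomp Require Import all_classical all_reals all_analysis.
Set Implicit Arguments. Unset Strict Implicit. Unset Printing Implicit Defensive.
Import Order.TTheory GRing.Theory Num.Theory numFieldNormedType.Exports.
Local Open Scope ring_scope.
Local Open Scope classical_set_scope.

Definition pt (R : realType) := (R * R * R)%type.
Definition mkpt (R : realType) (x y z : R) : pt R := (x, y, z).

Definition enorm (R : realType) (p : pt R) : R :=
  Num.sqrt (p.1.1 ^+ 2 + p.1.2 ^+ 2 + p.2 ^+ 2).
Definition edist (R : realType) (p q : pt R) : R :=
  enorm (mkpt (p.1.1 - q.1.1) (p.1.2 - q.1.2) (p.2 - q.2)).

Definition leb3 (R : realType) :=
  ((@lebesgue_measure R \x @lebesgue_measure R) \x @lebesgue_measure R)%E.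

Definition Gamma (R : realType) (s : R) : R :=
  Rintegral (@lebesgue_measure R) [set t : R | 0 < t]
    (fun t => t `^ (s - 1) * expR (- t)).

Definition c_const (R : realType) (d : nat) (alpha : R) : R :=
  2 `^ (alpha - 1) * alpha * Gamma ((d%:R + alpha) / 2)
  / (pi `^ (d%:R / 2) * Gamma (1 - alpha / 2)).

Definition fraclap (R : realType) (alpha : R) (u : pt R -> R) (x : pt R) : R :=
  c_const 3 alpha *
  lim ((fun e : R =>
          Rintegral (@leb3 R) [set y : pt R | e < edist x y]
            (fun y => (u x - u y) / (edist x y) `^ (3 + alpha))) @ 0^'+).

Definition ebasis (R : realType) (i : 'I_3) : pt R :=
  if val i == 0%N then mkpt 1 0 0 else if val i == 1%N then mkpt 0 1 0
  else mkpt 0 0 1.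

Fixpoint pder (R : realType) (l : seq 'I_3) (f : pt R -> R) : pt R -> R :=
  match l with
  | [::] => f
  | i :: l' => fun x => 'D_(ebasis R i) (pder l' f) x
  end.

Definition holder_space (R : realType) (k : nat) (s : R) (f : pt R -> R) : Prop :=
  (forall (l : seq 'I_3) (i : 'I_3) (x : pt R),
      (size l < k)%N -> derivable (pder l f) x (ebasis R i)) /\
  (forall l : seq 'I_3, (size l <= k)%N -> continuous (pder l f)) /\
  (exists M : R, forall (l : seq 'I_3) (x y : pt R), size l = k ->
      `|pder l f x - pder l f y| <= M * (edist x y) `^ s).

Definition box (R : realType) (ax bx ay by_ az bz : R) : set (pt R) :=
  [set p | ax < p.1.1 < bx /\ ay < p.1.2 < by_ /\ az < p.2 < bz].

Section Discrete.
Variables (R : realType) (alpha gamma L : R) (N : nat) (u : pt R -> R).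

Definition hstep : R := L / N%:R.

Definition xi (i j k : nat) : pt R := mkpt (i%:R * hstep) (j%:R * hstep) (k%:R * hstep).

Definition cell (i j k : nat) : set (pt R) :=
  [set p | i%:R * hstep <= p.1.1 <= (i.+1)%:R * hstep /\
           j%:R * hstep <= p.1.2 <= (j.+1)%:R * hstep /\
           k%:R * hstep <= p.2 <= (k.+1)%:R * hstep].

Definition D1 : set (pt R) := [set p | 0 < p.1.1 < L /\ 0 < p.1.2 < L /\ 0 < p.2 < L].
Definition D2 : set (pt R) := [set p | 0 <= p.1.1 /\ 0 <= p.1.2 /\ 0 <= p.2] `\` D1.

Definition psi (x e : pt R) : R :=
  (enorm e) `^ (- gamma) *
  ((\sum_(m < 2) \sum_(n < 2) \sum_(s < 2)
      u (mkpt (x.1.1 + (-1) ^+ m * e.1.1) (x.1.2 + (-1) ^+ n * e.1.2)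
              (x.2 + (-1) ^+ s * e.2))) - 8 * u x).

Definition omega (e : pt R) : R := (enorm e) `^ (gamma - (3 + alpha)).

Definition ccoef (m n s : nat) : R :=
  if gamma == 2 then (if (m + n + s == 1)%N then 8 / 3 else 0) else 1.

Definition disc_fraclap (x : pt R) : R :=
  - c_const 3 alpha *
  ( 8^-1 * (\sum_(m < 2) \sum_(n < 2) \sum_(s < 2 | (m + n + s != 0)%N)
               ccoef m n s * psi x (xi m n s))
      * Rintegral (@leb3 R) (cell 0 0 0) omega
  + 8^-1 * (\sum_(i < N) \sum_(j < N) \sum_(k < N | (i + j + k != 0)%N)
        (\sum_(m < 2) \sum_(n < 2) \sum_(s < 2) psi x (xi (i + m) (j + n) (k + s)))
        * Rintegral (@leb3 R) (cell i j k) omega)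
  - 8 * u x * Rintegral (@leb3 R) D2 (fun e => (enorm e) `^ (- (3 + alpha)))).
End Discrete.

(* Main.v *)
Require Import Defs.
From HB Require Import structures.
From mathcomp Require Import all_boot all_order all_algebra.
From mathcomp Require Import all_classical all_reals all_analysis.
From mathcomp Require Import unstable measurable_realfun.
From mathcomp Require Import ring lra.
Set Implicit Arguments. Unset Strict Implicit. Unset Printing Implicit Defensive.
Import Order.TTheory GRing.Theory Num.Theory numFieldNormedType.Exports.
Local Open Scope ring_scope.
Local Open Scope classical_set_scope.

(** Folding the principal value over the eight sign patterns turns the fractional
    Laplacian into minus the integral over the positive octant of
    [psi_2(x, xi) omega_2(xi)], where [psi_2 = |xi|^-2 S] and [S] is the symmetrized
    difference of [u].  Outside the cube [[0, L]^3] one has [S = - 8 u(x)] exactly, so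
    the error is that of the weighted trapezoidal rule for [psi_2] on the cube.

    Write [S = 4 sum_i u_ii(x) xi_i^2 + T].  The rule is invariant under permutations
    of the coordinates, hence its errors for the three functions [xi_i^2 / |xi|^2]
    agree; they add up to the error for the constant 1, which is zero.  So only
    [Q = T / |xi|^2] contributes.  By the Hoelder hypothesis [T] is of order
    [alpha + eps + 2] at 0, with matching first and second differences.  On a cell with
    centre [c] the reflection [xi -> 2 c - xi] shows that twice the error is the
    integral of
      [(Q - A) omega + (Q' - A) omega' = (Q + Q' - 2 A) (omega + omega') / 2
                                        + (Q - Q') (omega - omega') / 2],
    primes denoting values at the reflected point and [A] the average of [Q] over the
    corners; this is bounded by [C h^2 |xi|^(eps - 3)], which is integrable on the cube. *)

(** * Coordinatewise differences *)

Section Calculus.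
Context {R : realType}.
Implicit Types (f : pt R -> R) (d : 'I_3 -> pt R -> R) (p q : pt R).

(** Two obstacles shape the proof. The first is the direction-dependent part of [psi_2] at 0: the
    functions xi_i^2 / |xi|^2 are homogeneous of degree 0, so their differences at distance r from 0
    have size h/r and h^2/r^2, and a cellwise estimate against |xi|^(-1-alpha) gives only
    h^(2-alpha). Hence this part is removed exactly, by symmetry. The coefficients 8/3 serve this
    purpose: the origin is dropped from its cell, and the three axis nodes carry total weight 3 *
    8/3 = 8, which keeps constants exact. The second is that alpha + eps ranges over (0, 2], so that
    one Hoelder bound on the Hessian cannot express the regularity. Symmetric second differences of
    order alpha + eps can, and all later estimates use only these. On the scale r they give [T] the
    sizes r^2, r |p - q| and |v|^2 for values, first and second differences, each times
    r^(alpha+eps). Dividing by r^2 and multiplying by r^(-1-alpha) leaves r^(eps-3), so eps > 0 is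
    exactly what integrability at 0 requires. Balls are taken in the sup norm, where a path that
    changes one coordinate at a time stays inside; it differs from the Euclidean norm by a factor of
    at most 2. *)

Definition co (i : 'I_3) p : R :=
  if val i == 0%N then p.1.1 else if val i == 1%N then p.1.2 else p.2.

Lemma ebasisE (i : 'I_3) (x y z s : R) : (x, y, z) + s *: ebasis R i =
  (x + s * (val i == 0%N)%:R, y + s * (val i == 1%N)%:R,
   z + s * (val i == 2%N)%:R) :> pt R.
Proof. by case: i => [[|[|[|//]]] ?]; rewrite /ebasis /mkpt /=. Qed.

Lemma ebasisNE (i : 'I_3) (x y z s : R) : (x, y, z) - s *: ebasis R i =
  (x - s * (val i == 0%N)%:R, y - s * (val i == 1%N)%:R,
   z - s * (val i == 2%N)%:R) :> pt R.
Proof. by case: i => [[|[|[|//]]] ?]; rewrite /ebasis /mkpt /=. Qed.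

Lemma pnorm_le p r : (`|p| <= r) = [&& `|p.1.1| <= r, `|p.1.2| <= r & `|p.2| <= r].
Proof. by rewrite prod_normE /= ge_max prod_normE /= ge_max andbA. Qed.

(** Partial derivatives as one-variable derivatives along coordinate lines. In this form the mean
    value theorem on the real line applies directly. *)
Definition haspd f d := forall i p (t : R),
  is_derive t (1 : R) (fun s : R => f (p + s *: ebasis R i)) (d i (p + t *: ebasis R i)).

Lemma derivable_haspd f : (forall i p, derivable f p (ebasis R i)) ->
  haspd f (fun i p => 'D_(ebasis R i) f p).
Proof.
move=> df i p t; have := df i (p + t *: ebasis R i).
rewrite /derivable /derive => c.
have E : (fun h : R => h^-1 *: ((fun s => f (p + s *: ebasis R i)) (h *: 1 + t)
   - f (p + t *: ebasis R i))) = (fun h => h^-1 *: (f (h *: ebasis R i +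
     (p + t *: ebasis R i)) - f (p + t *: ebasis R i))).
  apply/funext => h; congr (_ *: (f _ - _)).
  by rewrite scalerDl addrCA addrA [h *: (1 : R)]mulr1 addrA.
by split; rewrite /derivable /derive /= E.
Qed.

Lemma line_bound (g dg : R -> R) (B : R) : (forall t : R, is_derive t (1 : R) g (dg t)) ->
  (forall t, 0 <= t <= 1 -> `|dg t| <= B) -> `|g 1 - g 0| <= B.
Proof.
move=> dgP b.
have [|c cI ->] := @MVT_segment R g dg 0 1 ler01 (fun x _ => dgP x).
  by apply: derivable_within_continuous => x _; case: (dgP x).
by rewrite subr0 mulr1 b //; move: cI; rewrite in_itv.
Qed.

Lemma haspd_line f d i p (h t : R) : haspd f d ->
  is_derive t (1 : R) (fun t : R => f (p + (t * h) *: ebasis R i))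
    (h * d i (p + (t * h) *: ebasis R i)).
Proof.
move=> fd; have -> : (fun t : R => f (p + (t * h) *: ebasis R i)) =
  (fun s => f (p + s *: ebasis R i)) \o (fun t => t * h) by [].
rewrite mulrC; apply: is_derive1_comp; first exact: fd.
have -> : (fun t : R => t * h) = h \*: (@idfun R).
  by apply/funext => s; rewrite /= mulrC.
by apply: is_derive_eq; rewrite /GRing.scale /= mulr1.
Qed.

Lemma pd_step f d i p (h B : R) : haspd f d ->
  (forall t : R, 0 <= t <= 1 -> `|d i (p + (t * h) *: ebasis R i)| <= B) ->
  `|f (p + h *: ebasis R i) - f p| <= B * `|h|.
Proof.
move=> fd b.
have := @line_bound (fun t => f (p + (t * h) *: ebasis R i))
  (fun t => h * d i (p + (t * h) *: ebasis R i)) (B * `|h|).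
rewrite mul1r mul0r scale0r addr0; apply => t; first exact: haspd_line.
by move=> /b t01; rewrite normrM mulrC ler_wpM2r.
Qed.

(** The two points move in opposite directions, so the derivative of the sum is a difference of
    partial derivatives and only their oscillation enters. *)
Lemma pd_step2 f d i p q (h B : R) : haspd f d ->
  (forall t : R, 0 <= t <= 1 -> `|d i (p + (t * h) *: ebasis R i)
     - d i (q - (t * h) *: ebasis R i)| <= B) ->
  `|f (p + h *: ebasis R i) + f (q - h *: ebasis R i) - (f p + f q)| <= B * `|h|.
Proof.
move=> fd b.
have := @line_bound (fun t => f (p + (t * h) *: ebasis R i) +
     f (q + (t * - h) *: ebasis R i))
  (fun t => h * d i (p + (t * h) *: ebasis R i) +
     - h * d i (q + (t * - h) *: ebasis R i)) (B * `|h|).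
rewrite !mul1r !mul0r !scale0r !addr0 scaleNr; apply => t; last first.
  by move=> /b t01; rewrite mulrN scaleNr mulNr -mulrBr normrM mulrC ler_wpM2r.
by apply: is_deriveD; exact: haspd_line.
Qed.

Lemma conv_le (a b t r : R) : 0 <= t <= 1 -> `|a| <= r -> `|b| <= r ->
  `|a + t * (b - a)| <= r.
Proof.
move=> t01; rewrite !ler_norml => ar br; apply/andP; split; nra.
Qed.

(** One coordinate is changed at a time, which stays in the sup-norm ball; the 3 counts the legs of
    the path. *)
Lemma pd_lip f d (r B : R) p q : haspd f d ->
  (forall i q, `|q| <= r -> `|d i q| <= B) ->
  `|p| <= r -> `|q| <= r -> `|f p - f q| <= 3 * B * `|p - q|.
Proof.
case: p => [[x y] z]; case: q => [[x' y'] z'] fd b.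
have b0 : `|(x, y, z) : pt R| <= r -> 0 <= B.
  by move=> /(b ord0); apply: le_trans.
move=> pr; have {}b0 := b0 pr; move: pr.
rewrite !pnorm_le /= => /and3P[xr yr zr] /and3P[x'r y'r z'r].
set N := `|((x, y, z) : pt R) - _|.
have := lexx N; rewrite {1}/N pnorm_le /= => /and3P[nx ny nz].
have {}ny : `|y - y'| <= N := ny.
have {}nx : `|x - x'| <= N := nx.
have {}nz : `|z - z'| <= N := nz.
pose i1 : 'I_3 := @Ordinal 3 1 isT; pose i2 : 'I_3 := @Ordinal 3 2 isT.
have h0 : `|f (x, y', z') - f (x', y', z')| <= B * `|x - x'|.
  have := @pd_step f d ord0 (x', y', z') (x - x') B fd.
  rewrite ebasisE /= !mulr0 !addr0 mulr1 subrKC; apply => t t01.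
  by rewrite b // ebasisE pnorm_le /= !mulr0 !addr0 y'r z'r !andbT mulr1 conv_le.
have h1 : `|f (x, y, z') - f (x, y', z')| <= B * `|y - y'|.
  have := @pd_step f d i1 (x, y', z') (y - y') B fd.
  rewrite ebasisE /= !mulr0 !addr0 mulr1 subrKC; apply => t t01.
  by rewrite b // ebasisE pnorm_le /= !mulr0 !addr0 xr z'r !andbT mulr1 conv_le.
have h2 : `|f (x, y, z) - f (x, y, z')| <= B * `|z - z'|.
  have := @pd_step f d i2 (x, y, z') (z - z') B fd.
  rewrite ebasisE /= !mulr0 !addr0 mulr1 subrKC; apply => t t01.
  by rewrite b // ebasisE pnorm_le /= !mulr0 !addr0 xr yr mulr1 conv_le.
have -> : f (x, y, z) - f (x', y', z') = (f (x, y, z) - f (x, y, z')) +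
  (f (x, y, z') - f (x, y', z')) + (f (x, y', z') - f (x', y', z')) by ring.
apply: (le_trans (ler_normD _ _)).
have t1 := ler_normD (f (x, y, z) - f (x, y, z')) (f (x, y, z') - f (x, y', z')).
have : B * `|x - x'| <= B * N by rewrite ler_wpM2l.
have : B * `|y - y'| <= B * N by rewrite ler_wpM2l.
have : B * `|z - z'| <= B * N by rewrite ler_wpM2l.
move=> e1 e2 e3; clearbody N. lra.
Qed.

(** Both c + v and c - v are moved to c by three simultaneous coordinate steps. At each moment the
    two moving points are at distance at most 2 |v|, so [pd_step2] turns the Hoelder bound on the
    gradient into a factor (2 |v|)^s |v| per step. *)
Lemma pd_second f d (r M s : R) (c v : pt R) : haspd f d -> 0 <= s ->
  (forall i p q, `|p| <= r -> `|q| <= r -> `|d i p - d i q| <= M * `|p - q| `^ s) ->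
  0 <= M -> `|c + v| <= r -> `|c - v| <= r ->
  `|f (c + v) + f (c - v) - 2 * f c| <= 3 * M * (2 * `|v|) `^ s * `|v|.
Proof.
case: c => [[x y] z]; case: v => [[a b] c] fd s0 dd M0.
rewrite !pnorm_le /= => /and3P[x1 y1 z1] /and3P[x2 y2 z2].
set N := `|((a, b, c) : pt R)|.
have := lexx N; rewrite {1}/N pnorm_le /= => /and3P[na nb nc].
have N0 : 0 <= N := normr_ge0 _.
pose i1 : 'I_3 := @Ordinal 3 1 isT; pose i2 : 'I_3 := @Ordinal 3 2 isT.
have K (x0 a0 t : R) : `|x0 + a0| <= r -> `|x0 - a0| <= r -> 0 <= t <= 1 ->
    `|x0 + t * a0| <= r /\ `|x0 - t * a0| <= r.
  move=> h1 h2 t01; have : `|x0| <= r.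
    by move: h1 h2; rewrite !ler_norml => *; lra.
  move: h1 h2; rewrite !ler_norml => *; split; nra.
have K0 (x0 a0 : R) : `|x0 + a0| <= r -> `|x0 - a0| <= r -> `|x0| <= r.
  by rewrite !ler_norml => *; lra.
have D (x0 a0 : R) : `|a0| <= N -> forall t : R, 0 <= t <= 1 -> `|x0 + t * a0 - (x0 - t * a0)| <= 2 * N.
  move=> aN t t01; have -> : x0 + t * a0 - (x0 - t * a0) = 2 * (t * a0) by ring.
  rewrite normrM normr_nat ler_wpM2l // normrM (ger0_norm (_ : 0 <= t)); last lra.
  by have := normr_ge0 a0; nra.
have D1 (x0 a0 : R) : `|a0| <= N -> `|x0 + a0 - (x0 - a0)| <= 2 * N.
  by move=> /(D x0) /(_ 1); rewrite ler01 lexx mul1r; apply.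
have D0 (x0 : R) : `|x0 - x0| <= 2 * N by rewrite subrr normr0 mulr_ge0.
have dB i p q : `|p| <= r -> `|q| <= r -> `|p - q| <= 2 * N ->
    `|d i p - d i q| <= M * (2 * N) `^ s.
  move=> pr qr pq; apply: (le_trans (dd _ _ _ pr qr)); rewrite ler_wpM2l //.
  by apply: ge0_ler_powR => //; rewrite nnegrE // mulr_ge0.
set B := M * (2 * N) `^ s.
have B0 : 0 <= B by rewrite mulr_ge0 // powR_ge0.
have h0 : `|f (x + a, y + b, z + c) + f (x - a, y - b, z - c) -
   (f (x, y + b, z + c) + f (x, y - b, z - c))| <= B * `|a|.
  have := @pd_step2 f d ord0 (x, y + b, z + c) (x, y - b, z - c) a B fd.
  rewrite ebasisE ebasisNE /= !mulr0 !subr0 !addr0 !mulr1; apply => t t01.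
  have [e1 e2] := K _ _ _ x1 x2 t01.
  apply: dB; rewrite ?ebasisE ?ebasisNE pnorm_le /= !mulr0 ?subr0 ?addr0 ?mulr1.
  - by rewrite e1 y1 z1.
  - by rewrite e2 y2 z2.
  - by rewrite D // !D1.
have h1 : `|f (x, y + b, z + c) + f (x, y - b, z - c) -
   (f (x, y, z + c) + f (x, y, z - c))| <= B * `|b|.
  have := @pd_step2 f d i1 (x, y, z + c) (x, y, z - c) b B fd.
  rewrite ebasisE ebasisNE /= !mulr0 !subr0 !addr0 !mulr1; apply => t t01.
  have [e1 e2] := K _ _ _ y1 y2 t01; have e3 := K0 _ _ x1 x2.
  apply: dB; rewrite ?ebasisE ?ebasisNE pnorm_le /= !mulr0 ?subr0 ?addr0 ?mulr1.
  - by rewrite e1 e3 z1.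
  - by rewrite e2 e3 z2.
  - by rewrite D // D0 !D1.
have h2 : `|f (x, y, z + c) + f (x, y, z - c) - (f (x, y, z) + f (x, y, z))| <= B * `|c|.
  have := @pd_step2 f d i2 (x, y, z) (x, y, z) c B fd.
  rewrite ebasisE ebasisNE /= !mulr0 !subr0 !addr0 !mulr1; apply => t t01.
  have [e1 e2] := K _ _ _ z1 z2 t01; have e3 := K0 _ _ x1 x2.
  have e4 := K0 _ _ y1 y2.
  apply: dB; rewrite ?ebasisE ?ebasisNE pnorm_le /= !mulr0 ?subr0 ?addr0 ?mulr1.
  - by rewrite e1 e3 e4.
  - by rewrite e2 e3 e4.
  - by rewrite D // !D0.
have {}h0 := le_trans h0 (ler_wpM2l B0 na).
have {}h1 := le_trans h1 (ler_wpM2l B0 nb).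
have {}h2 := le_trans h2 (ler_wpM2l B0 nc).
rewrite [X in `|X|](_ : _ = (f (x + a, y + b, z + c) + f (x - a, y - b, z - c) -
   (f (x, y + b, z + c) + f (x, y - b, z - c))) + (f (x, y + b, z + c) + f (x, y - b, z - c) -
   (f (x, y, z + c) + f (x, y, z - c))) + (f (x, y, z + c) + f (x, y, z - c) - (f (x, y, z) + f (x, y, z)))); last first.
  rewrite (_ : (x, y, z) + (a, b, c) = (x + a, y + b, z + c)) //.
  rewrite (_ : (x, y, z) - (a, b, c) = (x - a, y - b, z - c)) //.
  ring.
apply: (le_trans (ler_normD _ _)).
have -> : 3 * M * (2 * N) `^ s * N = B * N + B * N + B * N by rewrite /B; ring.
apply: lerD => //; apply: (le_trans (ler_normD _ _)); exact: lerD.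
Qed.

End Calculus.

(** * Symmetrized Taylor remainder *)

Section Symmetrization.
Context {R : realType}.
Implicit Types (f u : pt R -> R) (d : 'I_3 -> pt R -> R) (p q x v : pt R).
Implicit Types (s : 'I_2 * 'I_2 * 'I_2) (w : 'I_2 * 'I_2 * 'I_2 -> R).

Definition sgs s : pt R := ((-1) ^+ s.1.1, (-1) ^+ s.1.2, (-1) ^+ s.2).
Definition pmul (a p : pt R) : pt R := (a.1.1 * p.1.1, a.1.2 * p.1.2, a.2 * p.2).

Lemma haspd_ext f d d' : haspd f d -> (forall i p, d i p = d' i p) -> haspd f d'.
Proof. by move=> fd e i p t; rewrite -e; exact: fd. Qed.

Lemma haspd_cst (a : R) : haspd (fun=> a) (fun _ _ => 0).
Proof. move=> i p t; exact: is_derive_cst. Qed.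

Lemma haspdD f1 f2 d1 d2 : haspd f1 d1 -> haspd f2 d2 ->
  haspd (fun p => f1 p + f2 p) (fun i p => d1 i p + d2 i p).
Proof. by move=> h1 h2 i p t; exact: is_deriveD (h1 i p t) (h2 i p t). Qed.

Lemma haspdZ (a : R) f d : haspd f d ->
  haspd (fun p => a * f p) (fun i p => a * d i p).
Proof. by move=> h1 i p t; exact: is_deriveZ (h1 i p t). Qed.

Lemma haspd_sum (I : Type) (r : seq I) (F : I -> pt R -> R)
    (D : I -> 'I_3 -> pt R -> R) : (forall k, haspd (F k) (D k)) ->
  haspd (fun p => \sum_(k <- r) F k p) (fun i p => \sum_(k <- r) D k i p).
Proof.
move=> FD; elim: r => [|k r IH].
  rewrite (_ : (fun p => _) = fun=> 0); last by apply/funext => p; rewrite big_nil.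
  apply: (haspd_ext (haspd_cst 0)) => i p. by rewrite big_nil.
rewrite (_ : (fun p => _) = fun p => F k p + \sum_(k <- r) F k p); last first.
  by apply/funext => p; rewrite big_cons.
by apply: (haspd_ext (haspdD (FD k) IH)) => i p; rewrite big_cons.
Qed.

Lemma co_line i j p (t : R) : co j (p + t *: ebasis R i) = co j p + t * (i == j)%:R.
Proof.
case: p => [[x y] z]; rewrite ebasisE /co -val_eqE.
by case: i => [[|[|[|//]]] ?]; case: j => [[|[|[|//]]] ?].
Qed.

Lemma haspd_co j : haspd (co j : pt R -> R) (fun i _ => (i == j)%:R).
Proof.
move=> i p t.
have -> : (fun s : R => co j (p + s *: ebasis R i)) =
    cst (co j p) + (i == j)%:R \*: @idfun R.
  by apply/funext => s; rewrite co_line mulrC.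
rewrite -[X in is_derive _ _ _ X](_ : 0 + (i == j)%:R *: 1 = _); last first.
  by rewrite add0r /GRing.scale /= mulr1.
exact: is_deriveD.
Qed.

Lemma haspd_sqr j : haspd (fun p : pt R => co j p ^+ 2)
  (fun i p => 2 * (i == j)%:R * co j p).
Proof.
move=> i p t; set g := fun s : R => co j (p + s *: ebasis R i).
have -> : (fun s : R => co j (p + s *: ebasis R i) ^+ 2) = g * g.
  by apply/funext => s; rewrite expr2.
rewrite -[X in is_derive _ _ _ X](_ : g t *: (i == j)%:R + g t *: (i == j)%:R = _).
  by apply: is_deriveM; exact: haspd_co.
by rewrite /GRing.scale /= /g; ring.
Qed.

Lemma pmul_line s i p (t : R) :
  pmul (sgs s) (p + t *: ebasis R i) = pmul (sgs s) p + (t * co i (sgs s)) *: ebasis R i.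
Proof.
case: p => [[x y] z]; rewrite ebasisE /pmul /= ebasisE.
case: i => [[|[|[|//]]] ?] /=; rewrite ?mulr0 ?addr0 ?mulr1 mulrDr;
  by congr (_, _, _); congr (_ + _); rewrite mulrC.
Qed.

(** The weights make this family closed under partial differentiation in p: each derivative
    multiplies [w] by a coordinate of the sign pattern. *)
Definition symsum w f x p := \sum_s w s * f (x + pmul (sgs s) p).

Lemma haspd_symsum w f d x : haspd f d -> haspd (symsum w f x)
  (fun i => symsum (fun s => w s * co i (sgs s)) (d i) x).
Proof.
move=> fd; apply: (@haspd_sum _ _ (fun s p => w s * f (x + pmul (sgs s) p))
  (fun s i p => w s * co i (sgs s) * d i (x + pmul (sgs s) p))) => s.
apply: (@haspd_ext _ (fun i p => w s * (co i (sgs s) * d i (x + pmul (sgs s) p)))); last first.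
  by move=> i p; rewrite mulrA.
apply: haspdZ => i p t.
under eq_fun do rewrite pmul_line addrA.
by rewrite pmul_line addrA; apply: haspd_line.
Qed.

(** Orthogonality of the sign characters. It is why mixed second derivatives drop out of the
    symmetrized sum and only the diagonal of the Hessian survives at the origin. *)
Lemma sum_sign i j : \sum_s co i (sgs s) * co j (sgs s) = 8 * (i == j)%:R.
Proof.
rewrite -(pair_bigA _ (fun a b => co i (sgs (a, b)) * co j (sgs (a, b)))) /=.
rewrite -(pair_bigA _ (fun a b => \sum_c co i (sgs (a, b, c)) * co j (sgs (a, b, c)))) /=.
rewrite -val_eqE !big_ord_recr !big_ord0 /= /co /sgs /=.
by case: i => [[|[|[|//]]] ?]; case: j => [[|[|[|//]]] ?] /=;
  rewrite ?expr0 ?expr1; ring.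
Qed.

Lemma sum_sign1 i : \sum_s co i (sgs s) = 0.
Proof.
rewrite -(pair_bigA _ (fun a b => co i (sgs (a, b)))) /=.
rewrite -(pair_bigA _ (fun a b => \sum_c co i (sgs (a, b, c)))) /=.
rewrite !big_ord_recr !big_ord0 /= /co /sgs /=.
by case: i => [[|[|[|//]]] ?] /=; rewrite ?expr0 ?expr1; ring.
Qed.

Lemma normr_sgs i s : `|co i (sgs s)| = 1.
Proof. by rewrite /co /sgs; case: ifP => _; [|case: ifP => _]; rewrite normrX normrN1 expr1n. Qed.

Lemma pmul0 p : pmul p 0 = 0.
Proof. by rewrite /pmul /= !mulr0. Qed.

Lemma normr_pmul s p : `|pmul (sgs s) p| = `|p|.
Proof.
by rewrite [LHS]prod_normE [RHS]prod_normE /= !prod_normE /= !normrM !normrX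
  !normrN1 !expr1n !mul1r.
Qed.

Definition anti s : 'I_2 * 'I_2 * 'I_2 := (rev_ord s.1.1, rev_ord s.1.2, rev_ord s.2).

Lemma anti_inv : involutive anti.
Proof. by move=> [[a b] c]; rewrite /anti /= !rev_ordK. Qed.

Lemma sgs_anti s : sgs (anti s) = - sgs s.
Proof.
have E (a : 'I_2) : (-1) ^+ (rev_ord a) = - (-1) ^+ a :> R.
  by case: a => [[|[|//]] ?] /=; rewrite ?expr0 ?expr1 ?opprK.
by rewrite /sgs /= !E.
Qed.

Lemma pmulN p q : pmul (- p) q = - pmul p q.
Proof. by rewrite /pmul /= !mulNr. Qed.

Lemma coN i p : co i (- p) = - co i p.
Proof. by rewrite /co; case: ifP => // _; case: ifP. Qed.

(** Antipodal sign patterns carry the same weight, a product of two signs. Pairing them writes twice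
    the left side as a sum of eight second differences of f at x, whence 8 / 2 = 4. *)
Lemma symsum2_bound i j f x p (K b : R) : 0 <= b ->
  (forall v, `|f (x + v) + f (x - v) - 2 * f x| <= K * `|v| `^ b) ->
  `|symsum (fun s => co i (sgs s) * co j (sgs s)) f x p - 8 * (i == j)%:R * f x|
    <= 4 * K * `|p| `^ b.
Proof.
move=> b0 H; set W := fun s => _.
have E : 2 * (symsum W f x p - 8 * (i == j)%:R * f x) =
    \sum_s W s * (f (x + pmul (sgs s) p) + f (x - pmul (sgs s) p) - 2 * f x).
  have E1 : symsum W f x p = \sum_s W s * f (x - pmul (sgs s) p).
    rewrite /symsum (reindex_inj (inv_inj anti_inv)) /=; apply: eq_bigr => s _.
    by rewrite /W sgs_anti pmulN !coN mulrNN.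
  have E2 : 2 * symsum W f x p = symsum W f x p + \sum_s W s * f (x - pmul (sgs s) p).
    by rewrite -E1; ring.
  rewrite -sum_sign mulrBr E2 mulr_suml mulr_sumr /symsum.
  rewrite -big_split /= -sumrB; apply: eq_bigr => s _; rewrite /W.
  by ring.
have : `|2 * (symsum W f x p - 8 * (i == j)%:R * f x)| <= 8 * (K * `|p| `^ b).
  rewrite E; apply: (le_trans (ler_norm_sum _ _ _)).
  apply: (@le_trans _ _ (\sum_(s : 'I_2 * 'I_2 * 'I_2) (K * `|p| `^ b))).
    apply: ler_sum => s _; rewrite normrM /W normrM !normr_sgs !mul1r.
    by rewrite -(normr_pmul s p); exact: H.
  by rewrite sumr_const card_prod card_prod !card_ord -[leLHS]mulr_natl (_ : (2 * 2 * 2)%N = 8%N).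
rewrite normrM normr_nat => h; lra.
Qed.

(* [T] is the symmetrized difference of [u] minus its quadratic Taylor part,
   [D] being the diagonal of the Hessian at [x]. *)
Definition taylor_rem u (D : 'I_3 -> R) x p :=
  symsum (fun=> 1) u x p + (- 8 * u x + - 4 * \sum_(i < 3) D i * co i p ^+ 2).

(** The quadratic term in [T] is chosen so that the Hessian of [T] vanishes at 0; by [symsum2_bound]
    it is at most 4 K r^b on the ball. As the gradient [G] and [T] itself also vanish at 0,
    integrating twice with [pd_lip] gives 12 and 36. The second difference uses [pd_second] with the
    Lipschitz gradient: 3 * 12 * 2 = 72. *)
Lemma taylor_rem_bounds u g (h : 'I_3 -> 'I_3 -> pt R -> R) (K b : R) :
  0 <= K -> 0 <= b -> haspd u g -> (forall i, haspd (g i) (fun j => h i j)) ->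
  (forall i j x v, `|h i j (x + v) + h i j (x - v) - 2 * h i j x| <= K * `|v| `^ b) ->
  forall x (r : R), 0 < r -> let T := taylor_rem u (fun i => h i i x) x in
  (forall p, `|p| <= r -> `|T p| <= 36 * K * (r `^ b * r ^+ 2)) /\
  (forall p q, `|p| <= r -> `|q| <= r -> `|T p - T q| <= 36 * K * (r `^ b * r) * `|p - q|) /\
  (forall c v, `|c + v| <= r -> `|c - v| <= r ->
    `|T (c + v) + T (c - v) - 2 * T c| <= 72 * K * r `^ b * `|v| ^+ 2).
Proof.
move=> K0 b0 ug gh H x r r0 T.
pose G i p := symsum (fun s => 1 * co i (sgs s)) (g i) x p + (- 8 * h i i x) * co i p.
pose GG i j p := symsum (fun s => 1 * co i (sgs s) * co j (sgs s)) (h i j) x p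
   + (- 8 * h i i x) * (j == i)%:R.
have TG : haspd T G.
  have -> : T = fun p => symsum (fun=> 1) u x p + (- 8 * u x +
    - 4 * \sum_(i < 3) h i i x * co i p ^+ 2) by [].
  apply: haspd_ext.
    apply: haspdD; first exact: haspd_symsum ug.
    apply: haspdD; first exact: haspd_cst.
    by apply/haspdZ/haspd_sum => i; apply/haspdZ/haspd_sqr.
  move=> i p /=; rewrite /G; congr (_ + _).
  rewrite (bigD1 i) //= big1 ?eqxx; last by move=> k /negbTE; rewrite eq_sym => ->; rewrite !(mulr0, mul0r).
  rewrite /= !mulr1n. ring.
have GGG i : haspd (G i) (fun j => GG i j).
  apply: haspdD; first exact: haspd_symsum.
  by apply: haspdZ; apply: (haspd_ext (haspd_co i)).
have r1 : 0 <= r := ltW r0.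
have GGb i j p : `|p| <= r -> `|GG i j p| <= 4 * K * r `^ b.
  move=> pr; have := @symsum2_bound i j (h i j) x p K b b0 (H i j x).
  rewrite /GG.
  have -> : (fun s => 1 * co i (sgs s) * co j (sgs s)) =
      (fun s => co i (sgs s) * co j (sgs s)) by apply/funext => s; rewrite mul1r.
  have -> : - 8 * h i i x * (j == i)%:R = - (8 * (i == j)%:R * h i j x).
    by have [->|_] := eqVneq i j; rewrite ?eqxx ?mulr1n ?mulr0n; ring.
  move=> /le_trans; apply; rewrite ler_wpM2l ?mulr_ge0 //.
  by apply: ge0_ler_powR; rewrite ?nnegrE.
have r00 : `|0 : pt R| <= r by rewrite normr0.
have Gl i p q : `|p| <= r -> `|q| <= r -> `|G i p - G i q| <= 12 * K * r `^ b * `|p - q|.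
  move=> pr qr; have := pd_lip (GGG i) (GGb i) pr qr.
  by rewrite (_ : 3 * (4 * K * r `^ b) = 12 * K * r `^ b) //; ring.
have P0 : 0 <= 12 * K * r `^ b by rewrite !mulr_ge0 // powR_ge0.
have Gb i p : `|p| <= r -> `|G i p| <= 12 * K * r `^ b * r.
  move=> pr; have := Gl i p 0 pr r00.
  have -> : G i 0 = 0.
    rewrite /G /symsum; under eq_bigr do rewrite pmul0 addr0 mul1r.
    rewrite -mulr_suml sum_sign1 mul0r add0r /co /=.
    by case: ifP => _; [|case: ifP => _]; rewrite mulr0.
  rewrite !subr0 => /le_trans; apply; exact: ler_wpM2l.
have Tl p q : `|p| <= r -> `|q| <= r -> `|T p - T q| <= 36 * K * (r `^ b * r) * `|p - q|.
  move=> pr qr; have := pd_lip TG Gb pr qr.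
  by rewrite (_ : 3 * (12 * K * r `^ b * r) = 36 * K * (r `^ b * r)) //; ring.
split; [|split => //].
- move=> p pr; have := Tl p 0 pr r00.
  have -> : T 0 = 0.
    rewrite /T /taylor_rem /symsum; under eq_bigr do rewrite pmul0 addr0 mul1r.
    rewrite sumr_const card_prod card_prod !card_ord [X in _ + (_ + _ * X)]big1.
      by rewrite -mulr_natl; ring.
    by move=> i _; rewrite /co /=; case: ifP => _; [|case: ifP => _]; rewrite expr0n mulr0.
  rewrite !subr0 => /le_trans; apply.
  have -> : 36 * K * (r `^ b * r ^+ 2) = 36 * K * (r `^ b * r) * r by ring.
  by rewrite ler_wpM2l // !mulr_ge0 // powR_ge0.
- move=> c v cv1 cv2; have := @pd_second _ T G r (12 * K * r `^ b) 1 c v TG ler01.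
  rewrite powRr1 ?mulr_ge0 //.
  have -> : 3 * (12 * K * r `^ b) * (2 * `|v|) * `|v| = 72 * K * r `^ b * `|v| ^+ 2 by ring.
  apply=> //; first by move=> i p' q' pr qr; rewrite powRr1 //; exact: Gl.
  exact: powR_ge0.
Qed.

End Symmetrization.

(** * Norm comparison and the regularity hypothesis *)

Section Holder.
Context {R : realType}.
Implicit Types (f u : pt R -> R) (p q x v : pt R).

Lemma enorm_ge0 p : 0 <= enorm p.
Proof. exact: sqrtr_ge0. Qed.

Lemma enorm_sqr p : enorm p ^+ 2 = p.1.1 ^+ 2 + p.1.2 ^+ 2 + p.2 ^+ 2.
Proof. by rewrite sqr_sqrtr // !addr_ge0 // sqr_ge0. Qed.

Lemma normr_le_enorm p : `|p| <= enorm p.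
Proof.
have E (a b : R) : a ^+ 2 <= b ^+ 2 -> 0 <= b -> `|a| <= b.
  move=> ab b0; rewrite -(@ler_pXn2r _ 2) ?nnegrE //.
  by rewrite -normrX ger0_norm ?sqr_ge0.
have e0 := enorm_ge0 p.
by rewrite pnorm_le; apply/and3P; split; apply: E => //; rewrite enorm_sqr;
  have := sqr_ge0 p.1.1; have := sqr_ge0 p.1.2; have := sqr_ge0 p.2; lra.
Qed.

Lemma enorm_le_normr p : enorm p <= 2 * `|p|.
Proof.
rewrite -(@ler_pXn2r _ 2) ?nnegrE ?enorm_ge0 ?mulr_ge0 // enorm_sqr.
have := lexx `|p|; rewrite {1}pnorm_le => /and3P[].
set N := `|p|; have E (a : R) : `|a| <= N -> a ^+ 2 <= N ^+ 2.
  by move=> aN; rewrite -[a ^+ 2]ger0_norm ?sqr_ge0 // normrX ler_pXn2r ?nnegrE // /N.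
move=> /E h1 /E h2 /E h3; have := sqr_ge0 N.
have -> : (2 * N) ^+ 2 = 4 * N ^+ 2 by ring.
by move=> *; lra.
Qed.

Lemma edistE p q : Defs.edist p q = enorm (p - q).
Proof. by []. Qed.

Lemma holder_haspd (k : nat) (s : R) u (l : seq 'I_3) : holder_space k s u ->
  (size l < k)%N -> haspd (pder l u) (fun i => pder (i :: l) u).
Proof. by move=> [du _] lk; apply: derivable_haspd => i p; exact: du. Qed.

Lemma holder_normr (k : nat) (s : R) u : holder_space k s u -> 0 <= s <= 1 ->
  exists2 M : R, 0 <= M & forall (l : seq 'I_3) p q, size l = k ->
    `|pder l u p - pder l u q| <= M * `|p - q| `^ s.
Proof.
(* The Euclidean norm is at most twice the sup norm and 2^s <= 2; the absolute value is there
   because [M] comes without a sign. *)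
move=> [_ [_ [M HM]]] /andP[s0 s1]; exists (2 * `|M|); first by rewrite mulr_ge0.
move=> l p q lk; apply: (le_trans (HM l p q lk)).
have e : Defs.edist p q `^ s <= 2 * `|p - q| `^ s.
  rewrite edistE; apply: (@le_trans _ _ ((2 * `|p - q|) `^ s)).
    by apply: ge0_ler_powR; rewrite ?nnegrE ?enorm_ge0 ?mulr_ge0 ?enorm_le_normr.
  rewrite powRM // ler_wpM2r ?powR_ge0 // -[leRHS]powRr1 //.
  by rewrite ler_powR // ler1n.
apply: (@le_trans _ _ (`|M| * Defs.edist p q `^ s)).
  by rewrite ler_wpM2r ?powR_ge0 // ler_norm.
by have := ler_wpM2l (normr_ge0 M) e; rewrite mulrCA mulrA.
Qed.

(* The second differences of the Hessian have order [alpha + eps], whether this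
   exponent lies below or above 1. *)
Lemma holder_second_difference (alpha eps : R) u : 0 < alpha < 2 ->
  0 < eps <= 1 + (Num.floor alpha)%:~R - alpha ->
  holder_space (2 + `|Num.floor alpha|)%N (alpha - (Num.floor alpha)%:~R + eps) u ->
  alpha + eps <= 2 /\
  haspd u (fun i => pder [:: i] u) /\
  (forall i, haspd (pder [:: i] u) (fun j => pder [:: j; i] u)) /\
  exists2 K : R, 0 <= K & forall i j x v,
   `|pder [:: j; i] u (x + v) + pder [:: j; i] u (x - v) - 2 * pder [:: j; i] u x|
     <= K * `|v| `^ (alpha + eps).
Proof.
move=> /andP[a0 a2].
have [a1|a1] := ltP alpha 1.
- have -> : Num.floor alpha = 0.
    by apply/eqP; rewrite floor_eq (ltW a0) add0r.
  rewrite /= addr0 subr0 => /andP[e0 e1] hu.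
  split; first lra.
  split; first exact: (holder_haspd (l := [::]) hu).
  split; first by move=> i; exact: (holder_haspd (l := [:: i]) hu).
  have [|M M0 HM] := holder_normr hu; first by apply/andP; split; lra.
  (* For alpha < 1 the Hessian itself is Hoelder of exponent alpha + eps, and a second difference is
     a sum of two first differences. *)
  exists (2 * M); first by rewrite mulr_ge0.
  move=> i j x v.
  have := HM [:: j; i] (x + v) x erefl.
  have := HM [:: j; i] (x - v) x erefl.
  rewrite [x - v]addrC [x + v]addrC !addrK normrN => h1 h2.
  have -> : forall a b c : R, a + b - 2 * c = (a - c) + (b - c) by move=> *; ring.
  apply: (le_trans (ler_normD _ _)); rewrite -mulrA mulr_natl mulr2n.
  exact: lerD.
- have -> : Num.floor alpha = 1.
    by apply/eqP; rewrite floor_eq a1.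
  rewrite /= => /andP[e0 e1] hu.
  split; first by lra.
  split; first exact: (holder_haspd (l := [::]) hu).
  split; first by move=> i; exact: (holder_haspd (l := [:: i]) hu).
  have [|M M0 HM] := holder_normr hu; first by apply/andP; split; lra.
  (* For alpha >= 1 the third derivatives are Hoelder of exponent s = alpha - 1 + eps, and
     [pd_second] gains one power of |v|. The constant is 3 * 2^s <= 6. *)
  exists (6 * M); first by rewrite mulr_ge0.
  move=> i j x v.
  have hp := holder_haspd (l := [:: j; i]) hu isT.
  have s0 : 0 <= alpha - 1 + eps by lra.
  pose r := Num.max `|x + v| `|x - v|.
  have r1 : `|x + v| <= r by rewrite le_max lexx.
  have r2 : `|x - v| <= r by rewrite le_max lexx orbT.
  have h := @pd_second _ _ _ r M (alpha - 1 + eps) x v hp s0 _ M0 r1 r2.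
  apply: (le_trans (h _)); first by move=> k p q _ _; exact: HM.
  have -> : alpha + eps = (alpha - 1 + eps) + 1 by ring.
  have -> : `|v| `^ (alpha - 1 + eps + 1) = `|v| `^ (alpha - 1 + eps) * `|v|.
    by rewrite powRD ?powRr1 // gt_eqF //; lra.
  rewrite mulrA ler_wpM2r // powRM //.
  have -> : 6 * M * `|v| `^ (alpha - 1 + eps) = 3 * M * (2 * `|v| `^ (alpha - 1 + eps)) by ring.
  rewrite ler_wpM2l ?mulr_ge0 // ler_wpM2r ?powR_ge0 //.
  by rewrite -[leRHS]powRr1 // ler_powR ?ler1n //; lra.
Qed.

End Holder.

(** * Integration over three-dimensional space *)

(** The common property of the substitutions made below: translations, sign changes, transpositions
    of coordinates and their composites. *)
Definition mpres (R : realType) d (T : measurableType d) (m : set T -> \bar R) (phi : T -> T) :=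
  measurable_fun [set: T] phi /\ forall A, measurable A -> m (phi @^-1` A) = m A.

Section MeasurePreserving.
Context {R : realType}.

Section Generic.
Context d (T : measurableType d) (m : {measure set T -> \bar R}) (phi : T -> T).
Hypothesis mphi : mpres m phi.

Lemma mpres_ge0_integral (f : T -> \bar R) : measurable_fun [set: T] f ->
  (forall x, (0 <= f x)%E) -> (\int[m]_x f (phi x) = \int[m]_x f x)%E.
Proof.
move=> mf f0; have [mp pE] := mphi.
rewrite -[RHS](@eq_measure_integral _ _ _ setT m (pushforward m phi)); last first.
  by move=> A mA _; exact: pE.
rewrite (ge0_integral_pushforward mp) ?preimage_setT //.
Qed.

Lemma mpres_integrable (f : T -> R) : m.-integrable [set: T] (EFin \o f) ->
  m.-integrable [set: T] (EFin \o (f \o phi)).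
Proof.
move=> /integrableP[mf fi]; have [mp pE] := mphi.
apply/integrableP; split.
  by apply: measurableT_comp mf mp.
rewrite (mpres_ge0_integral (f := fun x => `|(f x)%:E|%E)) //.
exact: measurableT_comp.
Qed.

Lemma mpres_Rintegral (f : T -> R) : m.-integrable [set: T] (EFin \o f) ->
  Rintegral m setT (f \o phi) = Rintegral m setT f.
Proof.
move=> fi; have [mp pE] := mphi.
have fi' := mpres_integrable fi.
rewrite /Rintegral; congr fine.
rewrite -[RHS](@eq_measure_integral _ _ _ setT m (pushforward m phi)); last first.
  by move=> A mA _; exact: pE.
rewrite (integral_pushforward mp) ?preimage_setT //; by case/integrableP : fi.
Qed.

End Generic.

(** The pushforward of the product measure has the right values on rectangles, so uniqueness of the
    product measure identifies it. *)
Lemma mpresX d1 d2 (T1 : measurableType d1) (T2 : measurableType d2)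
  (m1 : {sigma_finite_measure set T1 -> \bar R})
  (m2 : {sigma_finite_measure set T2 -> \bar R}) f1 f2 :
  mpres m1 f1 -> mpres m2 f2 ->
  mpres (m1 \x m2)%E (fun p => (f1 p.1, f2 p.2)).
Proof.
move=> [mf1 E1] [mf2 E2].
have mf : measurable_fun [set: T1 * T2] (fun p => (f1 p.1, f2 p.2)).
  apply/measurable_fun_pairP; split => /=.
    exact: measurableT_comp mf1 measurable_fst.
  exact: measurableT_comp mf2 measurable_snd.
split=> // A mA; apply/esym.
apply: (product_measure_unique (m' := pushforward (m1 \x m2)%E (fun p => (f1 p.1, f2 p.2)))) => // A1 A2 mA1 mA2.
rewrite /pushforward.
rewrite -E1 // -E2 // -[RHS]product_measure1E //.
  by rewrite -[X in measurable X]setTI; exact: mf1.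
by rewrite -[X in measurable X]setTI; exact: mf2.
Qed.

Lemma mpres_swap d1 (T1 : measurableType d1)
  (m1 : {sigma_finite_measure set T1 -> \bar R}) :
  mpres (m1 \x m1)%E (@swap T1 T1).
Proof.
have mf : measurable_fun [set: (T1 * T1)%type] (@swap T1 T1) := @measurable_swap _ _ T1 T1.
split=> // A mA; apply/esym.
apply: (product_measure_unique (m' := pushforward (m1 \x m1)%E (@swap T1 T1))) => // A1 A2 mA1 mA2.
rewrite /pushforward muleC -[RHS]product_measure1E //.
have E : @swap T1 T1 @^-1` (A1 `*` A2) = A2 `*` A1 by apply/seteqP; split => -[a b] [].
by move: (congr1 (m1 \x m1)%E E).
Qed.

Local Notation lam := (@lebesgue_measure R).
Local Notation R1 := (measurableTypeR R).

(** Lebesgue measure is determined by its values on half-open intervals. *)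
Lemma mpres_translate (t : R) : mpres lam (fun x : R1 => x + t : R1).
Proof.
have mf : measurable_fun [set: R1] (fun x : R1 => x + t : R1).
  apply: (@continuous_measurable_fun R (fun x : R => x + t)) => x.
  by apply: continuousD => //; exact: cst_continuous.
split=> // A mA; apply/esym.
apply: (lebesgue_measure_unique (mu := pushforward lam (fun x : R1 => x + t : R1))) => // X [[a b] _ <-] /=.
rewrite /pushforward.
have -> : (fun x : R1 => x + t : R1) @^-1` `]a, b] = `]a - t, b - t]%classic.
  have E (x : R) : (x + t \in `]a, b]%R) = (x \in `]a - t, b - t]%R).
    by rewrite !in_itv /= ltrBlDr lerBrDr.
  apply/seteqP; split => x h.
    by have h' : x + t \in `]a, b]%R := h; rewrite E in h'.
  by have h' : x \in `]a - t, b - t]%R := h; rewrite -E in h'.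
rewrite !lebesgue_measure_itv /= !lte_fin ltrD2r; case: ifP => // _.
by rewrite -!EFinD; congr (_%:E); ring.
Qed.

Lemma mpres_opp : mpres lam (fun x : R1 => - x : R1).
Proof.
have mf : measurable_fun [set: R1] (fun x : R1 => - x : R1).
  apply: (@continuous_measurable_fun R (fun x : R => - x)) => x.
  exact: opp_continuous.
split=> // A mA; apply/esym.
apply: (lebesgue_measure_unique (mu := pushforward lam (fun x : R1 => - x : R1))) => // X [[a b] _ <-] /=.
rewrite /pushforward.
have -> : (fun x : R1 => - x : R1) @^-1` `]a, b] = `[- b, - a[%classic.
  have E (x : R) : (- x \in `]a, b]%R) = (x \in `[- b, - a[%R).
    by rewrite !in_itv /= ltrNr lerNl andbC.
  apply/seteqP; split => x h.
    by have h' : - x \in `]a, b]%R := h; rewrite E in h'.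
  by have h' : x \in `[- b, - a[%R := h; rewrite -E in h'.
rewrite !lebesgue_measure_itv /= !lte_fin ltrN2; case: ifP => // _.
by rewrite -!EFinD; congr (_%:E); ring.
Qed.

Lemma mpres_id d (T : measurableType d) (m : {measure set T -> \bar R}) :
  mpres m (fun x => x).
Proof. by split. Qed.

Lemma mpres_comp d (T : measurableType d) (m : {measure set T -> \bar R}) f g :
  mpres m f -> mpres m g -> mpres m (g \o f).
Proof.
move=> [mf Ef] [mg Eg]; split; first exact: measurableT_comp.
move=> A mA; rewrite comp_preimage Ef ?Eg //.
by rewrite -[X in measurable X]setTI; exact: mg.
Qed.

(** A name for the inner factor of [leb3]. To it is attached the sigma-finite structure that Tonelli
    and the uniqueness of the product measure require for the outer product. *)
Definition leb2 := (lam \x lam)%E.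
HB.instance Definition _ := Measure.on leb2.

Lemma sigma_finite_leb2 : sigma_finite [set: (R1 * R1)%type] leb2.
Proof.
have /sigma_finiteP[F [TF ndF Foo]] := sigma_finiteT lam.
exists (fun n => F n `*` F n).
  rewrite -setXTT TF predeqE => -[x y]; split.
    move=> [/= [n _ Fnx] [k _ Gky]]; exists (maxn n k) => //; split.
    - by move: x Fnx; exact/subsetPset/ndF/leq_maxl.
    - by move: y Gky; exact/subsetPset/ndF/leq_maxr.
  by move=> [n _ []/= ? ?]; split; exists n.
move=> k; have [? ?] := Foo k.
split; first exact: measurableX.
by rewrite /leb2 product_measure1E// lte_mul_pinfty// ge0_fin_numE.
Qed.

HB.instance Definition _ := Measure_isSigmaFinite.Build _ _ _ leb2 sigma_finite_leb2.

End MeasurePreserving.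

(** * Symmetries, integrals and null sets of three-dimensional space *)

Section Space.
Context {R : realType}.
Local Notation lam := (@lebesgue_measure R).
Local Notation R1 := (measurableTypeR R).
Local Notation R3 := (R1 * R1 * R1)%type.
Local Notation mu := (@leb2 R \x lam)%E.
Implicit Types (f g : pt R -> R) (p c : pt R).

Lemma leb3E : @leb3 R = mu. Proof. by []. Qed.

Lemma tonelli3 (F : R3 -> \bar R) : measurable_fun [set: R3] F ->
  (forall p, (0 <= F p)%E) ->
  (\int[mu]_p F p = \int[lam]_x \int[lam]_y \int[lam]_z F (x, y, z))%E.
Proof.
move=> mF F0; rewrite fubini_tonelli1 // /fubini_F.
rewrite [LHS](@fubini_tonelli1 _ _ R1 R1 R lam lam
  (fun q : R1 * R1 => \int[lam]_z F (q, z))%E) //.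
  exact: (measurable_fun_fubini_tonelli_F F).
by move=> q; exact: integral_ge0.
Qed.

Definition swap23 (p : R3) : R3 := (p.1.1, p.2, p.1.2).

(** This swap mixes the two factors of the nested product, so [mpresX] does not reach it. The
    measure of a set is written as an iterated integral and the two inner integrations are
    exchanged. *)
Lemma mpres_swap23 : mpres mu swap23.
Proof.
have m : measurable_fun [set: R3] swap23.
  apply: measurable_fun_pair => /=; last exact: measurableT_comp.
  by apply: measurable_fun_pair => //; exact: measurableT_comp.
split; first exact: m.
move=> A mA.
have mA' : measurable (swap23 @^-1` A) by rewrite -[X in measurable X]setTI; exact: m.
have mI (B : set R3) : measurable B -> measurable_fun [set: R3] (fun p : R3 => (\1_B p)%:E : \bar R).
  by move=> mB; apply/measurable_EFinP; exact: measurable_indic.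
have iE (B : set R3) : measurable B ->
   (mu B = \int[lam]_x \int[lam]_y \int[lam]_z (\1_B (x, y, z))%:E)%E.
  move=> mB; rewrite -(tonelli3 (F := fun p => (\1_B p)%:E)) //.
  - by rewrite integral_indic // setIT.
  - exact: mI.
etransitivity; first exact: (iE _ mA').
etransitivity; last exact/esym/(iE _ mA).
apply: eq_integral => x _.
rewrite [RHS](@fubini_tonelli _ _ R1 R1 R lam lam (fun q => (\1_A (x, q.1, q.2))%:E)) //.
- apply: (measurableT_comp (mI _ mA)).
  apply: measurable_fun_pair => //=.
  by apply: measurable_fun_pair => //; exact: measurable_cst.
Qed.

Lemma mpres_prod3 (f : R1 * R1 -> R1 * R1) (g : R1 -> R1) :
  mpres leb2 f -> mpres lam g -> mpres mu (fun p : R3 => (f p.1, g p.2)).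
Proof. exact: mpresX. Qed.

Lemma mpres_prod2 (f g : R1 -> R1) :
  mpres lam f -> mpres lam g -> mpres leb2 (fun p : R1 * R1 => (f p.1, g p.2)).
Proof. exact: mpresX. Qed.

Lemma mpres_swap12 : mpres mu (fun p : R3 => (p.1.2, p.1.1, p.2)).
Proof.
apply: (@mpres_prod3 (@swap R1 R1) (fun z => z)); last exact: mpres_id.
exact: mpres_swap.
Qed.

Lemma mpres_shift c : mpres mu (fun p : R3 => (p + c : pt R)).
Proof.
apply: (@mpres_prod3 (fun q : R1 * R1 => (q.1 + c.1.1 : R, q.2 + c.1.2 : R))
  (fun z => z + c.2 : R));
  last exact: mpres_translate.
by apply: (@mpres_prod2 (fun z => z + c.1.1 : R) (fun z => z + c.1.2 : R)); exact: mpres_translate.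
Qed.

Lemma mpres_flip1 : mpres mu (fun p : R3 => (- p.1.1 : R, p.1.2, p.2)).
Proof.
apply: (@mpres_prod3 (fun q : R1 * R1 => (- q.1 : R, q.2)) (fun z => z));
  last exact: mpres_id.
by apply: (@mpres_prod2 (fun z => - z : R) (fun z => z)); [exact: mpres_opp|exact: mpres_id].
Qed.

Lemma mpres_flip2 : mpres mu (fun p : R3 => (p.1.1, - p.1.2 : R, p.2)).
Proof.
apply: (@mpres_prod3 (fun q : R1 * R1 => (q.1, - q.2 : R)) (fun z => z));
  last exact: mpres_id.
by apply: (@mpres_prod2 (fun z => z) (fun z => - z : R)); [exact: mpres_id|exact: mpres_opp].
Qed.

Lemma mpres_flip3 : mpres mu (fun p : R3 => (p.1.1, p.1.2, - p.2 : R)).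
Proof.
apply: (@mpres_prod3 (fun q : R1 * R1 => (q.1, q.2)) (fun z => - z : R)); last exact: mpres_opp.
by apply: (@mpres_prod2 (fun z => z) (fun z => z)); exact: mpres_id.
Qed.

Lemma mpres_reflect c : mpres mu (fun p : R3 => (c - p : pt R)).
Proof.
have h := mpres_comp mpres_flip1 (mpres_comp mpres_flip2 (mpres_comp mpres_flip3 (mpres_shift c))).
have E : (fun p : R3 => ((- p.1.1 : R, - p.1.2 : R, - p.2 : R) + c : pt R)) =
    (fun p : R3 => (c - p : pt R)).
  by apply/funext => p; exact: (addrC (- p : pt R)).
by rewrite -E; exact: h.
Qed.

Definition meas f := measurable_fun [set: R3] (f : R3 -> R).
Definition itg f := mu.-integrable [set: R3] (EFin \o f).
(** Integration is always over the whole space, the domain being an indicator factor in the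
    integrand; integrals over different domains then combine by linearity. *)
Definition I3 f := Rintegral mu [set: R3] f.

Lemma itg_meas f : itg f -> meas f.
Proof. by move=> /integrableP[/measurable_EFinP]. Qed.

Lemma itgD f g : itg f -> itg g -> itg (fun p => f p + g p).
Proof. by move=> hf hg; exact: (integrableD measurableT hf hg). Qed.

Lemma itgZ (a : R) f : itg f -> itg (fun p => a * f p).
Proof. by move=> hf; exact: (integrableZl measurableT a hf). Qed.

Lemma itg0 : itg (fun=> 0).
Proof. exact: integrable0. Qed.

Lemma itgB f g : itg f -> itg g -> itg (fun p => f p - g p).
Proof. by move=> hf hg; exact: (integrableB measurableT hf hg). Qed.

Lemma I3D f g : itg f -> itg g -> I3 (fun p => f p + g p) = I3 f + I3 g.
Proof. by move=> hf hg; rewrite /I3 RintegralD. Qed.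

Lemma I3B f g : itg f -> itg g -> I3 (fun p => f p - g p) = I3 f - I3 g.
Proof. by move=> hf hg; rewrite /I3 RintegralB. Qed.

Lemma I3Z (a : R) f : itg f -> I3 (fun p => a * f p) = a * I3 f.
Proof. by move=> hf; rewrite /I3 RintegralZl. Qed.

Lemma itg_sum (J : Type) (r : seq J) (P : pred J) (F : J -> pt R -> R) :
  (forall j, P j -> itg (F j)) -> itg (fun p => \sum_(j <- r | P j) F j p).
Proof.
move=> hF; elim: r => [|j r IH].
  by have := itg0; congr itg; apply/funext => p; rewrite big_nil.
case: (boolP (P j)) => Pj.
  by have := itgD (hF j Pj) IH; congr itg; apply/funext => p; rewrite big_cons Pj.
by move: IH; congr itg; apply/funext => p; rewrite big_cons (negbTE Pj).
Qed.

Lemma I3_sum (J : Type) (r : seq J) (P : pred J) (F : J -> pt R -> R) :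
  (forall j, P j -> itg (F j)) ->
  I3 (fun p => \sum_(j <- r | P j) F j p) = \sum_(j <- r | P j) I3 (F j).
Proof.
move=> hF; elim: r => [|j r IH].
  rewrite big_nil /I3 /Rintegral integral0_eq // => p _.
  by rewrite big_nil.
rewrite big_cons; case: (boolP (P j)) => Pj.
  rewrite -IH -I3D //; first by congr I3; apply/funext => p; rewrite big_cons Pj.
    exact: hF.
  exact: itg_sum.
by rewrite -IH; congr I3; apply/funext => p; rewrite big_cons (negbTE Pj).
Qed.

Lemma I3_le f g : itg f -> itg g -> (forall p, f p <= g p) -> I3 f <= I3 g.
Proof. by move=> hf hg fg; apply: le_Rintegral. Qed.

Lemma itg_le f g : meas f -> itg g -> (forall p, `|f p| <= g p) -> itg f.
Proof.
move=> mf ig fg; apply: (le_integrable measurableT _ _ ig).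
  exact/measurable_EFinP.
by move=> p _; rewrite /= lee_fin; apply: (le_trans (fg p)); exact: ler_norm.
Qed.

Lemma itg_norm f : itg f -> itg (fun p => `|f p|).
Proof.
move=> hf; apply: (le_integrable measurableT _ _ hf).
  by apply/measurable_EFinP; apply: measurableT_comp => //; exact: itg_meas.
by move=> p _ /=; rewrite normr_id.
Qed.

Lemma I3_abs f g : itg f -> itg g -> (forall p, `|f p| <= g p) -> `|I3 f| <= I3 g.
Proof.
move=> hf hg fg; apply: (@le_trans _ _ (I3 (fun p => `|f p|))).
  exact: le_normr_Rintegral.
by apply: I3_le => //; exact: itg_norm.
Qed.

(** For countable [F] the excluded points fill countably many coordinate planes, a null set. It
    absorbs the faces of cells and the boundaries of the cube and the octant. *)
Definition off (F : set R) p := ~ F p.1.1 /\ ~ F p.1.2 /\ ~ F p.2.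

Lemma negligible_off (F : set R) : countable F -> mu.-negligible (~` off F).
Proof.
move=> cF.
have mF : measurable (F : set R1) by exact: countable_measurable.
have F0 : lam F = 0%E by exact: countable_lebesgue_measure0.
have n2 (A B : set R1) : measurable A -> measurable B -> leb2 (A `*` B) = (lam A * lam B)%E.
  by move=> mA mB; exact: product_measure1E.
have n3 (A : set (R1 * R1)) (B : set R1) : measurable A -> measurable B ->
    mu (A `*` B) = (leb2 A * lam B)%E.
  by move=> mA mB; rewrite product_measure1E.
exists (((F `*` setT) `*` setT) `|` (((setT `*` F) `*` setT) `|` (setT `*` F))).
split.
- by apply: measurableU; [|apply: measurableU]; repeat apply: measurableX.
- have z1 : mu ((F `*` setT) `*` setT) = 0%E.
    by rewrite n3 ?n2 ?F0 ?mul0e //; exact: measurableX.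
  have z2 : mu ((setT `*` F) `*` setT) = 0%E.
    by rewrite n3 ?n2 ?F0 ?mule0 ?mul0e //; exact: measurableX.
  have z3 : mu (setT `*` F) = 0%E by rewrite n3 ?F0 ?mule0.
  rewrite null_set_setU //; repeat apply: measurableX => //.
    by apply: measurableU; repeat apply: measurableX.
  by rewrite null_set_setU //; repeat apply: measurableX.
- move=> [[x y] z] /= h.
  have [Fx|Fx] := pselect (F x); first by left.
  have [Fy|Fy] := pselect (F y); first by right; left.
  by right; right; split => //=; apply: contrapT => Fz; apply: h.
Qed.

Lemma I3_ae (F : set R) f g : countable F -> meas f -> meas g ->
  (forall p, off F p -> f p = g p) -> I3 f = I3 g.
Proof.
move=> cF mf mg fg; rewrite /I3 /Rintegral; congr fine.
apply: ae_eq_integral => //; try exact/measurable_EFinP.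
apply: negligibleS (negligible_off cF) => p /= h1 h2.
by apply: h1 => _; rewrite /= fg.
Qed.

Lemma itg_ae (F : set R) f g : countable F -> meas f -> itg g ->
  (forall p, off F p -> f p = g p) -> itg f.
Proof.
move=> cF mf ig fg; apply/integrableP; split; first exact/measurable_EFinP.
case/integrableP: ig => mg h.
have E := @ae_eq_integral _ _ _ mu setT (fun p : R3 => `|(f p)%:E|)%E (fun p : R3 => `|(g p)%:E|)%E.
rewrite -E //.
- by apply: measurableT_comp.
- by apply: measurableT_comp => //; exact/measurable_EFinP.
- apply: negligibleS (negligible_off cF) => p /= h1 h2.
  by apply: h1 => _; rewrite /= fg.
Qed.

Lemma RI (D : set (pt R)) f : Rintegral (@leb3 R) D f = I3 (fun p => \1_D p * f p).
Proof.
rewrite leb3E [LHS]Rintegral_mkcond; congr I3; apply/funext => p.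
by rewrite /patch indicE; case: ifP => _; rewrite ?mul1r ?mul0r.
Qed.

Lemma mpres_I3 tau f : mpres mu tau -> itg f -> I3 (fun p => f (tau p)) = I3 f.
Proof. by move=> mt hf; exact: mpres_Rintegral. Qed.

Lemma mpres_itg tau f : mpres mu tau -> itg f -> itg (fun p => f (tau p)).
Proof. by move=> mt hf; exact: mpres_integrable. Qed.

Lemma meas_cst (a : R) : meas (fun=> a). Proof. exact: measurable_cst. Qed.
Lemma measD f g : meas f -> meas g -> meas (fun p => f p + g p).
Proof. by move=> hf hg; exact: measurable_funD. Qed.
Lemma measB f g : meas f -> meas g -> meas (fun p => f p - g p).
Proof. by move=> hf hg; exact: measurable_funB. Qed.
Lemma measM f g : meas f -> meas g -> meas (fun p => f p * g p).
Proof. by move=> hf hg; exact: measurable_funM. Qed.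
Lemma meas_comp (h : R -> R) f : measurable_fun [set: R] h -> meas f -> meas (fun p => h (f p)).
Proof. by move=> mh mf; exact: measurableT_comp. Qed.
Lemma meas_co1 : meas (fun p => p.1.1).
Proof. exact: (measurableT_comp (f := fst) (g := fst)). Qed.
Lemma meas_co2 : meas (fun p => p.1.2).
Proof. exact: (measurableT_comp (f := snd) (g := fst)). Qed.
Lemma meas_co3 : meas (fun p => p.2).
Proof. exact: measurable_snd. Qed.
Lemma meas_sum (J : Type) (r : seq J) (P : pred J) (F : J -> pt R -> R) :
  (forall j, meas (F j)) -> meas (fun p => \sum_(j <- r | P j) F j p).
Proof.
move=> hF; elim: r => [|j r IH].
  by have := meas_cst 0; congr meas; apply/funext => p; rewrite big_nil.
case: (boolP (P j)) => Pj.
  by have := measD (hF j) IH; congr meas; apply/funext => p; rewrite big_cons Pj.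
by move: IH; congr meas; apply/funext => p; rewrite big_cons (negbTE Pj).
Qed.
Lemma meas_mpres tau f : mpres mu tau -> meas f -> meas (fun p => f (tau p)).
Proof. by move=> [mt _] mf; exact: measurableT_comp mf mt. Qed.

Lemma meas_enorm : meas (@enorm R).
Proof.
apply: (@meas_comp (@Num.sqrt R)).
  by apply: continuous_measurable_fun; exact: sqrt_continuous.
have h f : meas f -> meas (fun p => f p ^+ 2) by move=> mf; apply: measM.
apply: measD; last by apply: (h (fun p => p.2)); exact: meas_co3.
apply: measD.
  by apply: (h (fun p => p.1.1)); exact: meas_co1.
by apply: (h (fun p => p.1.2)); exact: meas_co2.
Qed.

Lemma meas_enorm_powR (a : R) : meas (fun p => enorm p `^ a).
Proof. by apply: (@meas_comp (fun t => t `^ a)) => //; exact: meas_enorm. Qed.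

Lemma meas_indic (D : set (pt R)) : measurable (D : set R3) -> meas (\1_D).
Proof. by move=> mD; exact: measurable_indic. Qed.

Lemma measurable_box3 (A B C : set R1) : measurable A -> measurable B -> measurable C ->
  measurable ([set p | A p.1.1 /\ B p.1.2 /\ C p.2] : set R3).
Proof.
move=> mA mB mC; rewrite (_ : [set p | _] = (A `*` B) `*` C).
  by do 2 apply: measurableX => //.
by apply/seteqP; split => p /= [] => [h1 [h2 h3]|[h1 h2] h3].
Qed.

Lemma measurable_enorm_gt (e : R) : measurable ([set p | e < enorm p] : set R3).
Proof.
rewrite (_ : [set p | _] = setT `&` @enorm R @^-1` `]e, +oo[).
  have m : measurable_fun [set: R3] (@enorm R : R3 -> R) := meas_enorm.
  by apply: m => //; exact: measurable_itv.
by apply/seteqP; split => p /=; rewrite in_itv /= andbT // => -[].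
Qed.

End Space.

(** * Measurability and integrability *)

Lemma indic_in (R : realType) (T : Type) (D : set T) (p : T) : D p -> \1_D p = 1 :> R.
Proof. by move=> Dp; rewrite indicE mem_set. Qed.

Lemma indic_out (R : realType) (T : Type) (D : set T) (p : T) : ~ D p -> \1_D p = 0 :> R.
Proof. by move=> Dp; rewrite indicE memNset. Qed.

Section Continuous.
Context {R : realType}.
Local Notation R1 := (measurableTypeR R).
Local Notation R3 := (R1 * R1 * R1)%type.

(** An open set is the union of the countably many rational open boxes inside it. This links the
    topology of [pt R] to the product sigma-algebra. *)
Lemma open_measurable3 (U : set (pt R)) : open U -> measurable (U : set R3).
Proof.
move=> oU.
pose B (q : (rat * rat) * (rat * rat) * (rat * rat)) : set (pt R) :=
  [set p | p.1.1 \in `]ratr q.1.1.1, ratr q.1.1.2[%R /\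
    p.1.2 \in `]ratr q.1.2.1, ratr q.1.2.2[%R /\ p.2 \in `]ratr q.2.1, ratr q.2.2[%R].
pose F q := if pselect (B q `<=` U) then B q else set0.
have -> : U = \bigcup_q F q.
  apply/seteqP; split => [[[x y] z] Up|p [q _]]; last first.
    by rewrite /F; case: (pselect (B q `<=` U)) => // h /h.
  have := oU; rewrite openE => /(_ _ Up) /nbhs_ballP [e /= e0 eU].
  have near (t : R) : exists a b : rat, t \in `]ratr a, ratr b[%R /\
      forall s : R, s \in `]ratr a, ratr b[%R -> `|t - s| < e.
    have [|a] := @rat_in_itvoo R (t - e) t; first lra.
    have [|b] := @rat_in_itvoo R t (t + e); first lra.
    rewrite !in_itv /= => /andP[tb be] /andP[ea at_].
    exists a, b; rewrite in_itv /= at_ tb; split => // s.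
    by rewrite in_itv /= => /andP[h1 h2]; rewrite ltr_norml; apply/andP; split; lra.
  have [a1 [b1 [h1 k1]]] := near x; have [a2 [b2 [h2 k2]]] := near y.
  have [a3 [b3 [h3 k3]]] := near z.
  exists ((a1, b1), (a2, b2), (a3, b3)) => //; rewrite /F.
  case: pselect => // n; exfalso; apply: n => -[[x' y'] z'] /= [/k1 j1 [/k2 j2 /k3 j3]].
  by apply: eU; split => //; split.
apply: countable_bigcupT_measurable => [|q].
  by apply: countableP.
rewrite /F; case: (pselect (B q `<=` U)) => h; last exact: measurable0.
by apply: (measurable_box3 (A := [set` _]) (B := [set` _]) (C := [set` _])); exact: measurable_itv.
Qed.

Lemma continuous_meas (u : pt R -> R) : continuous u -> meas u.
Proof.
move=> cu; apply: (measurability _ (RGenOpens.measurableE R)).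
move=> /= _ [_ [a [b ->] <-]]; rewrite setTI; apply: open_measurable3.
by move/continuousP : cu; apply; exact: interval_open.
Qed.

Lemma bounded_support (ax bx ay by_ az bz : R) (u : pt R -> R) : continuous u ->
  (forall p, ~ Defs.box ax bx ay by_ az bz p -> u p = 0) ->
  exists2 M : R, 0 <= M & forall p, `|u p| <= M.
Proof.
move=> cu u0.
pose K : set (pt R) := (`[ax, bx]%classic `*` `[ay, by_]%classic) `*` `[az, bz]%classic.
have cK : compact K by do 2? apply: compact_setX; exact: segment_compact.
have [M [_ HM]] := compact_bounded (continuous_compact (continuous_subspaceT cu) cK).
exists (`|M| + 1); first by rewrite addr_ge0.
move=> p; have [bp|/u0 ->] := pselect (Defs.box ax bx ay by_ az bz p); last first.
  by rewrite normr0 addr_ge0.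
apply: (HM (`|M| + 1)); first by have := ler_norm M; lra.
exists p => //; case: bp => /andP[a1 a2] [/andP[a3 a4] /andP[a5 a6]].
by rewrite /K /= !in_itv /= !ltW.
Qed.

End Continuous.

(** * Integrability of powers of the norm at infinity and at the origin *)

Section Integrability.
Context {R : realType}.
Local Notation lam := (@lebesgue_measure R).
Local Notation R1 := (measurableTypeR R).
Local Notation R3 := (R1 * R1 * R1)%type.
Local Notation mu := (@leb2 R \x lam)%E.

Lemma measurable_comp_powR (h : R -> R) (b : R) : measurable_fun [set: R] h ->
  measurable_fun [set: R] (fun x => h x `^ b).
Proof. by move=> mh; exact: (measurableT_comp (measurable_powR b)). Qed.

Lemma integral_tail_powR (b : R) : 0 < b ->
  (\int[lam]_x ((1 + `|x|) `^ (- (1 + b)))%:E < +oo)%E.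
Proof.
move=> b0.
have c1 : continuous (fun x : R => (1 + `|x|) `^ (- (1 + b))).
  move=> x; apply: (@continuous_comp _ _ _ (fun x : R => 1 + `|x|) (fun t => t `^ (- (1 + b)))).
    by apply: continuousD; [exact: cst_continuous|exact: norm_continuous].
  have h : 0 < 1 + `|x| by rewrite ltr_wpDr.
  apply: differentiable_continuous; apply/derivable1_diffP.
  exact: (@ex_derive _ _ _ _ _ _ _ (is_derive1_powR (- (1 + b)) h)).
rewrite ge0_symfun_integralT //; first last.
- by move=> x /=; rewrite normrN.
rewrite -set_itvcy.
have -> : (\int[lam]_(x in `[0%R, +oo[) ((1 + `|x|) `^ (- (1 + b)))%:E =
   0%:E - (- b^-1 * (1 + 0) `^ (- b))%:E)%E.
  have D (x : R) : 0 <= x -> is_derive x (1 : R) (fun x : R => - b^-1 * (1 + x) `^ (- b))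
      ((1 + x) `^ (- (1 + b))).
    move=> x0; have h : 0 < 1 + x by lra.
    have h1 : is_derive x (1 : R) (fun x : R => 1 + x) 1.
      have := is_deriveD (is_derive_cst (1 : R) x (1 : R)) (is_derive_id x (1 : R)).
      by rewrite add0r.
    have h2 := @is_derive1_comp _ (fun t : R => t `^ (- b)) (fun x : R => 1 + x) x _ _
      (is_derive1_powR (- b) h) h1.
    rewrite -[X in is_derive _ _ _ X](_ : - b^-1 *: (- b * (1 + x) `^ (- b - 1) * 1) = _).
      exact: is_deriveZ h2.
    rewrite /GRing.scale /= mulr1 mulrA mulrNN mulVf ?gt_eqF // mul1r.
    by congr (_ `^ _); ring.
  rewrite -(@ge0_continuous_FTC2y R (fun x => (1 + `|x|) `^ (- (1 + b)))
     (fun x => - b^-1 * (1 + x) `^ (- b)) 0 0) //.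
  - exact: continuous_subspaceT.
  - have -> : (0 : R) = - b^-1 * 0 by rewrite mulr0.
    apply: cvgMr; apply/cvgrPdist_lt => e e0; near=> x.
    have x1 : 0 < 1 + x by near: x; exists 0; split => // y y0; lra.
    rewrite sub0r normrN ger0_norm ?powR_ge0 // powRN invf_plt ?posrE ?powR_gt0 //.
    have : (e^-1) `^ b^-1 < 1 + x.
      by near: x; exists ((e^-1) `^ b^-1); split; [exact: num_real|move=> y; lra].
    move=> /(@gt0_ltr_powR _ b b0); rewrite !nnegrE powR_ge0 ltW // => /(_ isT isT).
    by rewrite -powRrM mulVf ?gt_eqF // powRr1 // invr_ge0 ltW.
  - by move=> x x0; have := D x (ltW x0); case.
  - apply: cvg_at_right_filter; have := D 0 (lexx 0).
    by case=> /derivable1_diffP /differentiable_continuous.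
  - move=> x; rewrite in_itv /= andbT => x0; rewrite derive1E.
    by rewrite (@derive_val _ _ _ _ _ _ _ (D x (ltW x0))) gtr0_norm.
by rewrite -EFinB -EFinM ltry.
Unshelve. all: by end_near.
Qed.

(** The fundamental theorem of calculus on [L/(n+1), L] gives a bound uniform in n, and these
    segments increase to ]0, L], so monotone convergence applies. *)
Lemma integral_head_powR (q L : R) : 0 < q < 1 -> 0 < L ->
  (\int[lam]_(x in `]0%R, L]) (x `^ (- q))%:E < +oo)%E.
Proof.
move=> /andP[q0 q1] L0.
pose F (n : nat) : set R1 := `[L * n.+1%:R^-1, L]%classic.
have FE : \bigcup_n F n = `]0, L]%classic :> set R.
  apply/seteqP; split => x.
    move=> [n _ h]; have : x \in `[L * n.+1%:R^-1, L]%R := h.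
    rewrite in_itv /= => /andP[h1 h2]; rewrite /= in_itv /=; apply/andP; split => //.
    by apply: lt_le_trans h1; rewrite mulr_gt0 // invr_gt0 ltr0n.
  rewrite /= in_itv /= => /andP[x0 xL].
  exists (Num.trunc (L / x)); first by [].
  suff : x \in `[L * (Num.trunc (L / x)).+1%:R^-1, L]%R by [].
  rewrite in_itv /= xL andbT.
  rewrite ler_pdivrMr ?ltr0n // -ler_pdivrMl // mulrC.
  by apply: ltW; exact: (truncnS_gt (L / x)).
have mf : measurable_fun [set: R1] (fun x : R => (x `^ (- q))%:E).
  by apply/measurable_EFinP; exact: measurable_powR.
have bound n : (\int[lam]_(x in F n) (x `^ (- q))%:E <= (L `^ (1 - q) / (1 - q))%:E)%E.
  case: n => [|n].
    rewrite /F invr1 mulr1 set_itv1 integral_set1 lee_fin divr_ge0 ?powR_ge0 //; lra.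
  have a0 : 0 < L * n.+2%:R^-1 by rewrite mulr_gt0 // invr_gt0 ltr0n.
  have D (x : R) : 0 < x -> is_derive x (1 : R) (fun x : R => (1 - q)^-1 * x `^ (1 - q)) (x `^ (- q)).
    move=> x0; rewrite -[X in is_derive _ _ _ X](_ : (1 - q)^-1 *: ((1 - q) * x `^ (1 - q - 1)) = _).
      exact: is_deriveZ (is_derive1_powR (1 - q) x0).
    rewrite /GRing.scale /= mulrA mulVf ?mul1r; last by rewrite subr_eq0 gt_eqF.
    by congr (_ `^ _); ring.
  have C (x : R) : 0 < x -> {for x, continuous (fun x : R => (1 - q)^-1 * x `^ (1 - q))}.
    by move=> x0; case: (D x x0) => /derivable1_diffP /differentiable_continuous.
  rewrite /F (@continuous_FTC2 R _ (fun x : R => (1 - q)^-1 * x `^ (1 - q))).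
  - rewrite -EFinB lee_fin mulrC lerBlDr lerDl mulr_ge0 ?powR_ge0 // invr_ge0; lra.
  - by rewrite ltr_pdivrMr ?ltr0n // ltr_pMr // ltr1n.
  - apply: derivable_within_continuous => x; rewrite in_itv /= => /andP[h _].
    apply: (@ex_derive _ _ _ _ _ _ _ (is_derive1_powR (- q) _)); exact: lt_le_trans h.
  - split.
    + by move=> x; rewrite in_itv /= => /andP[h _]; case: (D x (lt_trans a0 h)).
    + by apply: cvg_at_right_filter; exact: C.
    + by apply: cvg_at_left_filter; exact: C.
  - move=> x; rewrite in_itv /= => /andP[h _]; rewrite derive1E.
    by rewrite (@derive_val _ _ _ _ _ _ _ (D x (lt_trans a0 h))).
apply: (@le_lt_trans _ _ (L `^ (1 - q) / (1 - q))%:E); last exact: ltry.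
rewrite -FE.
have ndF : nondecreasing_seq F.
  move=> m n mn; apply/subsetPset => x h; have : x \in `[L * m.+1%:R^-1, L]%R := h.
  rewrite in_itv /= => /andP[h1 h2]; rewrite /F /= in_itv /=; apply/andP; split => //.
  apply: le_trans h1; rewrite ler_pM2l // lef_pV2 ?posrE ?ltr0n //.
  by rewrite ler_nat.
have cv := @ge0_nondecreasing_set_cvg_integral _ R1 R F (fun x => (x `^ (- q))%:E) lam ndF.
have {}cv := cv (fun i => measurable_itv _) (fun i => measurable_funTS mf).
have {}cv := cv (fun i x _ => powR_ge0 x (- q)).
have ci := cvgP _ cv.
rewrite -(cvg_lim _ cv) //.
apply: lime_le => //; exact: nearW.
Qed.


(** Powers of the norm are dominated below by such products, which reduces their integrability to
    integrals in one variable. *)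
Lemma itg_prod (f : R -> R) : (forall t, 0 <= f t) -> measurable_fun [set: R1] f ->
  (\int[lam]_t (f t)%:E < +oo)%E ->
  itg (fun p : pt R => f p.1.1 * f p.1.2 * f p.2).
Proof.
move=> f0 mf fi.
have m : meas (fun p : pt R => f p.1.1 * f p.1.2 * f p.2).
  by apply: measM; [apply: measM|]; apply: meas_comp => //;
    [exact: meas_co1|exact: meas_co2|exact: meas_co3].
apply/integrableP; split; first exact/measurable_EFinP.
rewrite (eq_integral (fun p : R3 => (f p.1.1 * f p.1.2 * f p.2)%:E)); last first.
  by move=> p _ /=; rewrite ger0_norm // !mulr_ge0.
rewrite (tonelli3 (F := fun p : R3 => (f p.1.1 * f p.1.2 * f p.2)%:E)); first last.
- by move=> p; rewrite lee_fin !mulr_ge0.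
- exact/measurable_EFinP.
set J := (\int[lam]_t (f t)%:E)%E in fi *.
have J0 : (0 <= J)%E by apply: integral_ge0 => t _; rewrite lee_fin.
have Jf : J = (fine J)%:E by rewrite fineK // ge0_fin_numE.
have mE : measurable_fun [set: R1] (fun t => (f t)%:E) by exact/measurable_EFinP.
have Z (k : R) : 0 <= k -> (\int[lam]_t (k * f t)%:E = (k * fine J)%:E)%E.
  move=> k0; under eq_integral do rewrite EFinM.
  rewrite ge0_integralZl_EFin //; last by move=> t _; rewrite lee_fin.
  by rewrite -/J {1}Jf EFinM.
have j0 : 0 <= fine J by apply: fine_ge0.
have E2 x : (\int[lam]_y \int[lam]_z (f x * f y * f z)%:E = (fine J * fine J * f x)%:E)%E.
  rewrite (eq_integral (fun y : R1 => (f x * fine J * f y)%:E)); last first.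
    by move=> y _; rewrite (Z (f x * f y)) ?mulr_ge0 //; congr EFin; ring.
  by rewrite (Z (f x * fine J)) ?mulr_ge0 //; congr EFin; ring.
rewrite (eq_integral (fun x : R1 => (fine J * fine J * f x)%:E)); last first.
  by move=> x _; exact: E2.
by rewrite Z ?mulr_ge0 // ltry.
Qed.

Lemma powR_prod3 (a b c s : R) : 0 <= a -> 0 <= b -> 0 <= c ->
  a `^ s * b `^ s * c `^ s = (a * b * c) `^ s.
Proof. by move=> a0 b0 c0; rewrite !powRM // mulr_ge0. Qed.

Lemma powR_cube (a s : R) : 0 <= a -> (a ^+ 3) `^ (s / 3) = a `^ s.
Proof. by move=> a0; rewrite -powR_mulrn // -powRrM; congr (_ `^ _); field. Qed.

Lemma co_le_enorm (p : pt R) :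
  [/\ `|p.1.1| <= enorm p, `|p.1.2| <= enorm p & `|p.2| <= enorm p].
Proof.
by have := normr_le_enorm p; rewrite pnorm_le => /and3P[].
Qed.

Lemma powR_anti (a b s : R) : 0 < a -> a <= b -> 0 <= s -> b `^ (- s) <= a `^ (- s).
Proof.
move=> a0 ab s0; rewrite !powRN lef_pV2 ?posrE ?powR_gt0 //; last exact: lt_le_trans ab.
by apply: ge0_ler_powR; rewrite ?nnegrE //; [exact: ltW|apply: ltW; exact: lt_le_trans ab].
Qed.

(** The exponent is split evenly as 3 (1 + alpha/3). Where |p| > e, each factor 1 + |p_i| is at most
    K |p| with K = 1/e + 1, so the product of the three is at most (K |p|)^3. *)
Lemma itg_tail (alpha e : R) : 0 < alpha -> 0 < e ->
  itg (fun p : pt R => \1_[set p | e < enorm p] p * enorm p `^ (- (3 + alpha))).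
Proof.
move=> a0 e0; set b := alpha / 3; have b0 : 0 < b by rewrite divr_gt0.
set K := e^-1 + 1; have K0 : 0 < K by rewrite addr_gt0 ?invr_gt0.
have mn : measurable_fun [set: R] (fun t : R => 1 + `|t|).
  apply: continuous_measurable_fun => x.
  by apply: continuousD; [exact: cst_continuous|exact: norm_continuous].
have i1 := itg_prod (f := fun t => (1 + `|t|) `^ (- (1 + b))) (fun t => powR_ge0 _ _)
  (measurable_comp_powR _ mn)
  (integral_tail_powR b0).
apply: itg_le (itgZ (K `^ (3 + alpha)) i1) _.
  apply: measM; last exact: meas_enorm_powR.
  by apply: meas_indic; exact: measurable_enorm_gt.
move=> p; have [ep|ep] := pselect (e < enorm p); last first.
  by rewrite indic_out // mul0r normr0 !mulr_ge0 ?powR_ge0.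
rewrite indic_in //.
have p0 : 0 < enorm p := lt_trans e0 ep.
rewrite mul1r ger0_norm ?powR_ge0 // powR_prod3 ?addr_ge0 //.
have h (t : R) : `|t| <= enorm p -> 1 + `|t| <= K * enorm p.
  move=> tp; rewrite /K mulrDl mul1r lerD //.
  by rewrite mulrC ler_pdivlMr // mul1r ltW.
have [h1 h2 h3] := co_le_enorm p.
have Ke : 0 < K * enorm p by rewrite mulr_gt0.
have hp : (1 + `|p.1.1|) * (1 + `|p.1.2|) * (1 + `|p.2|) <= (K * enorm p) ^+ 3.
  rewrite (_ : _ ^+ 3 = (K * enorm p) * (K * enorm p) * (K * enorm p)); last by ring.
  by rewrite !ler_pM ?mulr_ge0 ?addr_ge0 // h.
have hg : 0 < (1 + `|p.1.1|) * (1 + `|p.1.2|) * (1 + `|p.2|).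
  by rewrite !mulr_gt0 // ltr_wpDr.
apply: (@le_trans _ _ (K `^ (3 + alpha) * ((K * enorm p) ^+ 3) `^ (- (1 + b)))); last first.
  by rewrite ler_wpM2l ?powR_ge0 // powR_anti //; lra.
have -> : - (1 + b) = - (3 + alpha) / 3 by rewrite /b; field.
rewrite powR_cube ?(ltW Ke) // powRM ?(ltW K0) ?(ltW p0) // mulrA.
by rewrite -powRD ?subrr ?powRr0 ?mul1r //; apply/implyP => _; rewrite gt_eqF.
Qed.

(** The product of the three coordinates is at most |p|^3, and the exponent q/3 < 1 is integrable at
    0 in each variable. *)
Lemma itg_head (q L : R) : 0 < q < 3 -> 0 < L ->
  itg (fun p : pt R => \1_[set p : pt R | [/\ 0 < p.1.1 <= L, 0 < p.1.2 <= L & 0 < p.2 <= L]] p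
     * enorm p `^ (- q)).
Proof.
move=> /andP[q0 q3] L0; set D := [set p | _].
have mi : measurable (`]0, L]%classic : set R1) by exact: measurable_itv.
pose f (t : R) := \1_(`]0, L]%classic : set R) t * t `^ (- (q / 3)).
have mf : measurable_fun [set: R1] f.
  by apply: measurable_funM; [exact: measurable_indic|exact: measurable_powR].
have f0 t : 0 <= f t by rewrite mulr_ge0 ?powR_ge0 // indicE.
have fi : (\int[lam]_t (f t)%:E < +oo)%E.
  have -> : (\int[lam]_t (f t)%:E = \int[lam]_(t in `]0%R, L]) (t `^ (- (q / 3)))%:E)%E.
    rewrite [RHS]integral_mkcond; apply: eq_integral => t _.
    by rewrite /patch /f indicE; case: ifP => _; rewrite ?mul1r ?mul0r.
  by apply: integral_head_powR => //; apply/andP; split; lra.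
have DE : D = [set p : pt R | (`]0, L]%classic : set R) p.1.1 /\
    (`]0, L]%classic : set R) p.1.2 /\ (`]0, L]%classic : set R) p.2].
  by apply/seteqP; split => p /=; rewrite !in_itv /= => -[] // h1 [].
apply: itg_le (itg_prod f0 mf fi) _.
  apply: measM; last exact: meas_enorm_powR.
  by apply: meas_indic; rewrite DE; exact: measurable_box3.
move=> p; have [Dp|Dp] := pselect (D p); last first.
  rewrite indic_out // mul0r normr0; apply: mulr_ge0; last exact: f0.
  by apply: mulr_ge0; exact: f0.
rewrite indic_in //.
have [/andP[x0 xL] /andP[y0 yL] /andP[z0 zL]] := Dp.
rewrite mul1r ger0_norm ?powR_ge0 //.
have E t : 0 < t -> t <= L -> f t = t `^ (- (q / 3)).
  by move=> t0 tL; rewrite /f indicE mem_set ?mul1r //= in_itv /= t0.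
rewrite !E // powR_prod3 ?(ltW x0) ?(ltW y0) ?(ltW z0) // -(@powR_cube (enorm p)) ?enorm_ge0 //.
have [h1 h2 h3] := co_le_enorm p.
rewrite (ger0_norm (ltW x0)) in h1; rewrite (ger0_norm (ltW y0)) in h2.
rewrite (ger0_norm (ltW z0)) in h3.
rewrite mulNr powR_anti ?mulr_gt0 //; last by rewrite divr_ge0 ?(ltW q0).
rewrite (_ : _ ^+ 3 = enorm p * enorm p * enorm p); last by ring.
by rewrite !ler_pM ?mulr_ge0 ?(ltW x0) ?(ltW y0) ?(ltW z0).
Qed.

End Integrability.

(** * Estimates on symmetric pairs of points *)

Section Pointwise.
Context {R : realType}.

Lemma normrM_le (a b x y : R) : `|a| <= x -> `|b| <= y -> `|a * b| <= x * y.
Proof. by move=> ax bY; rewrite normrM ler_pM. Qed.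

Lemma powR_diff (s x a b : R) : 0 <= s -> 0 < x -> x <= a -> x <= b ->
  `|a `^ (- s) - b `^ (- s)| <= s * x `^ (- (s + 1)) * `|a - b|.
Proof.
move=> s0 x0; wlog ab : a b / a <= b.
  move=> H xa xb; have [ab|/ltW ba] := leP a b; first exact: H.
  by rewrite distrC [`|a - b|]distrC; exact: H.
move=> xa xb.
have D (t : R) : 0 < t -> is_derive t (1 : R) (@powR R ^~ (- s)) (- s * t `^ (- s - 1)).
  exact: is_derive1_powR.
have [t|t|c] := @MVT_segment R (@powR R ^~ (- s)) (fun t => - s * t `^ (- s - 1)) a b ab.
- by rewrite in_itv /= => /andP[h _]; apply: D; apply: lt_trans h; exact: lt_le_trans xa.
- apply: derivable_within_continuous => y; rewrite in_itv /= => /andP[h _].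
  by have := D y (lt_le_trans (lt_le_trans x0 xa) h); case.
rewrite in_itv /= => /andP[ac cb] E.
rewrite distrC E normrM distrC ler_wpM2r // normrM normrN (ger0_norm s0).
rewrite ger0_norm ?powR_ge0 // ler_wpM2l // (_ : - s - 1 = - (s + 1)); last by ring.
by apply: powR_anti; [exact: x0|exact: le_trans ac|rewrite addr_ge0].
Qed.

(** Read s, n, d as |c|^2, |v|^2 and the scalar product of c and v: the inverses are |c+v|^-2,
    |c-v|^-2 and |c|^-2. Over a common denominator the numerators are -4 d, of size r h, and 2 (4
    d^2 - n (s + n)), of size r^2 h^2; each inverse contributes 4 r^-2. *)
Lemma inv_pair (r h s n d : R) : 0 < r -> 0 <= h -> h <= r -> 0 <= n -> n <= h ^+ 2 ->
  `|d| <= 2 * r * h -> s <= 3 * r ^+ 2 -> r ^+ 2 / 4 <= s ->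
  r ^+ 2 / 4 <= s + n + 2 * d -> r ^+ 2 / 4 <= s + n - 2 * d ->
  [/\ `|(s + n + 2 * d)^-1| <= 4 * r^-1 ^+ 2, `|(s + n - 2 * d)^-1| <= 4 * r^-1 ^+ 2,
   `|(s + n + 2 * d)^-1 - (s + n - 2 * d)^-1| <= 128 * h * r^-1 ^+ 3 &
   `|(s + n + 2 * d)^-1 + (s + n - 2 * d)^-1 - 2 * s^-1| <= 2560 * h ^+ 2 * r^-1 ^+ 4].
Proof.
move=> r0 h0 hr n0 nh dh s3 s4 p4 m4.
have q0 : 0 < r ^+ 2 / 4 by rewrite divr_gt0 // exprn_gt0.
have I x : r ^+ 2 / 4 <= x -> `|x^-1| <= 4 * r^-1 ^+ 2.
  move=> xq; have x0 : 0 < x := lt_le_trans q0 xq.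
  rewrite ger0_norm ?invr_ge0 ?(ltW x0) //.
  have -> : 4 * r^-1 ^+ 2 = (r ^+ 2 / 4)^-1 by field; rewrite gt_eqF.
  by rewrite lef_pV2 ?posrE.
have Is := I _ s4; have Ip := I _ p4; have Im := I _ m4.
have sn : s != 0 by rewrite gt_eqF // (lt_le_trans q0).
have pn : s + n + 2 * d != 0 by rewrite gt_eqF // (lt_le_trans q0).
have mn : s + n - 2 * d != 0 by rewrite gt_eqF // (lt_le_trans q0).
have d2 : d ^+ 2 <= 4 * r ^+ 2 * h ^+ 2.
  have := normrM_le dh dh; rewrite -expr2 ger0_norm ?sqr_ge0 // => /le_trans; apply.
  by rewrite le_eqVlt; apply/orP; left; apply/eqP; ring.
split => //.
- have -> : (s + n + 2 * d)^-1 - (s + n - 2 * d)^-1 =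
    (- 4 * d) * ((s + n + 2 * d)^-1 * (s + n - 2 * d)^-1) by field; rewrite mn pn.
  have -> : 128 * h * r^-1 ^+ 3 = (4 * (2 * r * h)) * ((4 * r^-1 ^+ 2) * (4 * r^-1 ^+ 2)).
    by field; rewrite gt_eqF.
  apply: normrM_le; last exact: normrM_le.
  by rewrite normrM normrN normr_nat ler_wpM2l.
- have -> : (s + n + 2 * d)^-1 + (s + n - 2 * d)^-1 - 2 * s^-1 =
    (2 * (4 * d ^+ 2 - n * (s + n))) * (s^-1 * ((s + n + 2 * d)^-1 * (s + n - 2 * d)^-1)).
    by field; rewrite mn pn sn.
  have -> : 2560 * h ^+ 2 * r^-1 ^+ 4 = (2 * (20 * r ^+ 2 * h ^+ 2)) *
     ((4 * r^-1 ^+ 2) * ((4 * r^-1 ^+ 2) * (4 * r^-1 ^+ 2))).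
    by field; rewrite gt_eqF.
  apply: normrM_le; last by apply: normrM_le => //; exact: normrM_le.
  rewrite normrM normr_nat ler_wpM2l //.
  have h2 : h ^+ 2 <= r ^+ 2 by rewrite ler_pXn2r ?nnegrE ?(ltW r0).
  have s0 : 0 <= s by exact: le_trans (ltW q0) s4.
  have : n * (s + n) <= h ^+ 2 * (4 * r ^+ 2) by apply: ler_pM => //; [exact: addr_ge0|lra].
  have : 0 <= n * (s + n) by rewrite mulr_ge0 // addr_ge0.
  have : 0 <= d ^+ 2 by exact: sqr_ge0.
  have -> : h ^+ 2 * (4 * r ^+ 2) = 4 * (r ^+ 2 * h ^+ 2) by ring.
  have -> : 20 * r ^+ 2 * h ^+ 2 = 20 * (r ^+ 2 * h ^+ 2) by ring.
  have {}d2 : d ^+ 2 <= 4 * (r ^+ 2 * h ^+ 2) by apply: (le_trans d2); rewrite mulrA.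
  by move=> *; rewrite ler_norml; apply/andP; split; lra.
Qed.

(** A discrete Leibniz rule on a symmetric pair. Every first difference costs a factor h/r and every
    second difference (h/r)^2. The three terms of the second difference give 4 + 2560 + 64 <= 2700,
    the two of the first 4 + 128 = 132. *)
Lemma quotient_pair (r h M Tp Tm T0 A B C0 : R) : 0 < r -> 0 <= h -> 0 <= M ->
  `|T0| <= M * r ^+ 2 -> `|Tp| <= M * r ^+ 2 -> `|Tm| <= M * r ^+ 2 ->
  `|Tp - Tm| <= M * r * h -> `|Tp + Tm - 2 * T0| <= M * h ^+ 2 ->
  `|A| <= 4 * r^-1 ^+ 2 -> `|B| <= 4 * r^-1 ^+ 2 -> `|A - B| <= 128 * h * r^-1 ^+ 3 ->
  `|A + B - 2 * C0| <= 2560 * h ^+ 2 * r^-1 ^+ 4 ->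
  `|A * Tp + B * Tm - 2 * (C0 * T0)| <= 2700 * M * h ^+ 2 * r^-1 ^+ 2 /\
  `|A * Tp - B * Tm| <= 132 * M * h * r^-1.
Proof.
move=> r0 h0 M0 t0 tp tm td ts a b ab abc; have rn : r != 0 by rewrite gt_eqF.
have sab : `|A + B| <= 8 * r^-1 ^+ 2 by apply: (le_trans (ler_normD _ _)); lra.
have stt : `|Tp + Tm| <= 2 * (M * r ^+ 2) by apply: (le_trans (ler_normD _ _)); lra.
split.
- have -> : A * Tp + B * Tm - 2 * (C0 * T0) = 2^-1 * ((Tp + Tm - 2 * T0) * (A + B)) +
    T0 * (A + B - 2 * C0) + 2^-1 * ((Tp - Tm) * (A - B)) by field.
  have e1 := normrM_le ts sab; have e2 := normrM_le t0 abc; have e3 := normrM_le td ab.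
  apply: (le_trans (ler_normD _ _)).
  apply: (le_trans (lerD (ler_normD _ _) (lexx _))).
  have z2 : `|2^-1 : R| = 2^-1 by rewrite ger0_norm ?invr_ge0.
  rewrite [`|2^-1 * _|]normrM [X in _ + X]normrM z2.
  have q1 : M * h ^+ 2 * (8 * r^-1 ^+ 2) = 8 * (M * h ^+ 2 * r^-1 ^+ 2) by ring.
  have q2 : M * r ^+ 2 * (2560 * h ^+ 2 * r^-1 ^+ 4) = 2560 * (M * h ^+ 2 * r^-1 ^+ 2) by field.
  have q3 : M * r * h * (128 * h * r^-1 ^+ 3) = 128 * (M * h ^+ 2 * r^-1 ^+ 2) by field.
  have q4 : 2700 * M * h ^+ 2 * r^-1 ^+ 2 = 2700 * (M * h ^+ 2 * r^-1 ^+ 2) by ring.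
  have q0 : 0 <= M * h ^+ 2 * r^-1 ^+ 2 by apply: mulr_ge0; [apply: mulr_ge0 => //|]; exact: sqr_ge0.
  by rewrite q1 in e1; rewrite q2 in e2; rewrite q3 in e3; rewrite q4; lra.
- have -> : A * Tp - B * Tm = 2^-1 * ((Tp - Tm) * (A + B)) + 2^-1 * ((Tp + Tm) * (A - B)) by field.
  have e1 := normrM_le td sab; have e2 := normrM_le stt ab.
  apply: (le_trans (ler_normD _ _)).
  have z2 : `|2^-1 : R| = 2^-1 by rewrite ger0_norm ?invr_ge0.
  rewrite [`|2^-1 * _|]normrM [X in _ + X]normrM z2.
  have q1 : M * r * h * (8 * r^-1 ^+ 2) = 8 * (M * h * r^-1) by field.
  have q2 : 2 * (M * r ^+ 2) * (128 * h * r^-1 ^+ 3) = 256 * (M * h * r^-1) by field.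
  have q4 : 132 * M * h * r^-1 = 132 * (M * h * r^-1) by ring.
  by rewrite q1 in e1; rewrite q2 in e2; rewrite q4; lra.
Qed.

Definition dot (p q : pt R) : R := p.1.1 * q.1.1 + p.1.2 * q.1.2 + p.2 * q.2.

Lemma enorm_sqrD (c v : pt R) : enorm (c + v) ^+ 2 = enorm c ^+ 2 + enorm v ^+ 2 + 2 * dot c v.
Proof. by rewrite !enorm_sqr /dot /=; ring. Qed.

Lemma enorm_sqrB (c v : pt R) : enorm (c - v) ^+ 2 = enorm c ^+ 2 + enorm v ^+ 2 - 2 * dot c v.
Proof. by rewrite !enorm_sqr /dot /=; ring. Qed.

Lemma dot_le (p q : pt R) : `|dot p q| <= 3 * (`|p| * `|q|).
Proof.
have := lexx `|p|; rewrite {1}pnorm_le => /and3P[a1 a2 a3].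
have := lexx `|q|; rewrite {1}pnorm_le => /and3P[b1 b2 b3].
have e1 := normrM_le a1 b1; have e2 := normrM_le a2 b2; have e3 := normrM_le a3 b3.
apply: (le_trans (ler_normD _ _)).
apply: (le_trans (lerD (ler_normD _ _) (lexx _))).
by rewrite (_ : 3 * (`|p| * `|q|) = `|p| * `|q| + `|p| * `|q| + `|p| * `|q|); [rewrite !lerD|ring].
Qed.

Lemma enorm_sqr_le (p : pt R) : enorm p ^+ 2 <= 3 * `|p| ^+ 2.
Proof.
have := dot_le p p; rewrite /dot -expr2 enorm_sqr !expr2; apply: le_trans; exact: ler_norm.
Qed.

Lemma enorm_powR_sqr (p : pt R) : enorm p `^ (- 2) = (enorm p ^+ 2)^-1.
Proof. by rewrite powRN -powR_mulrn ?enorm_ge0. Qed.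

Lemma ratio_pair (T : pt R -> R) (r h M : R) (c v : pt R) :
  0 < r -> 0 <= h -> h <= r -> 0 <= M -> `|v| <= h / 2 ->
  (forall p, `|p| <= r -> `|T p| <= M * r ^+ 2) ->
  (forall p q, `|p| <= r -> `|q| <= r -> `|T p - T q| <= M * r * `|p - q|) ->
  (forall c v, `|c + v| <= r -> `|c - v| <= r -> `|T (c + v) + T (c - v) - 2 * T c| <= M * `|v| ^+ 2) ->
  `|c| <= r -> `|c + v| <= r -> `|c - v| <= r ->
  r / 2 <= enorm c -> r / 2 <= enorm (c + v) -> r / 2 <= enorm (c - v) ->
  let Q p := enorm p `^ (- 2) * T p in
  `|Q (c + v) + Q (c - v) - 2 * Q c| <= 2700 * M * h ^+ 2 * r^-1 ^+ 2 /\
  `|Q (c + v) - Q (c - v)| <= 132 * M * h * r^-1.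
Proof.
move=> r0 h0 hr M0 vh t0 t1 t2 cr pr mr ec ep em Q.
rewrite /Q !enorm_powR_sqr enorm_sqrD enorm_sqrB.
have sq x : r / 2 <= x -> r ^+ 2 / 4 <= x ^+ 2.
  move=> hx; rewrite (_ : r ^+ 2 / 4 = (r / 2) ^+ 2); last by field.
  by rewrite ler_pXn2r ?nnegrE ?divr_ge0 ?(ltW r0) // (le_trans _ hx) ?divr_ge0 ?(ltW r0).
have v2 : `|v| ^+ 2 <= h ^+ 2 / 4.
  rewrite (_ : h ^+ 2 / 4 = (h / 2) ^+ 2); last by field.
  by rewrite ler_pXn2r ?nnegrE ?divr_ge0.
have hh := sqr_ge0 h.
have n1 : enorm v ^+ 2 <= h ^+ 2 by have := enorm_sqr_le v; lra.
have d1 : `|dot c v| <= 2 * r * h.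
  apply: (le_trans (dot_le c v)).
  have : `|c| * `|v| <= r * (h / 2) by apply: ler_pM.
  have : 0 <= r * h by rewrite mulr_ge0 // ltW.
  lra.
have s1 : enorm c ^+ 2 <= 3 * r ^+ 2.
  by apply: (le_trans (enorm_sqr_le c)); rewrite ler_wpM2l // ler_pXn2r ?nnegrE ?(ltW r0).
have [|||] := @inv_pair r h (enorm c ^+ 2) (enorm v ^+ 2) (dot c v) r0 h0 hr (sqr_ge0 _) n1 d1 s1.
- exact: sq.
- by rewrite -enorm_sqrD; exact: sq.
- by rewrite -enorm_sqrB; exact: sq.
move=> i1 i2 i3 i4.
apply: quotient_pair => //.
- exact: t0.
- exact: t0.
- exact: t0.
- apply: (le_trans (t1 _ _ pr mr)); rewrite ler_wpM2l ?mulr_ge0 ?(ltW r0) //.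
  have -> : c + v - (c - v) = v + v by rewrite opprB [v - c]addrC addrACA subrr add0r.
  by apply: (le_trans (ler_normD _ _)); lra.
- apply: (le_trans (t2 _ _ pr mr)); rewrite ler_wpM2l //; lra.
Qed.

Lemma weight_pair (a r h : R) (c v : pt R) : 0 <= a -> 0 < r -> 0 <= h ->
  `|v| <= h / 2 -> `|c| <= r -> r / 2 <= enorm (c + v) -> r / 2 <= enorm (c - v) ->
  `|enorm (c + v) `^ (- a) - enorm (c - v) `^ (- a)| <=
     6 * a * (r / 2) `^ (- (a + 1)) * h.
Proof.
move=> a0 r0 h0 vh cr ep em; have r2 : 0 < r / 2 by rewrite divr_gt0.
apply: (le_trans (powR_diff a0 r2 ep em)).
have -> : 6 * a * (r / 2) `^ (- (a + 1)) * h = a * (r / 2) `^ (- (a + 1)) * (6 * h) by ring.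
rewrite ler_wpM2l ?mulr_ge0 ?powR_ge0 //.
(* The norms are compared through their squares: the right side is at most 6 r h, while the sum of
   the two norms is at least r. *)
have E : (enorm (c + v) - enorm (c - v)) * (enorm (c + v) + enorm (c - v)) = 4 * dot c v.
  by rewrite -subr_sqr enorm_sqrD enorm_sqrB; ring.
have s0 : r <= enorm (c + v) + enorm (c - v) by lra.
have s1 : 0 < enorm (c + v) + enorm (c - v) by lra.
rewrite -(ler_pM2r s1) -{1}(ger0_norm (ltW s1)) -normrM E normrM normr_nat.
have d1 : `|dot c v| <= 3 * (r * (h / 2)).
  by apply: (le_trans (dot_le c v)); rewrite ler_wpM2l // ler_pM.
apply: (@le_trans _ _ (6 * h * r)); first by lra.
by rewrite ler_wpM2l ?mulr_ge0.
Qed.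

Lemma weighted_pair (Qp Qm A wp wm D E W W' : R) :
  `|Qp + Qm - 2 * A| <= D -> `|Qp - Qm| <= E -> `|wp| <= W -> `|wm| <= W ->
  `|wp - wm| <= W' ->
  `|(Qp - A) * wp + (Qm - A) * wm| <= D * W + E * W'.
Proof.
move=> d e p m pm.
have -> : (Qp - A) * wp + (Qm - A) * wm =
  2^-1 * ((Qp + Qm - 2 * A) * (wp + wm)) + 2^-1 * ((Qp - Qm) * (wp - wm)) by field.
have s : `|wp + wm| <= 2 * W by apply: (le_trans (ler_normD _ _)); lra.
have e1 := normrM_le d s; have e2 := normrM_le e pm.
have e3 : 0 <= E * W' by apply: le_trans e2.
apply: (le_trans (ler_normD _ _)).
have z2 : `|2^-1 : R| = 2^-1 by rewrite ger0_norm ?invr_ge0.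
by rewrite [`|2^-1 * _|]normrM [X in _ + X]normrM z2; lra.
Qed.

End Pointwise.

(** * Cells *)

Section Cells.
Context {R : realType}.
Variables (L : R) (N : nat).
Hypotheses (L0 : 0 < L) (N0 : (0 < N)%N).
Local Notation R1 := (measurableTypeR R).
Local Notation R3 := (R1 * R1 * R1)%type.
Local Notation h := (hstep L N).
Local Notation cell := (Defs.cell L N).
Local Notation node := (Defs.xi L N).

Lemma hstep_gt0 : 0 < h.
Proof. by rewrite /hstep divr_gt0 // ltr0n. Qed.

Lemma hstepN : N%:R * h = L.
Proof. by rewrite /hstep mulrC divfK // pnatr_eq0 -lt0n. Qed.

Definition cell_mid (i j k : nat) : pt R :=
  ((i%:R + 2^-1) * h, (j%:R + 2^-1) * h, (k%:R + 2^-1) * h).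

Lemma seg_center (i : nat) (t : R) : i%:R * h <= t <= i.+1%:R * h ->
  `|t - (i%:R + 2^-1) * h| <= h / 2.
Proof.
have h0 := hstep_gt0.
have -> : i.+1%:R * h = i%:R * h + h by rewrite -natr1 mulrDl mul1r.
have -> : (i%:R + 2^-1) * h = i%:R * h + h / 2 by rewrite mulrDl [2^-1 * h]mulrC.
by move=> /andP[a b]; rewrite ler_norml; apply/andP; split; lra.
Qed.

Lemma center_seg (i : nat) (v : R) : `|v| <= h / 2 ->
  i%:R * h <= (i%:R + 2^-1) * h + v <= i.+1%:R * h.
Proof.
have h0 := hstep_gt0.
have -> : i.+1%:R * h = i%:R * h + h by rewrite -natr1 mulrDl mul1r.
have -> : (i%:R + 2^-1) * h = i%:R * h + h / 2 by rewrite mulrDl [2^-1 * h]mulrC.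
by rewrite ler_norml => /andP[a b]; apply/andP; split; lra.
Qed.

Lemma cell_center (i j k : nat) (p : pt R) : cell i j k p -> `|p - cell_mid i j k| <= h / 2.
Proof.
by move=> [a [b c]]; rewrite pnorm_le /=; apply/and3P; split; exact: seg_center.
Qed.

Lemma center_cell (i j k : nat) (v : pt R) : `|v| <= h / 2 -> cell i j k (cell_mid i j k + v).
Proof.
by rewrite pnorm_le => /and3P[a b c]; split; [|split]; exact: center_seg.
Qed.

(** The sup norm of the far corner of the cell. On a cell other than the one at the origin it is
    comparable to the norm of every point, and it serves there as the scale r. *)
Definition rad (i j k : nat) : R := (maxn (maxn i j) k).+1%:R * h.

Lemma rad_gt0 i j k : 0 < rad i j k.
Proof. by rewrite mulr_gt0 ?ltr0n // hstep_gt0. Qed.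

Lemma step_le_rad i j k : h <= rad i j k.
Proof. by rewrite /rad ler_peMl ?(ltW hstep_gt0) // ler1n. Qed.

Lemma cell_rad i j k p : (i + j + k != 0)%N -> cell i j k p ->
  `|p| <= rad i j k /\ rad i j k / 2 <= enorm p.
Proof.
move=> ijk [/andP[a1 a2] [/andP[b1 b2] /andP[c1 c2]]].
have h0 := ltW hstep_gt0.
have n0 (n : nat) : 0 <= n%:R * h by rewrite mulr_ge0.
have up (n : nat) (t : R) : (n <= maxn (maxn i j) k)%N -> n%:R * h <= t -> t <= n.+1%:R * h ->
    `|t| <= rad i j k.
  move=> nm t1 t2; rewrite ger0_norm; last exact: le_trans t1.
  by apply: (le_trans t2); rewrite ler_wpM2r // ler_nat.
split.
  rewrite pnorm_le; apply/and3P.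
  by split; [apply: (up i)|apply: (up j)|apply: (up k)] => //; rewrite !leq_max leqnn ?orbT.
apply: le_trans (normr_le_enorm p).
have lo (n : nat) (t : R) : n%:R * h <= t -> `|t| <= `|p| -> n%:R * h <= `|p|.
  by move=> t1; apply: le_trans; apply: (le_trans t1); exact: ler_norm.
have := lexx `|p|; rewrite {1}pnorm_le => /and3P[x y z].
have m : (maxn (maxn i j) k)%:R * h <= `|p|.
  case: (leqP (maxn i j) k) => _; first exact: (lo _ _ c1 z).
  case: (leqP i j) => _; first exact: (lo _ _ b1 y).
  exact: (lo _ _ a1 x).
apply: le_trans m; rewrite /rad -natr1 mulrDl mul1r.
(* Away from the origin the largest index m is at least 1, so m >= (m + 1) / 2. *)
have : 1 * h <= (maxn (maxn i j) k)%:R * h.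
  rewrite ler_wpM2r // ler1n lt0n; apply: contraNN ijk.
  by rewrite -leqn0 !geq_max !leqn0 => /andP[/andP[/eqP-> /eqP->] /eqP->].
lra.
Qed.

Definition avg (f : pt R -> R) (i j k : nat) : R :=
  8^-1 * \sum_(m < 2) \sum_(n < 2) \sum_(s < 2) f (node (i + m) (j + n) (k + s)).

Lemma node_center (i j k : nat) (m n s : 'I_2) : exists2 v : pt R, `|v| <= h / 2 &
  node (i + m) (j + n) (k + s) = cell_mid i j k + v /\
  node (i + rev_ord m) (j + rev_ord n) (k + rev_ord s) = cell_mid i j k - v.
Proof.
have h0 := hstep_gt0.
pose w (m : 'I_2) : R := (m%:R - 2^-1) * h.
have wE (i' : nat) (m' : 'I_2) : (i' + m')%:R * h = (i'%:R + 2^-1) * h + w m'.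
  by rewrite /w natrD; ring.
have rE (m' : 'I_2) : (rev_ord m')%:R = 1 - m'%:R :> R.
  case: m' => [[|[|//]] ?]; first by rewrite /= (_ : (2 - 1)%N = 1%N) // subr0.
  by rewrite /= (_ : (2 - 2)%N = 0%N) // subrr.
have wN (m' : 'I_2) : w (rev_ord m') = - w m' by rewrite /w rE; field.
have wb (m' : 'I_2) : `|w m'| <= h / 2.
  by rewrite /w; case: m' => [[|[|//]] ?] /=; rewrite ler_norml; apply/andP; split; lra.
exists (w m, w n, w s); first by rewrite pnorm_le /= !wb.
by rewrite /Defs.xi /mkpt !wE !wN.
Qed.

(** The eight corners form four pairs symmetric about the centre, so the average differs from the
    central value by a mean of second differences. *)
Lemma avg_center (f : pt R -> R) (i j k : nat) (D : R) :
  (forall v, `|v| <= h / 2 ->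
    `|f (cell_mid i j k + v) + f (cell_mid i j k - v) - 2 * f (cell_mid i j k)| <= D) ->
  `|2 * f (cell_mid i j k) - 2 * avg f i j k| <= D.
Proof.
move=> fD; set c := cell_mid i j k in fD *.
have P (m n s : 'I_2) : `|f (node (i + m) (j + n) (k + s)) +
    f (node (i + rev_ord m) (j + rev_ord n) (k + rev_ord s)) - 2 * f c| <= D.
  by have [v vh [-> ->]] := node_center i j k m n s; exact: fD.
pose o0 : 'I_2 := ord0; pose o1 : 'I_2 := ord_max.
have := P o0 o0 o0; have := P o0 o0 o1; have := P o0 o1 o0; have := P o0 o1 o1.
rewrite /avg !big_ord_recr !big_ord0 /= !add0r.
set f000 := f (node (i + 0) (j + 0) (k + 0)).
rewrite !ler_norml => /andP[a1 a2] /andP[b1 b2] /andP[c1 c2] /andP[d1 d2].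
apply/andP; split; lra.
Qed.

(** [nratio] is the function Q of the overview, and [weight] is omega_2, as 2 - (3 + alpha) = - (1 +
    alpha). *)
Definition nratio (T : pt R -> R) (p : pt R) : R := enorm p `^ (- 2) * T p.
Definition weight (alpha : R) (p : pt R) : R := enorm p `^ (- (1 + alpha)).

(** With r the scale of the cell, the second difference of [nratio T] times the weight has size (h^2
    r^(alpha+eps-2)) r^(-1-alpha), and the product of the first differences has size (h
    r^(alpha+eps-1)) (h r^(-2-alpha)). Both equal h^2 r^(eps-3). *)
Lemma cell_pair_bound (T : pt R -> R) (K alpha eps : R) (i j k : nat) (p : pt R) :
  0 <= K -> 0 < alpha -> 0 < eps -> alpha + eps <= 2 ->
  (forall r, 0 < r -> (forall p, `|p| <= r -> `|T p| <= K * r `^ (alpha + eps) * r ^+ 2) /\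
    (forall p q, `|p| <= r -> `|q| <= r ->
       `|T p - T q| <= K * r `^ (alpha + eps) * r * `|p - q|) /\
    (forall c v, `|c + v| <= r -> `|c - v| <= r ->
      `|T (c + v) + T (c - v) - 2 * T c| <= K * r `^ (alpha + eps) * `|v| ^+ 2)) ->
  (i + j + k != 0)%N -> cell i j k p ->
  `|(nratio T p - avg (nratio T) i j k) * weight alpha p +
    (nratio T (cell_mid i j k + cell_mid i j k - p) - avg (nratio T) i j k) *
      weight alpha (cell_mid i j k + cell_mid i j k - p)| <=
    64 * (100 * 110) * K * h ^+ 2 * enorm p `^ (- (3 - eps)).
Proof.
move=> K0 a0 e0 ae HT ijk cp.
(* The first summand comes from two second differences of [nratio T], the second from the product of
   first differences; alpha <= 2 bounds the sum by 10152. *)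
have k1 : 2 * 2700 + 12 * 132 * (1 + alpha) <= 100 * 110 by lra.
set Q := nratio T; set w := weight alpha; set p' := cell_mid i j k + cell_mid i j k - p.
have a3 : 0 <= 3 - eps by lra.
have a3' : 3 - eps <= 3 by lra.
set r := rad i j k; have r0 : 0 < r := rad_gt0 i j k.
have hr : h <= r := step_le_rad i j k; have h0 := hstep_gt0.
have [t0 [t1 t2]] := HT r r0.
set c := cell_mid i j k; set M := K * r `^ (alpha + eps).
have M0 : 0 <= M by rewrite mulr_ge0 // powR_ge0.
have RP v : `|v| <= h / 2 ->
  `|Q (c + v) + Q (c - v) - 2 * Q c| <= 2700 * M * h ^+ 2 * r^-1 ^+ 2 /\
  `|Q (c + v) - Q (c - v)| <= 132 * M * h * r^-1.
  move=> vh.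
  have [cr ce] : `|c| <= r /\ r / 2 <= enorm c.
    apply: cell_rad ijk _; rewrite -[c]addr0; apply: center_cell.
    by rewrite normr0 divr_ge0 // ltW.
  have [pr pe] := cell_rad ijk (center_cell i j k vh).
  have [mr me] : `|c - v| <= r /\ r / 2 <= enorm (c - v).
    by apply: cell_rad ijk _; apply: center_cell; rewrite normrN.
  exact: (ratio_pair r0 (ltW h0) hr M0 vh t0 t1 t2 cr pr mr ce pe me).
set v := p - c; have vh : `|v| <= h / 2 := cell_center cp.
have pE : p = c + v by rewrite /v addrC subrK.
have p'E : p' = c - v by rewrite /p' pE -/c opprD addrACA subrr add0r.
have [q1 q2] := RP v vh.
have q3 := avg_center (fun v vh => (RP v vh).1).
have [pr pe] := cell_rad ijk (center_cell i j k vh).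
have vh' : `|- v| <= h / 2 by rewrite normrN.
have [mr me] := cell_rad ijk (center_cell i j k vh').
have [cr ce] : `|c| <= r /\ r / 2 <= enorm c.
  apply: cell_rad ijk _; rewrite -[c]addr0; apply: center_cell.
  by rewrite normr0 divr_ge0 // ltW.
have a1 : 0 <= 1 + alpha by rewrite addr_ge0 // ltW.
have wp := weight_pair a1 r0 (ltW h0) vh cr pe me.
have r2 : 0 < r / 2 by rewrite divr_gt0.
set rho := r / 2 in r2 wp pe me.
have W1 : `|w (c + v)| <= rho `^ (- (1 + alpha)).
  by rewrite /w /weight ger0_norm ?powR_ge0 // powR_anti.
have W2 : `|w (c - v)| <= rho `^ (- (1 + alpha)).
  by rewrite /w /weight ger0_norm ?powR_ge0 // powR_anti.
(* Replacing the central value by the corner average costs one more second difference, hence the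
   factor 2. *)
have q4 : `|Q (c + v) + Q (c - v) - 2 * avg Q i j k| <= 2 * 2700 * M * h ^+ 2 * r^-1 ^+ 2.
  have -> : Q (c + v) + Q (c - v) - 2 * avg Q i j k = (Q (c + v) + Q (c - v) - 2 * Q c)
    + (2 * Q c - 2 * avg Q i j k) by ring.
  apply: (le_trans (ler_normD _ _)).
  have -> : 2 * 2700 * M * h ^+ 2 * r^-1 ^+ 2 = 2700 * M * h ^+ 2 * r^-1 ^+ 2 +
    2700 * M * h ^+ 2 * r^-1 ^+ 2 by ring.
  exact: lerD.
rewrite p'E {1 2}pE; apply: (le_trans (weighted_pair q4 q2 W1 W2 wp)).
have rn : r != 0 by rewrite gt_eqF.
have rhon : rho != 0 by rewrite gt_eqF.
have e1 : rho `^ (- (1 + alpha + 1)) = rho `^ (- (1 + alpha)) * (2 * r^-1).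
  rewrite opprD powRD; last by apply/implyP => _.
  congr (_ * _); rewrite powRN powRr1 ?(ltW r2) //.
  by rewrite /rho invfM invrK mulrC.
rewrite e1.
set W := rho `^ (- (1 + alpha)); have Wge : 0 <= W := powR_ge0 _ _.
apply: (@le_trans _ _ (100 * 110 * (M * h ^+ 2 * r^-1 ^+ 2 * W))).
  have z0 : 0 <= M * h ^+ 2 * r^-1 ^+ 2 * W.
    by apply: mulr_ge0 => //; apply: mulr_ge0; [apply: mulr_ge0 => //|]; exact: sqr_ge0.
  have -> : 2 * 2700 * M * h ^+ 2 * r^-1 ^+ 2 * W + 132 * M * h * r^-1 *
     (6 * (1 + alpha) * (W * (2 * r^-1)) * h) =
     (2 * 2700 + 12 * 132 * (1 + alpha)) * (M * h ^+ 2 * r^-1 ^+ 2 * W) by ring.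
  exact: ler_wpM2r z0 _ _ k1.
have -> : 64 * (100 * 110) * K * h ^+ 2 * enorm p `^ (- (3 - eps)) =
  100 * 110 * (K * h ^+ 2 * (64 * enorm p `^ (- (3 - eps)))) by ring.
apply: ler_wpM2l; first by rewrite mulr_ge0.
have -> : M * h ^+ 2 * r^-1 ^+ 2 * W = K * h ^+ 2 * (r `^ (alpha + eps) * r^-1 ^+ 2 * W).
  by rewrite /M; ring.
have Kh : 0 <= K * h ^+ 2 by apply: mulr_ge0 => //; exact: sqr_ge0.
apply: (ler_wpM2l Kh).
(* The factor 2^(alpha+eps) <= 4 lost here is regained from r^-2 = rho^-2 / 4. *)
have e2 : r `^ (alpha + eps) <= 4 * rho `^ (alpha + eps).
  have -> : r = 2 * rho by rewrite /rho; field.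
  rewrite powRM ?(ltW r2) // ler_wpM2r ?powR_ge0 //.
  have -> : (4 : R) = 2 `^ 2 by rewrite powR_mulrn // -natrX.
  by rewrite ler_powR // ler1n.
have e3 : r^-1 ^+ 2 = 4^-1 * rho `^ (- 2).
  by rewrite powRN powR_mulrn ?(ltW r2) // /rho; field.
have e4 : r `^ (alpha + eps) * r^-1 ^+ 2 * W <= rho `^ (- (3 - eps)).
  have -> : rho `^ (- (3 - eps)) = rho `^ (alpha + eps) * rho `^ (- 2) * W.
    rewrite /W -powRD; last by apply/implyP => _.
    rewrite -powRD; last by apply/implyP => _.
    by congr (_ `^ _); ring.
  rewrite e3; apply: (ler_wpM2r Wge); rewrite mulrA; apply: ler_wpM2r; first exact: powR_ge0.
  by rewrite ler_pdivrMr // mulrC.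
apply: (le_trans e4).
have ep0 : 0 < enorm p by rewrite pE; exact: lt_le_trans pe.
(* The Euclidean norm is at most twice the sup norm, so |p| <= 2 r = 4 rho; with the exponent 3 -
   eps <= 3 this costs 4^3 = 64. *)
have e5 : enorm p / 4 <= rho.
  have := enorm_le_normr p; rewrite {2}pE => h1.
  rewrite /rho ler_pdivrMr // mulrAC -mulrA (_ : 4 / 2 = 2); last by field.
  by rewrite mulrC; apply: (le_trans h1); rewrite ler_wpM2l.
have e6 : rho `^ (- (3 - eps)) <= (enorm p / 4) `^ (- (3 - eps)).
  by apply: powR_anti => //; rewrite divr_gt0.
apply: (le_trans e6).
rewrite powRM ?(ltW ep0) ?invr_ge0 // mulrC ler_wpM2r ?powR_ge0 //.
rewrite -powR_inv1 // -powRrM mulN1r opprK.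
have -> : (64 : R) = 4 `^ 3%:R by rewrite powR_mulrn // -natrX.
by rewrite ler_powR ?ler1n.
Qed.

End Cells.

(** * The quadrature rule *)

Section Quadrature.
Context {R : realType}.
Variables (L alpha eps : R) (N : nat).
Hypotheses (L0 : 0 < L) (N0 : (0 < N)%N).
Hypotheses (a0 : 0 < alpha) (a2 : alpha < 2) (e0 : 0 < eps) (ae2 : alpha + eps <= 2).
Local Notation R1 := (measurableTypeR R).
Local Notation R3 := (R1 * R1 * R1)%type.
Local Notation h := (hstep L N).
Local Notation cell := (Defs.cell L N).
Local Notation node := (Defs.xi L N).
Local Notation w := (weight alpha).
Implicit Types (f g : pt R -> R) (p : pt R).

Definition cube : set (pt R) :=
  [set p | 0 <= p.1.1 <= L /\ 0 <= p.1.2 <= L /\ 0 <= p.2 <= L].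

Definition dom p : R := enorm p `^ (- (3 - eps)).

Lemma measurable_cube : measurable (cube : set R3).
Proof.
have -> : cube = [set p : pt R | (`[0, L]%classic : set R) p.1.1 /\
    (`[0, L]%classic : set R) p.1.2 /\ (`[0, L]%classic : set R) p.2].
  by apply/seteqP; split => p; rewrite /cube /= !in_itv.
by apply: measurable_box3; exact: measurable_itv.
Qed.

Lemma measurable_cell i j k : measurable (cell i j k : set R3).
Proof.
have -> : cell i j k = [set p : pt R | (`[i%:R * h, i.+1%:R * h]%classic : set R) p.1.1 /\
    (`[j%:R * h, j.+1%:R * h]%classic : set R) p.1.2 /\
    (`[k%:R * h, k.+1%:R * h]%classic : set R) p.2].
  by apply/seteqP; split => p; rewrite /Defs.cell /= !in_itv.
by apply: measurable_box3; exact: measurable_itv.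
Qed.

Lemma cell_cube i j k p : (i < N)%N -> (j < N)%N -> (k < N)%N -> cell i j k p -> cube p.
Proof.
move=> iN jN kN [hx [hy hz]]; have h0 := ltW (hstep_gt0 L0 N0).
have H (n : nat) (t : R) : (n < N)%N -> n%:R * h <= t <= n.+1%:R * h -> 0 <= t <= L.
  move=> nN /andP[t1 t2]; apply/andP; split.
    by apply: le_trans t1; rewrite mulr_ge0.
  by apply: (le_trans t2); rewrite -[leRHS](hstepN L N0) ler_wpM2r // ler_nat.
by split; [exact: H hx|split; [exact: H hy|exact: H hz]].
Qed.

Lemma enorm0 : enorm (0 : pt R) = 0.
Proof. by rewrite /enorm /= expr0n /= !addr0 sqrtr0. Qed.

Lemma enorm_eq0 p : enorm p = 0 -> p = 0.
Proof.
move=> p0; have [] := co_le_enorm p; rewrite p0 !normr_le0 => /eqP a /eqP b /eqP c.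
by case: p a b c {p0} => [[x y] z] /= -> -> ->.
Qed.

Lemma enorm_gt0 p : p != 0 -> 0 < enorm p.
Proof.
move=> pn; rewrite lt0r enorm_ge0 andbT; apply: contraNN pn => /eqP/enorm_eq0 ->.
by [].
Qed.

(** [powR] sends 0 to 0 for every nonzero exponent. All singular integrands therefore vanish at the
    origin, and the pointwise bounds hold there too. *)
Lemma weight0 : w 0 = 0.
Proof. by rewrite /weight enorm0 powR0 // oppr_eq0 gt_eqF // addr_gt0. Qed.

Lemma weight_ge0 p : 0 <= w p. Proof. exact: powR_ge0. Qed.
Lemma dom_ge0 p : 0 <= dom p. Proof. exact: powR_ge0. Qed.

(** The quotient of the two functions is |p|^(2 - (alpha+eps)), whose exponent is nonnegative. B = 2
    L yields integrability on the cube; B = 2 h yields the powers of h missing on the cell at the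
    origin. *)
Lemma weight_dom p (B : R) : enorm p <= B -> w p <= B `^ (2 - (alpha + eps)) * dom p.
Proof.
have [->|pn] := eqVneq p 0; first by rewrite weight0 mulr_ge0 ?powR_ge0.
have p0 := enorm_gt0 pn => pB.
have -> : w p = enorm p `^ (2 - (alpha + eps)) * dom p.
  rewrite /weight /dom -powRD; last by apply/implyP => _; rewrite gt_eqF.
  by congr (_ `^ _); ring.
apply: ler_wpM2r; first exact: dom_ge0.
by apply: ge0_ler_powR; rewrite ?nnegrE ?enorm_ge0 ?(le_trans (enorm_ge0 p) pB) // subr_ge0.
Qed.

Lemma itg_cube_dom : itg (fun p => \1_cube p * dom p).
Proof.
have q : 0 < 3 - eps < 3 by apply/andP; split; move: a0 e0 ae2 => *; lra.
have c1 : countable [set (0 : R)] by exact: countable1.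
apply: itg_ae c1 _ (itg_head q L0) _.
  by apply: measM; [apply: meas_indic; exact: measurable_cube|exact: meas_enorm_powR].
move=> p [p1 [p2 p3]]; congr (_ * _).
have E (t : R) : ~ [set 0] t -> (0 < t <= L) = (0 <= t <= L).
  by move=> /eqP t0; rewrite lt0r t0.
rewrite !indicE; congr (_%:R); congr nat_of_bool; apply/idP/idP; rewrite !inE /cube /=.
  by move=> [h1 [h2 h3]]; split; rewrite E.
by move=> [h1 h2 h3]; rewrite -!E.
Qed.

Lemma itg_cube f (C : R) : meas f -> (forall p, cube p -> `|f p| <= C * dom p) ->
  itg (fun p => \1_cube p * f p).
Proof.
move=> mf fC; apply: itg_le (itgZ C itg_cube_dom) _.
  by apply: measM => //; apply: meas_indic; exact: measurable_cube.
move=> p; have [cp|cp] := pselect (cube p).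
  by rewrite !indic_in // !mul1r; exact: fC.
by rewrite !(indic_out _ cp) !mul0r mulr0 normr0.
Qed.

Lemma itg_cell f i j k : (i < N)%N -> (j < N)%N -> (k < N)%N -> meas f ->
  itg (fun p => \1_cube p * f p) -> itg (fun p => \1_(cell i j k) p * f p).
Proof.
move=> iN jN kN mf fi; apply: itg_le (itg_norm fi) _.
  by apply: measM => //; apply: meas_indic; exact: measurable_cell.
move=> p; have [cp|cp] := pselect (cell i j k p).
  by rewrite !indic_in //; exact: cell_cube cp.
by rewrite (indic_out _ cp) mul0r normr0.
Qed.

(** Closed neighbouring cells share faces. These lie in the planes with a coordinate in [grid], off
    which the indicators of the cells add up to that of the cube. *)
Definition grid : set R := range (fun n : nat => n%:R * h).

Lemma countable_grid : countable grid.
Proof.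
apply: (@sub_countable _ _ _ [set: nat]); [exact: card_image_le | exact: countableP].
Qed.

Definition ind (b : bool) : R := b%:R.

Lemma indM b c : ind b * ind c = ind (b && c).
Proof. by case: b; case: c; rewrite /ind ?mulr1 ?mulr0 ?mul0r. Qed.

Lemma sum_seg (n : nat) (t : R) : ~ grid t ->
  \sum_(i < n) ind (i%:R * h <= t <= i.+1%:R * h) = ind (0 <= t <= n%:R * h).
Proof.
move=> gt; have h0 := hstep_gt0 L0 N0.
elim: n => [|n IH].
  rewrite big_ord0 mul0r /ind; case: (ltgtP t 0) => // t0; exfalso; apply: gt.
  by exists 0%N; rewrite // mul0r.
rewrite big_ord_recr /= IH.
have s : n.+1%:R * h = n%:R * h + h by rewrite -natr1 mulrDl mul1r.
have n0 : 0 <= n%:R * h by rewrite mulr_ge0 // ltW.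
rewrite s; case: (ltgtP (n%:R * h) t) => tn; last by exfalso; apply: gt; exists n.
  have -> : 0 <= t by exact: le_trans (ltW tn).
  by rewrite /ind /= add0r.
have -> : t <= n%:R * h + h by lra.
by rewrite !andbT /ind addr0.
Qed.

Lemma cell_indic i j k p : \1_(cell i j k) p = ind (i%:R * h <= p.1.1 <= i.+1%:R * h) *
  ind (j%:R * h <= p.1.2 <= j.+1%:R * h) * ind (k%:R * h <= p.2 <= k.+1%:R * h).
Proof.
have [[c1 [c2 c3]]|cp] := pselect (cell i j k p).
  by rewrite indic_in // c1 c2 c3 !mul1r.
rewrite (indic_out _ cp) !indM /ind; case: andP => // -[/andP[c1 c2] c3].
by exfalso; apply: cp.
Qed.

Lemma cube_indic p : \1_cube p = ind (0 <= p.1.1 <= L) * ind (0 <= p.1.2 <= L) * ind (0 <= p.2 <= L).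
Proof.
have [[c1 [c2 c3]]|cp] := pselect (cube p).
  by rewrite indic_in // c1 c2 c3 !mul1r.
rewrite (indic_out _ cp) !indM /ind; case: andP => // -[/andP[c1 c2] c3].
by exfalso; apply: cp.
Qed.

Lemma cube_cells p : off grid p ->
  \1_cube p = \sum_(i < N) \sum_(j < N) \sum_(k < N) \1_(cell i j k) p :> R.
Proof.
move=> [g1 [g2 g3]]; rewrite cube_indic -{1 2 3}(hstepN L N0) -!sum_seg // !mulr_suml.
apply: eq_bigr => i _; rewrite -mulrA mulr_suml mulr_sumr; apply: eq_bigr => j _.
by rewrite !mulr_sumr; apply: eq_bigr => k _; rewrite mulrA; exact/esym/cell_indic.
Qed.

Lemma I3_cube f : meas f -> itg (fun p => \1_cube p * f p) ->
  I3 (fun p => \1_cube p * f p) =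
  \sum_(i < N) \sum_(j < N) \sum_(k < N) I3 (fun p => \1_(cell i j k) p * f p).
Proof.
move=> mf fi; have ci (i j k : 'I_N) : itg (fun p => \1_(cell i j k) p * f p).
  exact: itg_cell.
have s1 (i j : 'I_N) : itg (fun p => \sum_(k < N) \1_(cell i j k) p * f p).
  by apply: itg_sum.
have s2 (i : 'I_N) : itg (fun p => \sum_(j < N) \sum_(k < N) \1_(cell i j k) p * f p).
  by apply: itg_sum.
have s3 : itg (fun p => \sum_(i < N) \sum_(j < N) \sum_(k < N) \1_(cell i j k) p * f p).
  by apply: itg_sum.
rewrite (@I3_ae R _ _ (fun p => \sum_(i < N) \sum_(j < N) \sum_(k < N) \1_(cell i j k) p * f p)
  countable_grid).
- rewrite I3_sum //; apply: eq_bigr => i _; rewrite I3_sum //; apply: eq_bigr => j _.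
  by rewrite I3_sum.
- exact: itg_meas.
- exact: itg_meas.
- move=> p gp; rewrite cube_cells // mulr_suml; apply: eq_bigr => i _.
  by rewrite mulr_suml; apply: eq_bigr => j _; rewrite mulr_suml.
Qed.

Definition wcell i j k : R := I3 (fun p => \1_(cell i j k) p * w p).

(** The substitute for the corner average on the cell at the origin, where [psi_2] has in general no
    limit. It is still a mean: the three axis nodes have weight 8/3 and the others 0. *)
Definition avg0 f : R := 8^-1 * \sum_(m < 2) \sum_(n < 2) \sum_(s < 2 | (m + n + s != 0)%N)
  ccoef (2 : R) m n s * f (node m n s).

Definition coef f (i j k : nat) : R := if (i + j + k == 0)%N then avg0 f else avg L N f i j k.

Definition quad f : R := \sum_(i < N) \sum_(j < N) \sum_(k < N) coef f i j k * wcell i j k.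

Definition qerr f : R := I3 (fun p => \1_cube p * (f p * w p)) - quad f.

Lemma meas_weight : meas w. Proof. exact: meas_enorm_powR. Qed.

Lemma enorm_cube p : cube p -> enorm p <= 2 * L.
Proof.
move=> [/andP[x0 xL] [/andP[y0 yL] /andP[z0 zL]]].
apply: (le_trans (enorm_le_normr p)); rewrite ler_wpM2l // pnorm_le.
by rewrite !ger0_norm // xL yL zL.
Qed.

Definition bweight : R := (2 * L) `^ (2 - (alpha + eps)).

Lemma itg_cube_bounded f (C : R) : meas f -> 0 <= C -> (forall p, cube p -> `|f p| <= C) ->
  itg (fun p => \1_cube p * (f p * w p)).
Proof.
move=> mf C0 fC; apply: (@itg_cube _ (C * bweight)).
  by apply: measM => //; exact: meas_weight.
move=> p cp; rewrite normrM -mulrA; apply: ler_pM => //; first exact: fC.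
by rewrite ger0_norm ?weight_ge0 //; apply: weight_dom; exact: enorm_cube.
Qed.

Lemma itg_cube_weight : itg (fun p => \1_cube p * w p).
Proof.
have := @itg_cube_bounded (fun=> 1) 1 (meas_cst 1) ler01.
have -> : (fun p => \1_cube p * (1 * w p)) = (fun p => \1_cube p * w p).
  by apply/funext => p; rewrite mul1r.
by apply => p _; rewrite normr1.
Qed.

Lemma avg0D f g : avg0 (fun p => f p + g p) = avg0 f + avg0 g.
Proof.
rewrite /avg0 -mulrDr -big_split; congr (_ * _); apply: eq_bigr => m _.
rewrite -big_split; apply: eq_bigr => n _; rewrite -big_split; apply: eq_bigr => s _.
by rewrite mulrDr.
Qed.

Lemma avgD f g i j k : avg L N (fun p => f p + g p) i j k = avg L N f i j k + avg L N g i j k.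
Proof.
rewrite /avg -mulrDr -big_split; congr (_ * _); apply: eq_bigr => m _.
by rewrite -big_split; apply: eq_bigr => n _; rewrite -big_split.
Qed.

Lemma avg0Z a f : avg0 (fun p => a * f p) = a * avg0 f.
Proof.
rewrite /avg0 [RHS]mulrCA; congr (_ * _); rewrite mulr_sumr; apply: eq_bigr => m _.
rewrite mulr_sumr; apply: eq_bigr => n _; rewrite mulr_sumr; apply: eq_bigr => s _.
by rewrite mulrCA.
Qed.

Lemma avgZ a f i j k : avg L N (fun p => a * f p) i j k = a * avg L N f i j k.
Proof.
rewrite /avg [RHS]mulrCA; congr (_ * _); rewrite mulr_sumr; apply: eq_bigr => m _.
by rewrite mulr_sumr; apply: eq_bigr => n _; rewrite mulr_sumr.
Qed.

Lemma qerrD f g : itg (fun p => \1_cube p * (f p * w p)) -> itg (fun p => \1_cube p * (g p * w p)) ->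
  qerr (fun p => f p + g p) = qerr f + qerr g.
Proof.
move=> hf hg; rewrite /qerr.
have -> : quad (fun p => f p + g p) = quad f + quad g.
  rewrite /quad -big_split; apply: eq_bigr => i _; rewrite -big_split; apply: eq_bigr => j _.
  rewrite -big_split; apply: eq_bigr => k _ /=; rewrite -mulrDl /coef.
  by case: ifP => _; rewrite ?avg0D ?avgD.
have -> : I3 (fun p => \1_cube p * ((f p + g p) * w p)) =
    I3 (fun p => \1_cube p * (f p * w p)) + I3 (fun p => \1_cube p * (g p * w p)).
  by rewrite -I3D //; congr I3; apply/funext => p; ring.
by ring.
Qed.

Lemma qerrZ a f : itg (fun p => \1_cube p * (f p * w p)) ->
  qerr (fun p => a * f p) = a * qerr f.
Proof.
move=> hf; rewrite /qerr.
have -> : quad (fun p => a * f p) = a * quad f.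
  rewrite /quad mulr_sumr; apply: eq_bigr => i _; rewrite mulr_sumr; apply: eq_bigr => j _.
  rewrite mulr_sumr; apply: eq_bigr => k _ /=; rewrite mulrA /coef.
  by case: ifP => _; rewrite ?avg0Z ?avgZ.
have -> : I3 (fun p => \1_cube p * (a * f p * w p)) = a * I3 (fun p => \1_cube p * (f p * w p)).
  by rewrite -I3Z //; congr I3; apply/funext => p; ring.
by ring.
Qed.

End Quadrature.

(** * Error of the quadrature rule *)

Section QuadratureError.
Context {R : realType}.
Variables (L alpha eps : R) (N : nat).
Hypotheses (L0 : 0 < L) (N0 : (0 < N)%N).
Hypotheses (a0 : 0 < alpha) (a2 : alpha < 2) (e0 : 0 < eps) (ae2 : alpha + eps <= 2).
Local Notation R1 := (measurableTypeR R).
Local Notation R3 := (R1 * R1 * R1)%type.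
Local Notation h := (hstep L N).
Local Notation cell := (Defs.cell L N).
Local Notation node := (Defs.xi L N).
Local Notation w := (weight alpha).
Local Notation Cube := (cube L).
Local Notation Dom := (dom eps).
Local Notation Err := (qerr L alpha N).
Local Notation Quad := (quad L alpha N).
Local Notation Coef := (coef L N).
Local Notation Wcell := (wcell L alpha N).
Implicit Types (f g T : pt R -> R) (p : pt R).

Definition swap12 p : pt R := (p.1.2, p.1.1, p.2).

Lemma indic_eq (T : Type) (A B : set T) (x y : T) : (A x <-> B y) -> \1_A x = \1_B y :> R.
Proof.
move=> AB; have [Ax|Ax] := pselect (A x).
  by rewrite !indic_in //; apply/AB.
by rewrite (indic_out _ Ax) indic_out // => /AB.
Qed.

Lemma enorm_swap12 p : enorm (swap12 p) = enorm p.
Proof. by rewrite /enorm /swap12 /=; congr (Num.sqrt _); ring. Qed.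

Lemma enorm_swap23 p : enorm (swap23 p : pt R) = enorm p.
Proof. by rewrite /enorm /swap23 /=; congr (Num.sqrt _); ring. Qed.

(** The measure, the cube and the weight are symmetric in the coordinates. In the rule the swap
    permutes the cells and their corners, and [ccoef] depends on m + n + s alone. *)
Lemma qerr_swap12 f : itg (fun p => \1_Cube p * (f p * w p)) ->
  Err (f \o swap12) = Err f.
Proof.
move=> fi; rewrite /qerr; congr (_ - _).
  rewrite -[RHS](mpres_I3 mpres_swap12 fi); congr I3; apply/funext => p /=.
  rewrite /w -(enorm_swap12 p); congr (_ * _).
  by apply: indic_eq; rewrite /cube /=; split => -[b1 [b2 b3]].
rewrite /quad exchange_big; apply: eq_bigr => j _; apply: eq_bigr => i _.
apply: eq_bigr => k _; congr (_ * _).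
  rewrite /coef (addnC i j); case: ifP => _.
    rewrite /avg0; congr (_ * _); rewrite exchange_big; apply: eq_bigr => n _.
    by apply: eq_bigr => m _; apply: eq_big => s; rewrite ?(addnC m n) // /ccoef (addnC m n).
  by rewrite /avg; congr (_ * _); rewrite exchange_big.
rewrite /wcell -[RHS](mpres_I3 mpres_swap12).
  congr I3; apply/funext => p /=; rewrite /weight -(enorm_swap12 p); congr (_ * _).
  by apply: indic_eq; rewrite /Defs.cell /=; split => -[b1 [b2 b3]].
by apply: itg_cell => //; [exact: meas_weight|exact: (itg_cube_weight L0 a0 e0 ae2)].
Qed.

Lemma qerr_swap23 f : itg (fun p => \1_Cube p * (f p * w p)) ->
  Err (f \o @swap23 R) = Err f.
Proof.
move=> fi; rewrite /qerr; congr (_ - _).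
  rewrite -[RHS](mpres_I3 mpres_swap23 fi); congr I3; apply/funext => p /=.
  rewrite /w -(enorm_swap23 p); congr (_ * _).
  by apply: indic_eq; rewrite /cube /=; split => -[b1 [b2 b3]].
rewrite /quad; apply: eq_bigr => i _; rewrite exchange_big; apply: eq_bigr => k _.
apply: eq_bigr => j _; congr (_ * _).
  rewrite /coef (addnAC i j k); case: ifP => _.
    rewrite /avg0; congr (_ * _); apply: eq_bigr => m _.
    under eq_bigr do rewrite big_mkcond /=.
    under [RHS]eq_bigr do rewrite big_mkcond /=.
    rewrite exchange_big; apply: eq_bigr => s _; apply: eq_bigr => n _.
    by rewrite /ccoef (addnAC m n s).
  by rewrite /avg; congr (_ * _); apply: eq_bigr => m _; rewrite exchange_big.
rewrite /wcell -[RHS](mpres_I3 mpres_swap23).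
  congr I3; apply/funext => p /=; rewrite /weight -(enorm_swap23 p); congr (_ * _).
  by apply: indic_eq; rewrite /Defs.cell /=; split => -[b1 [b2 b3]].
by apply: itg_cell => //; [exact: meas_weight|exact: (itg_cube_weight L0 a0 e0 ae2)].
Qed.

Definition qq (i : 'I_3) p : R := enorm p `^ (- 2) * co i p ^+ 2.

Lemma enorm_m2 p : p != 0 -> enorm p `^ (- 2) * enorm p ^+ 2 = 1.
Proof.
move=> /enorm_gt0 p0; rewrite enorm_powR_sqr mulVf // expf_eq0 /= gt_eqF //.
Qed.

Lemma meas_co (i : 'I_3) : meas (co i : pt R -> R).
Proof.
by case: i => [[|[|[|//]]] ?]; [exact: meas_co1|exact: meas_co2|exact: meas_co3].
Qed.

Lemma qq_le1 i p : `|qq i p| <= 1.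
Proof.
have [->|pn] := eqVneq p 0.
  by rewrite /qq enorm0 powR0 ?mul0r ?normr0 // oppr_eq0.
rewrite ger0_norm; last by rewrite mulr_ge0 ?powR_ge0 // sqr_ge0.
rewrite -(enorm_m2 pn) ler_wpM2l ?powR_ge0 // enorm_sqr /co.
have := sqr_ge0 p.1.1; have := sqr_ge0 p.1.2; have := sqr_ge0 p.2.
by case: ifP => _; [|case: ifP => _]; move=> *; lra.
Qed.

Lemma itg_qq i : itg (fun p => \1_Cube p * (qq i p * w p)).
Proof.
apply: (itg_cube_bounded L0 a0 e0 ae2 (C := 1)) => //; last by move=> p _; exact: qq_le1.
apply: measM; first exact: meas_enorm_powR.
by apply: (@measM R (co i) (co i)); exact: meas_co.
Qed.

Lemma node_neq0 i j k : (i + j + k != 0)%N -> node i j k != 0.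
Proof.
have h0 := hstep_gt0 L0 N0; have E (n : nat) : n%:R * h = 0 -> n = 0%N.
  by move/eqP; rewrite mulf_eq0 pnatr_eq0 (gt_eqF h0) orbF => /eqP.
by apply: contraNneq => -[/E -> /E -> /E ->].
Qed.

(** The sum of the three functions [qq]: it is 1 off the origin and 0 at it. The rule never
    evaluates at the origin and the weight vanishes there, so it acts as the constant 1. *)
Definition unitf p : R := enorm p `^ (- 2) * enorm p ^+ 2.

Lemma qerr_unit : Err unitf = 0.
Proof.
rewrite /qerr.
have -> : I3 (fun p => \1_Cube p * (unitf p * w p)) = I3 (fun p => \1_Cube p * w p).
  congr I3; apply/funext => p; congr (_ * _); have [->|pn] := eqVneq p 0.
    by rewrite weight0 // mulr0.
  by rewrite /unitf enorm_m2 // mul1r.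
rewrite (I3_cube L0 N0 (meas_weight alpha) (itg_cube_weight L0 a0 e0 ae2)).
apply/eqP; rewrite subr_eq0; apply/eqP; apply: eq_bigr => i _; apply: eq_bigr => j _.
apply: eq_bigr => k _; rewrite -/(Wcell i j k) -[LHS]mul1r; congr (_ * _).
rewrite /coef; case: ifPn => ijk; last first.
  rewrite /avg (eq_bigr (fun=> 4)); first by rewrite sumr_const card_ord; field.
  move=> m _; rewrite (eq_bigr (fun=> 2)); first by rewrite sumr_const card_ord; ring.
  move=> n _; rewrite (eq_bigr (fun=> 1)); first by rewrite sumr_const card_ord; ring.
  move=> s _; rewrite /unitf enorm_m2 //; apply: node_neq0.
  by apply: contraNN ijk; rewrite !addn_eq0 => /andP[/andP[/andP[-> _] /andP[-> _]] /andP[-> _]].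
rewrite /avg0.
have E (m n s : 'I_2) : (m + n + s != 0)%N -> unitf (node m n s) = 1.
  by move=> mns; rewrite /unitf enorm_m2 //; exact: node_neq0.
rewrite (eq_bigr (fun m : 'I_2 => \sum_(n < 2) \sum_(s < 2 | (m + n + s != 0)%N)
  ccoef (2 : R) m n s)); last first.
  move=> m _; apply: eq_bigr => n _; apply: eq_bigr => s mns.
  by rewrite E // mulr1.
(* The three coefficients 8/3 add up to 8, cancelling the prefactor. *)
rewrite !big_ord_recr !big_ord0 /= !big_mkcond /= !big_ord_recr !big_ord0 /= /ccoef eqxx /=.
by field.
Qed.

Lemma qerr_qq i : Err (qq i) = 0.
Proof.
pose i0 : 'I_3 := ord0; pose i1 : 'I_3 := @Ordinal 3 1 isT; pose i2 : 'I_3 := @Ordinal 3 2 isT.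
have e1 : Err (qq i1) = Err (qq i0).
  rewrite -(qerr_swap12 (itg_qq i0)); congr (Err _); apply/funext => p /=.
  by rewrite /qq enorm_swap12.
have e2 : Err (qq i2) = Err (qq i1).
  rewrite -(qerr_swap23 (itg_qq i1)); congr (Err _); apply/funext => p /=.
  by rewrite /qq enorm_swap23.
have s : Err (qq i0) + Err (qq i1) + Err (qq i2) = 0.
  have i01 : itg (fun p => \1_Cube p * ((qq i0 p + qq i1 p) * w p)).
    have := itgD (itg_qq i0) (itg_qq i1); congr itg; apply/funext => p; ring.
  rewrite -(qerrD N (itg_qq i0) (itg_qq i1)) -(qerrD N i01 (itg_qq i2)) -qerr_unit.
  by congr (Err _); apply/funext => p; rewrite /qq /unitf enorm_sqr /co /=; ring.
have z : Err (qq i0) = 0 by rewrite e2 e1 in s; lra.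
case: i => [[|[|[|//]]] lt].
- by rewrite (_ : Ordinal lt = i0) //; apply: val_inj.
- by rewrite (_ : Ordinal lt = i1) ?e1 //; apply: val_inj.
- by rewrite (_ : Ordinal lt = i2) ?e2 ?e1 //; apply: val_inj.
Qed.

Lemma le_half (x c : R) : 0 <= x -> 2 * x <= c -> x <= c.
Proof. lra. Qed.

Lemma cst_le1 (x : R) : 0 <= x -> x + 8 / 3 * x <= 4 * x.
Proof. lra. Qed.

Lemma cst_le2 (x : R) : 0 <= x -> 16 * x <= 64 * (100 * 110) * x.
Proof. lra. Qed.

Lemma I3_reflect f (c : pt R) : itg f ->
  itg (fun p => f p + f (c - p)) /\ 2 * I3 f = I3 (fun p => f p + f (c - p)).
Proof.
move=> fi; have tau := mpres_reflect c.
have fi' : itg (fun p => f (c - p)) := mpres_itg tau fi.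
split; first exact: (itgD fi fi').
have e : I3 (fun p => f (c - p)) = I3 f := mpres_I3 tau fi.
by rewrite (I3D fi fi') e mulr_natl mulr2n.
Qed.

Section Remainder.
Variables (T : pt R -> R) (K : R).
Hypotheses (K0 : 0 <= K) (mT : meas T).
Hypothesis HT : forall r, 0 < r ->
  (forall p, `|p| <= r -> `|T p| <= K * r `^ (alpha + eps) * r ^+ 2) /\
  (forall p q, `|p| <= r -> `|q| <= r ->
     `|T p - T q| <= K * r `^ (alpha + eps) * r * `|p - q|) /\
  (forall c v, `|c + v| <= r -> `|c - v| <= r ->
    `|T (c + v) + T (c - v) - 2 * T c| <= K * r `^ (alpha + eps) * `|v| ^+ 2).

Lemma meas_ratio : meas (nratio T).
Proof. by apply: measM => //; exact: meas_enorm_powR. Qed.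

Lemma ratio_le p (B : R) : enorm p <= B -> `|nratio T p| <= K * B `^ (alpha + eps).
Proof.
move=> pB; have [->|pn] := eqVneq p 0.
  by rewrite /nratio enorm0 powR0 ?oppr_eq0 // mul0r normr0 mulr_ge0 // powR_ge0.
(* The radius is the norm of the point itself, which gives [nratio T] the order |p|^(alpha+eps). *)
have p0 := enorm_gt0 pn; have [t0 _] := HT p0.
have := t0 p (normr_le_enorm p) => tp.
rewrite /nratio normrM ger0_norm ?powR_ge0 //.
apply: (@le_trans _ _ (enorm p `^ (- 2) * (K * enorm p `^ (alpha + eps) * enorm p ^+ 2))).
  by rewrite ler_wpM2l ?powR_ge0.
have -> : enorm p `^ (- 2) * (K * enorm p `^ (alpha + eps) * enorm p ^+ 2) =
  K * enorm p `^ (alpha + eps) * (enorm p `^ (- 2) * enorm p ^+ 2) by ring.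
rewrite enorm_m2 // mulr1 ler_wpM2l //.
apply: ge0_ler_powR; rewrite ?nnegrE ?enorm_ge0 ?(le_trans (enorm_ge0 p) pB) //.
by rewrite addr_ge0 // ltW.
Qed.

Lemma itg_ratio : itg (fun p => \1_Cube p * (nratio T p * w p)).
Proof.
apply: (itg_cube_bounded L0 a0 e0 ae2 meas_ratio (C := K * (2 * L) `^ (alpha + eps))).
  by rewrite mulr_ge0 // powR_ge0.
by move=> p cp; apply: ratio_le; exact: enorm_cube cp.
Qed.

Definition cst_ratio : R := 64 * (100 * 110) * K.

Lemma cell_error (i j k : 'I_N) :
  `|I3 (fun p => \1_(cell i j k) p * (nratio T p * w p)) - Coef (nratio T) i j k * Wcell i j k|
   <= cst_ratio * h ^+ 2 * I3 (fun p => \1_(cell i j k) p * Dom p).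
Proof.
have h0 := hstep_gt0 L0 N0.
set a := Coef (nratio T) i j k.
have iw : itg (fun p => \1_(cell i j k) p * w p).
  by apply: itg_cell => //; [exact: meas_weight|exact: (itg_cube_weight L0 a0 e0 ae2)].
have ir : itg (fun p => \1_(cell i j k) p * (nratio T p * w p)).
  apply: itg_cell => //; last exact: itg_ratio.
  by apply: measM; [exact: meas_ratio|exact: meas_weight].
have id : itg (fun p => \1_(cell i j k) p * Dom p).
  by apply: itg_cell => //; [exact: meas_enorm_powR|exact: (itg_cube_dom L0 a0 e0 ae2)].
pose F p := \1_(cell i j k) p * ((nratio T p - a) * w p).
have FE : F = fun p => \1_(cell i j k) p * (nratio T p * w p) - a * (\1_(cell i j k) p * w p).
  by apply/funext => p; rewrite /F; ring.
have iF : itg F by rewrite FE; apply: itgB => //; exact: itgZ.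
have -> : I3 (fun p => \1_(cell i j k) p * (nratio T p * w p)) - a * Wcell i j k = I3 F.
  by rewrite FE I3B ?I3Z //; exact: itgZ.
have iC : itg (fun p => cst_ratio * h ^+ 2 * (\1_(cell i j k) p * Dom p)) by exact: itgZ.
rewrite -I3Z //.
have C0 : 0 <= cst_ratio * h ^+ 2.
  by apply: mulr_ge0; [rewrite /cst_ratio !mulr_ge0|exact: sqr_ge0].
(* The cell at the origin is settled by size alone: [nratio T] is at most K (2 h)^(alpha+eps), its
   weighted average at most 8/3 times that, and [weight_dom] with B = 2 h completes the power to (2
   h)^2. *)
have [ijk|ijk] := boolP (i + j + k == 0)%N.
  apply: I3_abs => // p; have [cp|cp] := pselect (cell i j k p); last first.
    by rewrite /F (indic_out _ cp) !mul0r mulr0 normr0.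
  rewrite /F indic_in // !mul1r normrM.
  move: (ijk); rewrite !addn_eq0 => /andP[/andP[/eqP i0 /eqP j0] /eqP k0].
  have small (x y z : R) : 0 <= x <= h -> 0 <= y <= h -> 0 <= z <= h ->
      enorm ((x, y, z) : pt R) <= 2 * h.
    move=> /andP[x0 x1] /andP[y0 y1] /andP[z0 z1].
    apply: (le_trans (enorm_le_normr _)); rewrite ler_wpM2l // pnorm_le /=.
    by rewrite !ger0_norm // x1 y1 z1.
  have bp : enorm p <= 2 * h.
    move: cp; rewrite i0 j0 k0 /Defs.cell /= !mul0r !mul1r => -[b1 [b2 b3]].
    by case: p b1 b2 b3 => [[x y] z] /=; exact: small.
  have bn (m n s : 'I_2) : enorm (node m n s) <= 2 * h.
    have b (q : 'I_2) : 0 <= q%:R * h <= h.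
      by case: q => [[|[|//]] ?] /=; rewrite ?mul0r ?mul1r ?lexx ltW.
    exact: small.
  have ra : `|a| <= 8 / 3 * (K * (2 * h) `^ (alpha + eps)).
    rewrite /a /coef ijk /avg0 normrM ger0_norm ?invr_ge0 //.
    rewrite ler_pdivrMl //; apply: (le_trans (ler_norm_sum _ _ _)).
    set X := 8 / 3 * _; have X0 : 0 <= X by rewrite /X mulr_ge0 // ?divr_ge0 // mulr_ge0 // powR_ge0.
    have -> : 8 * X = \sum_(m < 2) \sum_(n < 2) \sum_(s < 2) X.
      by rewrite !sumr_const !card_ord; ring.
    apply: ler_sum => m _; apply: (le_trans (ler_norm_sum _ _ _)).
    apply: ler_sum => n _; apply: (le_trans (ler_norm_sum _ _ _)).
    rewrite big_mkcond /=; apply: ler_sum => s _; case: ifP => // _.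
    apply: normrM_le; last exact: ratio_le.
    rewrite /ccoef eqxx; case: ifP => _; last by rewrite normr0 divr_ge0.
    by rewrite ger0_norm // divr_ge0.
  have rp := ratio_le bp.
  have wp := weight_dom a0 ae2 bp.
  have rpa : `|nratio T p - a| <= 4 * (K * (2 * h) `^ (alpha + eps)).
    apply: (le_trans (ler_normB _ _)).
    apply: (le_trans (lerD rp ra)); apply: cst_le1.
    by rewrite mulr_ge0 // powR_ge0.
  apply: (@le_trans _ _ (4 * (K * (2 * h) `^ (alpha + eps)) *
     ((2 * h) `^ (2 - (alpha + eps)) * Dom p))).
    apply: ler_pM => //; by rewrite ger0_norm ?weight_ge0.
  have h2 : 2 * h != 0 by rewrite mulf_neq0 // gt_eqF.
  have -> : 4 * (K * (2 * h) `^ (alpha + eps)) * ((2 * h) `^ (2 - (alpha + eps)) * Dom p) =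
    4 * K * ((2 * h) `^ (alpha + eps) * (2 * h) `^ (2 - (alpha + eps))) * Dom p by ring.
  rewrite -powRD; last by apply/implyP => _.
  rewrite [_ + (2 - _)]addrC subrK powR_mulrn; last by rewrite mulr_ge0 // ltW.
  apply: ler_wpM2r; first exact: dom_ge0.
  have -> : 4 * K * (2 * h) ^+ 2 = 16 * (K * h ^+ 2) by ring.
  rewrite /cst_ratio -[leRHS]mulrA; apply: cst_le2.
  by apply: mulr_ge0 => //; exact: sqr_ge0.
(* On every other cell the reflection p -> [c2] - p preserves the cell, and the integrand is
   replaced by its sum over reflected pairs. *)
set c2 := cell_mid L N i j k + cell_mid L N i j k.
have [iFt E2] := I3_reflect c2 iF.
have cE p : \1_(cell i j k) (c2 - p) = \1_(cell i j k) p :> R.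
  have H q : cell i j k q -> cell i j k (c2 - q).
    move=> cq; have qh := cell_center L0 N0 cq.
    have -> : c2 - q = cell_mid L N i j k + (- (q - cell_mid L N i j k)).
      by rewrite /c2 opprB addrA.
    by apply: center_cell => //; rewrite normrN.
  apply: indic_eq; split; last exact: H.
  by move=> /H; rewrite opprB addrC subrK.
have : `|2 * I3 F| <= I3 (fun p => cst_ratio * h ^+ 2 * (\1_(cell i j k) p * Dom p)).
  rewrite E2; apply: (I3_abs iFt iC) => p.
  rewrite /F cE -mulrDr.
  have [cp|cp] := pselect (cell i j k p); last first.
    by rewrite (indic_out _ cp) !mul0r mulr0 normr0.
  rewrite indic_in // !mul1r /a /coef (negbTE ijk).
  exact: (cell_pair_bound L0 N0 K0 a0 e0 ae2 HT ijk cp).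
by rewrite normrM normr_nat; apply: le_half.
Qed.

(** The local bounds add up to the integral of [dom] over the whole cube, which is the same for
    every N. *)
Lemma qerr_ratio :
  `|Err (nratio T)| <= cst_ratio * h ^+ 2 * I3 (fun p => \1_Cube p * Dom p).
Proof.
rewrite /qerr (I3_cube L0 N0 _ itg_ratio); last first.
  by apply: measM; [exact: meas_ratio|exact: meas_weight].
rewrite (I3_cube L0 N0 (meas_enorm_powR _) (itg_cube_dom L0 a0 e0 ae2)) /quad.
rewrite -sumrB mulr_sumr; apply: (le_trans (ler_norm_sum _ _ _)); apply: ler_sum => i _.
rewrite -sumrB mulr_sumr; apply: (le_trans (ler_norm_sum _ _ _)); apply: ler_sum => j _.
rewrite -sumrB mulr_sumr; apply: (le_trans (ler_norm_sum _ _ _)); apply: ler_sum => k _.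
exact: cell_error.
Qed.

End Remainder.

End QuadratureError.

(** * Folding the principal value *)

Section Octant.
Context {R : realType}.
Local Notation R1 := (measurableTypeR R).
Local Notation R3 := (R1 * R1 * R1)%type.
Local Notation mu := (@leb2 R \x @lebesgue_measure R)%E.
Implicit Types (f g u : pt R -> R) (p x : pt R).

Definition oct : set (pt R) := [set p | 0 < p.1.1 /\ 0 < p.1.2 /\ 0 < p.2].

(** The involution exchanges [H] with its complement up to a null set, so the part of the integral
    outside [H] is carried into [H]. *)
Lemma I3_fold (tau : pt R -> pt R) (H : set (pt R)) f : mpres mu (tau : R3 -> R3) ->
  measurable (H : set R3) -> (forall p, tau (tau p) = p) ->
  (forall p, off [set 0] p -> (H (tau p) <-> ~ H p)) -> itg f ->
  itg (fun p => \1_H p * (f p + f (tau p))) /\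
  I3 f = I3 (fun p => \1_H p * (f p + f (tau p))).
Proof.
move=> mt mH tt tH fi.
have mI : meas (\1_H) by exact: meas_indic.
have ift : itg (fun p => f (tau p)) := mpres_itg mt fi.
have iH g : itg g -> itg (fun p => \1_H p * g p).
  move=> gi; apply: itg_le (itg_norm gi) _; first by apply: measM => //; exact: itg_meas.
  move=> p; rewrite normrM ler_piMl // indicE; case: (p \in H); rewrite ?normr1 ?normr0 //.
have i1 := iH _ fi; have i2 := iH _ ift.
have i3 : itg (fun p => \1_H (tau p) * f p).
  have := mpres_itg mt i2; congr itg; apply/funext => p; by rewrite tt.
split.
  by have := itgD i1 i2; congr itg; apply/funext => p; rewrite mulrDr.
have -> : (fun p => \1_H p * (f p + f (tau p))) = (fun p => \1_H p * f p + \1_H p * f (tau p)).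
  by apply/funext => p; rewrite mulrDr.
rewrite (I3D i1 i2).
have e2 : I3 (fun p => \1_H p * f (tau p)) = I3 (fun p => \1_H (tau p) * f p).
  by rewrite -(mpres_I3 mt i2); congr I3; apply/funext => p; rewrite tt.
rewrite e2 -(I3D i1 i3); have c0 : countable [set (0 : R)] by exact: countable1.
apply: (I3_ae c0) => //.
- exact: itg_meas.
- by apply: itg_meas; exact: itgD.
- move=> p /tH hp; have [h|h] := pselect (H p).
    by rewrite indic_in // (indic_out _ (_ : ~ H (tau p))) ?mul1r ?mul0r ?addr0 // => /hp.
  by rewrite (indic_out _ h) indic_in ?mul1r ?mul0r ?add0r //; apply/hp.
Qed.

Definition fl1 p : pt R := (- p.1.1, p.1.2, p.2).
Definition fl2 p : pt R := (p.1.1, - p.1.2, p.2).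
Definition fl3 p : pt R := (p.1.1, p.1.2, - p.2).

Lemma neg_flip (t : R) : t != 0 -> (0 < - t <-> ~ 0 < t).
Proof.
move=> t0; rewrite oppr_gt0; split => [h|/negP]; first by rewrite ltNge (ltW h).
by rewrite -leNgt le_eqVlt (negbTE t0).
Qed.

Lemma I3_octant f : itg f -> I3 f = I3 (fun p => \1_oct p *
  \sum_(s : 'I_2 * 'I_2 * 'I_2) f (pmul (sgs s) p)).
Proof.
move=> fi.
have mpos : measurable (`]0, +oo[%classic : set R1) by exact: measurable_itv.
have mH1 : measurable ([set p : pt R | 0 < p.1.1] : set R3).
  have := measurable_box3 mpos measurableT measurableT; congr measurable.
  by apply/seteqP; split => p /=; rewrite in_itv /= andbT => // -[].
have mH2 : measurable ([set p : pt R | 0 < p.1.2] : set R3).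
  have := measurable_box3 measurableT mpos measurableT; congr measurable.
  by apply/seteqP; split => p /=; rewrite in_itv /= andbT => // -[_ []].
have mH3 : measurable ([set p : pt R | 0 < p.2] : set R3).
  have := measurable_box3 measurableT measurableT mpos; congr measurable.
  by apply/seteqP; split => p /=; rewrite in_itv /= andbT => // -[_ []].
have [|p [/eqP z1 _]|i1 e1] := I3_fold (tau := fl1) mpres_flip1 mH1 _ _ fi.
- by move=> [[a b] c]; rewrite /fl1 /= opprK.
- exact: neg_flip z1.
have [|p [_ [/eqP z1 _]]|i2 e2] := I3_fold (tau := fl2) mpres_flip2 mH2 _ _ i1.
- by move=> [[a b] c]; rewrite /fl2 /= opprK.
- exact: neg_flip z1.
have [|p [_ [_ /eqP z1]]|i3 e3] := I3_fold (tau := fl3) mpres_flip3 mH3 _ _ i2.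
- by move=> [[a b] c]; rewrite /fl3 /= opprK.
- exact: neg_flip z1.
rewrite e1 e2 e3; congr I3; apply/funext => -[[a b] c].
rewrite -(pair_bigA _ (fun m n => f (pmul (sgs (m, n)) (a, b, c)))) /=.
rewrite -(pair_bigA _ (fun m n => \sum_s f (pmul (sgs (m, n, s)) (a, b, c)))) /=.
rewrite !big_ord_recr !big_ord0 /= /fl1 /fl2 /fl3 /sgs /pmul /=.
rewrite !expr0 !expr1 !mul1r !mulN1r !add0r.
have -> : \1_[set p : pt R | 0 < p.1.1] (a, b, - c) = \1_[set p : pt R | 0 < p.1.1] (a, b, c) :> R by exact: indic_eq.
have -> : \1_[set p : pt R | 0 < p.1.1] (a, - b, c) = \1_[set p : pt R | 0 < p.1.1] (a, b, c) :> R by exact: indic_eq.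
have -> : \1_[set p : pt R | 0 < p.1.1] (a, - b, - c) = \1_[set p : pt R | 0 < p.1.1] (a, b, c) :> R by exact: indic_eq.
have -> : \1_[set p : pt R | 0 < p.1.2] (a, b, - c) = \1_[set p : pt R | 0 < p.1.2] (a, b, c) :> R by exact: indic_eq.
have -> : \1_oct (a, b, c) = \1_[set p : pt R | 0 < p.2] (a, b, c) *
  (\1_[set p : pt R | 0 < p.1.2] (a, b, c) * \1_[set p : pt R | 0 < p.1.1] (a, b, c)) :> R.
  have [h1|h1] := pselect (0 < a); last first.
    rewrite (indic_out _ (_ : ~ oct (a, b, c))) ?(indic_out _ (_ : ~ [set p : pt R | 0 < p.1.1] (a, b, c))) ?mulr0 //.
    by move=> [/h1].
  have [h2|h2] := pselect (0 < b); last first.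
    rewrite (indic_out _ (_ : ~ oct (a, b, c))) ?(indic_out _ (_ : ~ [set p : pt R | 0 < p.1.2] (a, b, c))) ?mulr0 ?mul0r ?mulr0 //.
    by move=> [_ [/h2]].
  have [h3|h3] := pselect (0 < c); last first.
    rewrite (indic_out _ (_ : ~ oct (a, b, c))) ?(indic_out _ (_ : ~ [set p : pt R | 0 < p.2] (a, b, c))) ?mul0r //.
    by move=> [_ [_ /h3]].
  by rewrite !indic_in // !mul1r.
ring.
Qed.

Lemma measurable_oct : measurable (oct : set R3).
Proof.
have mpos : measurable (`]0, +oo[%classic : set R1) by exact: measurable_itv.
have := measurable_box3 mpos mpos mpos; congr measurable.
by apply/seteqP; split => p; rewrite /oct /= !in_itv /= !andbT.
Qed.

Lemma enorm_pmul (s : 'I_2 * 'I_2 * 'I_2) p : enorm (pmul (sgs s) p) = enorm p.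
Proof.
rewrite /enorm /pmul /=; congr (Num.sqrt (_ + _ + _));
  by rewrite exprMn -exprM mulnC exprM sqrrN expr1n expr1n mul1r.
Qed.

Definition secdiff u x p : R := symsum (fun=> 1) u x p - 8 * u x.

(** The cut-off and the kernel depend on y - x only through its norm, which sign changes preserve;
    so each truncated integral can be folded separately. Away from 0 it converges absolutely because
    u is bounded. *)
Lemma I3_truncation (alpha e M : R) u x : 0 < alpha -> 0 < e -> 0 <= M ->
  meas u -> (forall p, `|u p| <= M) ->
  Rintegral (@leb3 R) [set y | e < Defs.edist x y]
     (fun y => (u x - u y) / (Defs.edist x y) `^ (3 + alpha)) =
  - I3 (fun p => \1_[set p | e < enorm p] p *
     (\1_oct p * (secdiff u x p * enorm p `^ (- (3 + alpha))))).
Proof.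
move=> a0 e0 M0 mu_ uM.
pose G p := \1_[set p | e < enorm p] p * enorm p `^ (- (3 + alpha)) * (u x - u (p + x)).
have mG : meas G.
  apply: measM.
    by apply: measM; [apply: meas_indic; exact: measurable_enorm_gt|exact: meas_enorm_powR].
  by apply: measB; [exact: meas_cst|exact: (meas_mpres (mpres_shift x) mu_)].
have iG : itg G.
  apply: itg_le mG (itgZ (2 * M) (itg_tail a0 e0)) _ => p.
  rewrite /G normrM mulrC ler_pM //.
    by apply: (le_trans (ler_normB _ _)); have := uM x; have := uM (p + x); lra.
  by rewrite ger0_norm // mulr_ge0 ?powR_ge0 // indicE.
have -> : Rintegral (@leb3 R) [set y | e < Defs.edist x y]
     (fun y => (u x - u y) / (Defs.edist x y) `^ (3 + alpha)) = I3 G.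
  rewrite RI -(mpres_I3 (mpres_shift (- x)) iG); congr I3; apply/funext => y /=.
  have E : Defs.edist x y = enorm (y - x).
    by rewrite edistE /enorm /=; congr (Num.sqrt (_ + _ + _)); rewrite -sqrrN opprB.
  rewrite /G subrK powRN -E -mulrA [(u x - u y) / _]mulrC; congr (_ * _).
  by apply: indic_eq; rewrite /= E.
rewrite (I3_octant iG).
have ig : itg (fun p => \1_oct p * \sum_(s : 'I_2 * 'I_2 * 'I_2) G (pmul (sgs s) p)) ->
  I3 (fun p => \1_oct p * \sum_(s : 'I_2 * 'I_2 * 'I_2) G (pmul (sgs s) p)) =
  I3 (fun p => - 1 * (\1_[set p | e < enorm p] p *
     (\1_oct p * (secdiff u x p * enorm p `^ (- (3 + alpha)))))).
  move=> _; congr I3; apply/funext => p.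
  have -> : \sum_(s : 'I_2 * 'I_2 * 'I_2) G (pmul (sgs s) p) =
    \sum_(s : 'I_2 * 'I_2 * 'I_2) (\1_[set p | e < enorm p] p * enorm p `^ (- (3 + alpha))) *
       (u x - u (x + pmul (sgs s) p)).
    apply: eq_bigr => s _; rewrite /G enorm_pmul [x + _]addrC; congr (_ * _ * _).
    by apply: indic_eq; rewrite /= enorm_pmul.
  rewrite -mulr_sumr sumrB sumr_const card_prod card_prod !card_ord.
  rewrite /secdiff /symsum; under [in RHS]eq_bigr do rewrite mul1r.
  by rewrite -[u x *+ _]mulr_natl; ring.
have iS : itg (fun p => \1_oct p * \sum_(s : 'I_2 * 'I_2 * 'I_2) G (pmul (sgs s) p)).
  have mS : meas (fun p => \1_oct p * \sum_(s : 'I_2 * 'I_2 * 'I_2) G (pmul (sgs s) p)).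
    apply: measM; first by apply: meas_indic; exact: measurable_oct.
    apply: meas_sum => s; apply: measurableT_comp mG _ => //.
    apply: measurable_fun_pair => /=; [apply: measurable_fun_pair|];
      by apply: measurable_funM => //; exact: measurableT_comp.
  apply: itg_le mS (itgZ (16 * M) (itg_tail a0 e0)) _ => p.
  rewrite normrM; apply: (@le_trans _ _ (1 * \sum_(s : 'I_2 * 'I_2 * 'I_2)
     (2 * M * (\1_[set p | e < enorm p] p * enorm p `^ (- (3 + alpha)))))).
    apply: ler_pM => //; first by rewrite indicE; case: (p \in oct); rewrite ?normr1 ?normr0.
    apply: (le_trans (ler_norm_sum _ _ _)); apply: ler_sum => s _.
    rewrite /G normrM mulrC ler_pM //.
      by apply: (le_trans (ler_normB _ _)); have := uM x; have := uM (pmul (sgs s) p + x); lra.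
    rewrite enorm_pmul (@indic_eq R _ _ [set p | e < enorm p] _ p); last by rewrite /= enorm_pmul.
    by rewrite ger0_norm // mulr_ge0 ?powR_ge0 // indicE.
  rewrite mul1r sumr_const card_prod card_prod !card_ord -[leLHS]mulr_natl.
  rewrite le_eqVlt; apply/orP; left; apply/eqP; ring.
rewrite (ig iS) I3Z ?mulN1r //.
have := itgZ (- 1) iS; congr itg; apply/funext => p.
have -> : \sum_(s : 'I_2 * 'I_2 * 'I_2) G (pmul (sgs s) p) =
    \sum_(s : 'I_2 * 'I_2 * 'I_2) (\1_[set p | e < enorm p] p * enorm p `^ (- (3 + alpha))) *
       (u x - u (x + pmul (sgs s) p)).
  apply: eq_bigr => s _; rewrite /G enorm_pmul [x + _]addrC; congr (_ * _ * _).
  by apply: indic_eq; rewrite /= enorm_pmul.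
rewrite -mulr_sumr sumrB sumr_const card_prod card_prod !card_ord.
rewrite /secdiff /symsum; under [in RHS]eq_bigr do rewrite mul1r.
by rewrite -[u x *+ _]mulr_natl; ring.
Qed.

(** Dominated convergence along sequences e_n -> 0+, with the absolute value of the full octant
    integrand as the majorant. *)
Lemma cvg_truncation f : itg (fun p => \1_oct p * f p) ->
  I3 (fun p => \1_[set p | e < enorm p] p * (\1_oct p * f p)) @[e --> 0^'+] -->
  I3 (fun p => \1_oct p * f p).
Proof.
move=> fi; apply/cvg_at_rightP => e [e0 ecv].
have mf := itg_meas fi.
have mfe n : meas (fun p => \1_[set p | e n < enorm p] p * (\1_oct p * f p)).
  by apply: measM => //; apply: meas_indic; exact: measurable_enorm_gt.
have [] := @dominated_convergence _ R3 R mu setT measurableT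
  (fun n (p : R3) => (\1_[set p : pt R | e n < enorm p] p * (\1_oct p * f p))%:E)
  (fun p : R3 => (\1_oct p * f p)%:E) (fun p : R3 => `|(\1_oct p * f p)%:E|%E).
- by move=> n; apply/measurable_EFinP; exact: mfe.
- exact/measurable_EFinP.
- apply: aeW => p _; have [op|op] := pselect (oct p); last first.
    rewrite (indic_out _ op) mul0r; under eq_fun do rewrite mulr0.
    exact: cvg_cst.
  have p0 : 0 < enorm p.
    by apply: enorm_gt0; apply/eqP => pz; move: op; rewrite pz /oct /= ltxx => -[].
  (* For a fixed p in the octant, e_n < |p| eventually, and from then on the truncation has no
     effect at p. *)
  apply: cvg_near_cst; have := ecv; move/cvgrPdist_lt/(_ _ p0); apply: filterS => n.
  rewrite sub0r normrN ger0_norm ?(ltW (e0 n)) // => h.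
  by rewrite (indic_in _ (_ : [set p | e n < enorm p] p)) // mul1r.
- exact: itg_norm fi.
- apply: aeW => p n _; rewrite lee_fin normrM ler_piMl // indicE.
  by case: (_ \in _); rewrite ?normr1 ?normr0.
move=> _ _ cv.
have E : (\int[mu]_(p in [set: R3]) (\1_oct p * f p)%:E = (I3 (fun p => \1_oct p * f p))%:E)%E.
  by rewrite /I3 /Rintegral fineK //; exact: integrable_fin_num.
by rewrite E in cv; exact: (fine_cvg cv).
Qed.

End Octant.

(** * Both operators as integrals over the cube and its exterior *)

Section Assembly.
Context {R : realType}.
Local Notation R1 := (measurableTypeR R).
Local Notation R3 := (R1 * R1 * R1)%type.
Implicit Types (f g u : pt R -> R) (p x : pt R).

(** The principal value disappears here: once the folded integrand is absolutely integrable, the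
    limit of the truncations is an ordinary integral. *)
Lemma fraclap_octant (alpha M : R) u x : 0 < alpha -> 0 <= M -> meas u ->
  (forall p, `|u p| <= M) ->
  itg (fun p => \1_oct p * (secdiff u x p * enorm p `^ (- (3 + alpha)))) ->
  fraclap alpha u x = - (c_const 3 alpha *
    I3 (fun p => \1_oct p * (secdiff u x p * enorm p `^ (- (3 + alpha))))).
Proof.
move=> a0 M0 um uM gi; rewrite /fraclap -mulrN; congr (_ * _).
apply: cvg_lim => //.
apply: (@cvg_trans _ ((fun e : R => - I3 (fun p => \1_[set p | e < enorm p] p *
   (\1_oct p * (secdiff u x p * enorm p `^ (- (3 + alpha)))))) @ 0^'+)).
  apply: near_eq_cvg; near=> e.
  have e0 : 0 < e by near: e; exact: nbhs_right_gt.
  exact/esym/(I3_truncation x a0 e0 M0 um uM).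
by apply: cvgN; exact: cvg_truncation gi.
Unshelve. all: by end_near.
Qed.

Lemma symsum_nested u x p : symsum (fun=> 1) u x p =
  \sum_(m < 2) \sum_(n < 2) \sum_(s < 2)
    u (mkpt (x.1.1 + (-1) ^+ m * p.1.1) (x.1.2 + (-1) ^+ n * p.1.2) (x.2 + (-1) ^+ s * p.2)).
Proof.
rewrite /symsum; under eq_bigr do rewrite mul1r.
rewrite -(pair_bigA _ (fun a b => u (x + pmul (sgs (a, b)) p))) /=.
by rewrite -(pair_bigA _ (fun a b => \sum_c u (x + pmul (sgs (a, b, c)) p))) /=.
Qed.

Lemma psiE u x p : Defs.psi 2 u x p = enorm p `^ (- 2) * secdiff u x p.
Proof. by rewrite /Defs.psi /secdiff symsum_nested. Qed.

Lemma meas_shift_flip u x (s : 'I_2 * 'I_2 * 'I_2) : meas u ->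
  meas (fun p => u (x + pmul (sgs s) p)).
Proof.
move=> um; apply: measurableT_comp um _ => //.
by apply: measurable_fun_pair => /=; [apply: measurable_fun_pair|];
  apply: measurable_funD => //; apply: measurable_funM => //; exact: measurableT_comp.
Qed.

Lemma meas_symsum u x : meas u -> meas (symsum (fun=> 1) u x).
Proof.
move=> um; apply: meas_sum => s; apply: measM; first exact: meas_cst.
exact: meas_shift_flip.
Qed.

Lemma meas_taylor_rem u (d : 'I_3 -> R) x : meas u -> meas (taylor_rem u d x).
Proof.
move=> um; apply: measD; first exact: meas_symsum.
apply: measD; first exact: meas_cst.
apply: measM; first exact: meas_cst.
apply: meas_sum => i; apply: measM; first exact: meas_cst.
by apply: (@measM R (co i) (co i)); exact: meas_co.
Qed.

(** A shift by at least a side length, in either direction, moves that coordinate of x out of its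
    open interval, so all eight shifted values of u vanish. *)
Lemma far_secdiff (ax bx ay by_ az bz L : R) u x p :
  (forall p, ~ Defs.box ax bx ay by_ az bz p -> u p = 0) ->
  Defs.box ax bx ay by_ az bz x ->
  bx - ax <= L -> by_ - ay <= L -> bz - az <= L ->
  [\/ L <= p.1.1, L <= p.1.2 | L <= p.2] -> secdiff u x p = - 8 * u x.
Proof.
move=> u0 [/andP[x1 x2] [/andP[y1 y2] /andP[z1 z2]]] Lx Ly Lz Lp.
rewrite /secdiff /symsum big1; first by ring.
move=> s _; rewrite u0 ?mulr0 //.
have F (a b c t : R) (m : 'I_2) : a < c -> c < b -> b - a <= L -> L <= t ->
    ~~ (a < c + (-1) ^+ m * t < b).
  move=> ac cb ba Lt; apply/negP => /andP[].
  by case: m => [[|[|//]] ?] /=; rewrite ?expr0 ?expr1 ?mul1r ?mulN1r; lra.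
move=> [/= b1 [b2 b3]]; case: Lp => Lp.
- by move: b1; apply/negP; exact: F Lp.
- by move: b2; apply/negP; exact: F Lp.
- by move: b3; apply/negP; exact: F Lp.
Qed.

Lemma sum3_split (N : nat) (X : nat -> nat -> nat -> R) : (0 < N)%N ->
  \sum_(i < N) \sum_(j < N) \sum_(k < N) X i j k =
  X 0%N 0%N 0%N + \sum_(i < N) \sum_(j < N) \sum_(k < N | (i + j + k != 0)%N) X i j k.
Proof.
case: N => // N _.
have -> : X 0%N 0%N 0%N =
    \sum_(i < N.+1) \sum_(j < N.+1) \sum_(k < N.+1 | (i + j + k == 0)%N) X i j k.
  rewrite (bigD1 ord0) //= [X in _ = _ + X]big1 ?addr0; last first.
    move=> i i0; rewrite big1 // => j _; rewrite big_pred0 // => k.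
    by rewrite !addn_eq0; move: i0; rewrite -val_eqE /= => /negbTE ->.
  rewrite (bigD1 ord0) //= [X in _ = _ + X]big1 ?addr0; last first.
    move=> j j0; rewrite big_pred0 // => k.
    by rewrite !addn_eq0; move: j0; rewrite -val_eqE /= => /negbTE ->.
  by rewrite (big_pred1 ord0) // => k; rewrite -val_eqE.
rewrite -big_split; apply: eq_bigr => i _; rewrite -big_split; apply: eq_bigr => j _ /=.
by rewrite (bigID (fun k : 'I_N.+1 => (i + j + k == 0)%N)).
Qed.

Lemma omegaE (alpha : R) p : Defs.omega alpha 2 p = weight alpha p.
Proof. by rewrite /Defs.omega /weight; congr (_ `^ _); ring. Qed.

Lemma wcellE (L alpha : R) (N i j k : nat) :
  Rintegral (@leb3 R) (Defs.cell L N i j k) (Defs.omega alpha 2) = wcell L alpha N i j k.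
Proof. by rewrite RI /wcell; congr I3; apply/funext => p; rewrite omegaE. Qed.

Lemma quadE (L alpha : R) (N : nat) f : (0 < N)%N -> quad L alpha N f =
  8^-1 * (\sum_(m < 2) \sum_(n < 2) \sum_(s < 2 | (m + n + s != 0)%N)
     ccoef (2 : R) m n s * f (Defs.xi L N m n s)) * wcell L alpha N 0 0 0
  + 8^-1 * (\sum_(i < N) \sum_(j < N) \sum_(k < N | (i + j + k != 0)%N)
     (\sum_(m < 2) \sum_(n < 2) \sum_(s < 2) f (Defs.xi L N (i + m) (j + n) (k + s)))
       * wcell L alpha N i j k).
Proof.
move=> N0; rewrite /quad.
rewrite (sum3_split (fun i j k => coef L N f i j k * wcell L alpha N i j k) N0).
congr (_ + _); rewrite mulr_sumr; apply: eq_bigr => i _.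
rewrite mulr_sumr; apply: eq_bigr => j _; rewrite mulr_sumr; apply: eq_bigr => k ijk.
by rewrite /coef (negbTE ijk) /avg mulrA.
Qed.

Lemma disc_fraclapE (alpha L : R) (N : nat) u x : (0 < N)%N ->
  disc_fraclap alpha 2 L N u x = - c_const 3 alpha * (quad L alpha N (Defs.psi 2 u x)
    - 8 * u x * I3 (fun p => \1_(Defs.D2 L) p * enorm p `^ (- (3 + alpha)))).
Proof.
move=> N0; rewrite /disc_fraclap; congr (_ * _); congr (_ - _); last first.
  by rewrite RI.
rewrite quadE // wcellE; congr (_ + _); congr (_ * _).
by apply: eq_bigr => i _; apply: eq_bigr => j _; apply: eq_bigr => k _; rewrite wcellE.
Qed.

(** The splitting |xi|^(-3-alpha) = |xi|^-2 omega_2(xi); at the origin both sides are 0 by the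
    convention for [powR]. *)
Lemma psi_weight (alpha : R) u x p : 0 < alpha ->
  secdiff u x p * enorm p `^ (- (3 + alpha)) = Defs.psi 2 u x p * weight alpha p.
Proof.
move=> a0; rewrite psiE; have [->|pn] := eqVneq p 0.
  rewrite weight0 // mulr0 enorm0 powR0 ?mulr0 //.
  by rewrite oppr_eq0 gt_eqF // addr_gt0.
have p0 := enorm_gt0 pn.
have -> : enorm p `^ (- (3 + alpha)) = enorm p `^ (- 2) * weight alpha p.
  rewrite /weight -powRD; first by congr (_ `^ _); ring.
  by apply/implyP => _; rewrite gt_eqF.
by rewrite mulrCA mulrA.
Qed.

Lemma measurable_D1 (L : R) : measurable (Defs.D1 L : set R3).
Proof.
have mi : measurable (`]0, L[%classic : set R1) by exact: measurable_itv.
by have := measurable_box3 mi mi mi; congr measurable.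
Qed.

Lemma measurable_D2 (L : R) : measurable (Defs.D2 L : set R3).
Proof.
apply: measurableD; last exact: measurable_D1.
have mi : measurable (`[0, +oo[%classic : set R1) by exact: measurable_itv.
have := measurable_box3 mi mi mi; congr measurable.
by apply/seteqP; split => p; rewrite /= !in_itv /= !andbT.
Qed.

Lemma D2_far (L : R) p : off [set 0] p -> Defs.D2 L p ->
  oct p /\ [\/ L <= p.1.1, L <= p.1.2 | L <= p.2].
Proof.
move=> [/eqP n1 [/eqP n2 /eqP n3]] [[p1 [p2 p3]] nD].
have q1 : 0 < p.1.1 by rewrite lt0r n1.
have q2 : 0 < p.1.2 by rewrite lt0r n2.
have q3 : 0 < p.2 by rewrite lt0r n3.
split; first by [].
have [l1|l1] := leP L p.1.1; first by constructor 1.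
have [l2|l2] := leP L p.1.2; first by constructor 2.
have [l3|l3] := leP L p.2; first by constructor 3.
by exfalso; apply: nD; rewrite /Defs.D1 /= q1 l1 q2 l2 q3 l3.
Qed.

Lemma far_enorm (L : R) p : 0 < L -> [\/ L <= p.1.1, L <= p.1.2 | L <= p.2] ->
  L / 2 < enorm p.
Proof.
move=> L0 Lp; have [h1 h2 h3] := co_le_enorm p; have L2 : L / 2 < L by lra.
apply: (lt_le_trans L2).
case: Lp => h; apply: (le_trans h);
  [apply: le_trans h1|apply: le_trans h2|apply: le_trans h3]; exact: ler_norm.
Qed.

Lemma itg_D2 (alpha L : R) : 0 < alpha -> 0 < L ->
  itg (fun p => \1_(Defs.D2 L) p * enorm p `^ (- (3 + alpha))).
Proof.
move=> a0 L0; have c0 : countable [set (0 : R)] by exact: countable1.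
have L2 : 0 < L / 2 by rewrite divr_gt0.
have mD : meas (\1_(Defs.D2 L)) by apply: meas_indic; exact: measurable_D2.
have mt := itg_tail a0 L2.
apply: (itg_ae (g := fun p => \1_(Defs.D2 L) p *
   (\1_[set p | L / 2 < enorm p] p * enorm p `^ (- (3 + alpha)))) c0).
- by apply: measM => //; exact: meas_enorm_powR.
- apply: itg_le (itg_norm mt) _; first by apply: measM => //; exact: itg_meas.
  move=> p; rewrite normrM ler_piMl // indicE.
  by case: (_ \in _); rewrite ?normr1 ?normr0.
- move=> p op; have [Dp|Dp] := pselect (Defs.D2 L p); last first.
    by rewrite (indic_out _ Dp) !mul0r.
  have [_ /(far_enorm L0) f] := D2_far op Dp.
  by rewrite (indic_in _ (_ : [set p | L / 2 < enorm p] p)) // mul1r.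
Qed.

Lemma octant_split (alpha L : R) u x : 0 < alpha -> 0 < L -> meas u ->
  (forall p, [\/ L <= p.1.1, L <= p.1.2 | L <= p.2] -> secdiff u x p = - 8 * u x) ->
  itg (fun p => \1_(cube L) p * (Defs.psi 2 u x p * weight alpha p)) ->
  let g p := \1_oct p * (secdiff u x p * enorm p `^ (- (3 + alpha))) in
  itg g /\ I3 g = I3 (fun p => \1_(cube L) p * (Defs.psi 2 u x p * weight alpha p))
     - 8 * u x * I3 (fun p => \1_(Defs.D2 L) p * enorm p `^ (- (3 + alpha))).
Proof.
move=> a0 L0 um far ic g.
(* Off these planes strict and weak inequalities agree, so the octant is the disjoint union of the
   cube and [D2]. *)
pose F : set R := [set 0; L].
have cF : countable F by apply: finite_set_countable; exact: finite_set2.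
have mg : meas g.
  apply: measM; first by apply: meas_indic; exact: measurable_oct.
  apply: measM; last exact: meas_enorm_powR.
  by apply: measB; [exact: meas_symsum|exact: meas_cst].
have i2 := itgZ (8 * u x) (itg_D2 a0 L0).
have i3 := itgB ic i2.
have E p : off F p -> g p = \1_(cube L) p * (Defs.psi 2 u x p * weight alpha p) -
    8 * u x * (\1_(Defs.D2 L) p * enorm p `^ (- (3 + alpha))).
  move=> [f1 [f2 f3]].
  have off0 : off [set 0] p by split; [|split] => z; [apply: f1|apply: f2|apply: f3]; left.
  have nL (t : R) : ~ F t -> (t < L) = (t <= L).
    by move=> Ft; rewrite le_eqVlt; case: eqP => // tL; exfalso; apply: Ft; right.
  have n0 (t : R) : ~ F t -> (0 < t) = (0 <= t).
    by move=> Ft; rewrite le_eqVlt eq_sym; case: eqP => // tL; exfalso; apply: Ft; left.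
  rewrite /g; have [op|op] := pselect (oct p); last first.
    rewrite (indic_out _ op) mul0r.
    rewrite (indic_out _ (_ : ~ cube L p)); last first.
      by move=> [/andP[q1 _] [/andP[q2 _] /andP[q3 _]]]; apply: op; rewrite /oct /= !n0.
    rewrite (indic_out _ (_ : ~ Defs.D2 L p)); last by move=> /(D2_far off0)[].
    by rewrite !mul0r mulr0 subr0.
  rewrite (indic_in _ op) mul1r.
  have [c1 [c2 c3]] := op.
  have [cp|cp] := pselect (cube L p).
    rewrite indic_in // mul1r (indic_out _ (_ : ~ Defs.D2 L p)).
      by rewrite mul0r mulr0 subr0 psi_weight.
    move=> [_]; apply; move: cp => [/andP[_ q1] [/andP[_ q2] /andP[_ q3]]].
    by rewrite /Defs.D1 /= c1 c2 c3 !nL.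
  rewrite (indic_out _ cp) mul0r sub0r.
  have Dp : Defs.D2 L p.
    split; first by rewrite /= !ltW.
    move=> [/andP[_ q1] [/andP[_ q2] /andP[_ q3]]]; apply: cp.
    by rewrite /cube /= !ltW.
  rewrite indic_in // mul1r far; first by rewrite !mulNr.
  by have [] := D2_far off0 Dp.
split; first exact: (itg_ae cF mg i3 E).
by rewrite (I3_ae cF mg (itg_meas i3) E) I3B // I3Z //; exact: itg_D2.
Qed.

End Assembly.

(** * Conclusion *)

Section Decomposition.
Context {R : realType}.
Variables (alpha eps L K : R) (N : nat) (u : pt R -> R) (d : 'I_3 -> R) (x : pt R).
Hypotheses (L0 : 0 < L) (N0 : (0 < N)%N).
Hypotheses (a0 : 0 < alpha) (a2 : alpha < 2) (e0 : 0 < eps) (ae2 : alpha + eps <= 2).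
Hypotheses (K0 : 0 <= K) (um : meas u).
Local Notation T := (taylor_rem u d x).
Hypothesis HT : forall r, 0 < r ->
  (forall p, `|p| <= r -> `|T p| <= K * r `^ (alpha + eps) * r ^+ 2) /\
  (forall p q, `|p| <= r -> `|q| <= r ->
     `|T p - T q| <= K * r `^ (alpha + eps) * r * `|p - q|) /\
  (forall c v, `|c + v| <= r -> `|c - v| <= r ->
    `|T (c + v) + T (c - v) - 2 * T c| <= K * r `^ (alpha + eps) * `|v| ^+ 2).

Lemma psi_split : Defs.psi 2 u x =
  (fun p => nratio T p + (4 * d ord0) * qq ord0 p + (4 * d (@Ordinal 3 1 isT)) * qq (@Ordinal 3 1 isT) p
     + (4 * d (@Ordinal 3 2 isT)) * qq (@Ordinal 3 2 isT) p).
Proof.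
apply/funext => p; rewrite psiE /nratio /taylor_rem /secdiff /qq.
rewrite !big_ord_recl big_ord0.
have -> : lift ord0 ord0 = @Ordinal 3 1 isT by exact: val_inj.
have -> : lift ord0 (lift ord0 ord0) = @Ordinal 3 2 isT by exact: val_inj.
by ring.
Qed.

Lemma itg_psi : itg (fun p => \1_(cube L) p * (Defs.psi 2 u x p * weight alpha p)).
Proof.
have mT : meas T by exact: meas_taylor_rem.
have i1 := itg_ratio L0 a0 e0 ae2 K0 mT HT.
have i2 i := itgZ (4 * d i) (itg_qq L0 a0 e0 ae2 i).
have := itgD (itgD (itgD i1 (i2 ord0)) (i2 (@Ordinal 3 1 isT))) (i2 (@Ordinal 3 2 isT)).
by congr itg; apply/funext => p; rewrite psi_split; ring.
Qed.

Lemma qerr_psi : qerr L alpha N (Defs.psi 2 u x) = qerr L alpha N (nratio T).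
Proof.
have mT : meas T by exact: meas_taylor_rem.
have i1 := itg_ratio L0 a0 e0 ae2 K0 mT HT.
have i2 i : itg (fun p => \1_(cube L) p * (4 * d i * qq i p * weight alpha p)).
  have := itgZ (4 * d i) (itg_qq L0 a0 e0 ae2 i).
  by congr itg; apply/funext => p; ring.
have i3 : itg (fun p => \1_(cube L) p * ((nratio T p + 4 * d ord0 * qq ord0 p) * weight alpha p)).
  by have := itgD i1 (i2 ord0); congr itg; apply/funext => p; ring.
have i4 : itg (fun p => \1_(cube L) p * ((nratio T p + 4 * d ord0 * qq ord0 p +
   4 * d (@Ordinal 3 1 isT) * qq (@Ordinal 3 1 isT) p) * weight alpha p)).
  by have := itgD i3 (i2 (@Ordinal 3 1 isT)); congr itg; apply/funext => p; ring.
rewrite psi_split (qerrD N i4 (i2 _)) (qerrD N i3 (i2 _)) (qerrD N i1 (i2 _)).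
rewrite !qerrZ ?(qerr_qq L0 N0 a0 e0 ae2) ?mulr0 ?addr0 //;
  exact: (itg_qq L0 a0 e0 ae2).
Qed.

End Decomposition.

Lemma le_36_72 (R : realType) (a : R) : 0 <= a -> 36 * a <= 72 * a.
Proof. lra. Qed.

Theorem theorem4 (R : realType) (alpha : R) (ax bx ay by_ az bz : R)
  (u : pt R -> R) (eps : R) :
  0 < alpha < 2 ->
  ax < bx -> ay < by_ -> az < bz ->
  (forall p : pt R, ~ box ax bx ay by_ az bz p -> u p = 0) ->
  0 < eps <= 1 + (Num.floor alpha)%:~R - alpha ->
  holder_space (2 + `|Num.floor alpha|)%N (alpha - (Num.floor alpha)%:~R + eps) u ->
  let L := Num.max (bx - ax) (Num.max (by_ - ay) (bz - az)) in
  exists C : R, 0 < C /\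
  exists N0 : nat, forall N : nat, (0 < N)%N -> (N0 <= N)%N ->
    forall x : pt R, box ax bx ay by_ az bz x ->
      `|fraclap alpha u x - disc_fraclap alpha 2 L N u x| <= C * (hstep L N) ^+ 2.
Proof.
move=> a02 abx aby abz u0 eps0 hu L.
have [ae2 [ud [udd [K K0 HK]]]] := holder_second_difference a02 eps0 hu.
have [a0 a2] := andP a02; have [e0 _] := andP eps0.
have Lx : bx - ax <= L by rewrite le_max lexx.
have Ly : by_ - ay <= L by rewrite !le_max lexx orbT.
have Lz : bz - az <= L by rewrite !le_max lexx !orbT.
have L0 : 0 < L by apply: lt_le_trans Lx; rewrite subr_gt0.
have cu : continuous u by case: hu => _ [hc _]; exact: (hc [::] isT).
have um := continuous_meas cu.
have [M M0 uM] := bounded_support cu u0.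
set c := c_const 3 alpha; set I := I3 (fun p => \1_(cube L) p * dom eps p).
have ab0 : 0 <= alpha + eps by rewrite addr_ge0 // ltW.
(* The single factor 72 covers the constants 36, 36 and 72 of [taylor_rem_bounds]. *)
have HT x r : 0 < r -> let T := taylor_rem u (fun i => pder [:: i; i] u x) x in
  (forall p, `|p| <= r -> `|T p| <= (72 * K) * r `^ (alpha + eps) * r ^+ 2) /\
  (forall p q, `|p| <= r -> `|q| <= r ->
     `|T p - T q| <= (72 * K) * r `^ (alpha + eps) * r * `|p - q|) /\
  (forall c v, `|c + v| <= r -> `|c - v| <= r ->
    `|T (c + v) + T (c - v) - 2 * T c| <= (72 * K) * r `^ (alpha + eps) * `|v| ^+ 2).
  move=> r0 T.
  have [t0 [t1 t2]] := taylor_rem_bounds K0 ab0 ud udd HK x r0.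
  have X0 : 0 <= K * r `^ (alpha + eps) by rewrite mulr_ge0 // powR_ge0.
  split; [|split] => [p pr|p q pr qr|//].
  - apply: (le_trans (t0 p pr)).
    have -> : 36 * K * (r `^ (alpha + eps) * r ^+ 2) = 36 * (K * r `^ (alpha + eps) * r ^+ 2) by ring.
    have -> : 72 * K * r `^ (alpha + eps) * r ^+ 2 = 72 * (K * r `^ (alpha + eps) * r ^+ 2) by ring.
    by apply: le_36_72; rewrite mulr_ge0 // sqr_ge0.
  - apply: (le_trans (t1 p q pr qr)); rewrite ler_wpM2r //.
    have -> : 36 * K * (r `^ (alpha + eps) * r) = 36 * (K * r `^ (alpha + eps) * r) by ring.
    have -> : 72 * K * r `^ (alpha + eps) * r = 72 * (K * r `^ (alpha + eps) * r) by ring.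
    by apply: le_36_72; rewrite mulr_ge0 // ltW.
have K72 : 0 <= 72 * K by rewrite mulr_ge0.
(* [K] bounds the second differences of the Hessian at all points and [I] is a fixed integral, so
   the constant depends on neither x nor N. The summand 1 makes it positive even if the rest
   vanishes. *)
exists (`|c| * (cst_ratio (72 * K) * I) + 1); split.
  have I0 : 0 <= I.
    by apply: Rintegral_ge0 => p _; rewrite mulr_ge0 ?dom_ge0 // indicE.
  by rewrite ltr_wpDl // mulr_ge0 // mulr_ge0 // /cst_ratio mulr_ge0.
(* The estimate holds for every positive N, hence the threshold 0. *)
exists 0%N => N N0 _ x xO.
set d := fun i => pder [:: i; i] u x.
have ip := itg_psi L0 a0 e0 ae2 K72 um (HT x).
have far p := far_secdiff u0 xO Lx Ly Lz (p := p).
have [ig Ig] := octant_split a0 L0 um far ip.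
rewrite (fraclap_octant a0 M0 um uM ig) (disc_fraclapE _ _ _ _ N0) Ig.
(* The exterior term k is the same number in both operators and cancels, leaving - c times the
   quadrature error of [psi_2]. *)
have E : forall a b k : R, - (c * (a - k)) - - c * (b - k) = - c * (a - b).
  by move=> *; ring.
rewrite E -[I3 _ - _]/(qerr L alpha N (Defs.psi 2 u x)).
rewrite (qerr_psi L0 N0 a0 e0 ae2 K72 um (HT x)) normrM normrN mulrDl mul1r.
apply: ler_wpDr; first exact: sqr_ge0.
rewrite -mulrA ler_wpM2l // mulrAC.
apply: (qerr_ratio L0 N0 a0 e0 ae2 K72 _ (HT x)).
exact: meas_taylor_rem.
Qed.
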